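(* Let $\varphi=\frac{1+\sqrt5}{2}$, $\Gamma_0=\langle(\varphi,0),(1,\varphi+3)\rangle_{\mathbb{Z}}\subset\mathbb{R}^2$, let $R_0$ be the $\mathbb{Z}^2$-action on the torus $\mathbb{R}^2/\Gamma_0$ given by $R_0^{n}(x)=x+n$ for $n\in\mathbb{Z}^2$, let $\mathcal{P}_0=\{P_0,\dots,P_{10}\}$ be the topological partition of $\mathbb{R}^2/\Gamma_0$ described in the context, let $\mathcal{X}_{\mathcal{P}_0,R_0}$ be the symbolic dynamical system corresponding to $\mathcal{P}_0,R_0$, let $\sigma$ be the shift action, and let $\Omega_0$ be the Jeandel-Rao Wang shift. Then: (i) $\mathcal{X}_{\mathcal{P}_0,R_0}\subsetneq\Omega_0$ is a proper minimal and aperiodic subshift of $\Omega_0$; (ii) the partition $\mathcal{P}_0$ gives a symbolic representation of $(\mathbb{R}^2/\Gamma_0,\mathbb{Z}^2,R_0)$; (iii) the dynamical system $(\mathbb{R}^2/\Gamma_0,\mathbb{Z}^2,R_0)$ is the maximal equicontinuous factor of $(\mathcal{X}_{\mathcal{P}_0,R_0},\mathbb{Z}^2,\sigma)$; (iv) the set of fiber cardinalities of the factor map $f_0:\mathcal{X}_{\mathcal{P}_0,R_0}\to\mathbb{R}^2/\Gamma_0$ is $\{1,2,8\}$; (v) the dynamical system $(\mathcal{X}_{\mathcal{P}_0,R_0},\mathbb{Z}^2,\sigma)$ is strictly ergodic (uniquely ergodic and minimal), and the measure-preserving dynamical system $(\mathcal{X}_{\mathcal{P}_0,R_0},\mathbb{Z}^2,\sigma,\nu)$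 is isomorphic to $(\mathbb{R}^2/\Gamma_0,\mathbb{Z}^2,R_0,\lambda)$, where $\nu$ is the unique shift-invariant probability measure on $\mathcal{X}_{\mathcal{P}_0,R_0}$ and $\lambda$ is the Haar (probability) measure on $\mathbb{R}^2/\Gamma_0$.
   Context: Subshifts. For a finite set $\mathcal{A}$, $\mathcal{A}^{\mathbb{Z}^2}$ has the product topology and the shift action $(\sigma^{n}(x))_{m}=x_{m+n}$. A subshift is a closed shift-invariant subset. A nonempty subshift is aperiodic if the shift action on it is free; it is minimal if it contains no nonempty proper closed shift-invariant subset. Wang shifts. A Wang tile is a quadruple $\tau=(a,b,c,d)$ = (right, top, left, bottom) colors. For a finite set $\mathcal{T}$ of Wang tiles, the Wang shift $\Omega_{\mathcal{T}}\subset\mathcal{T}^{\mathbb{Z}^2}$ is the set of all $x:\mathbb{Z}^2\to\mathcal{T}$ such that for all $n$: right color of $x_{n}$ = left color of $x_{n+(1,0)}$ and top color of $x_n$ = bottom color of $x_{n+(0,1)}$. Jeandel-Rao tiles (right, top, left, bottom): $t_0=(2,4,2,1)$, $t_1=(2,2,2,0)$, $t_2=(1,1,3,1)$, $t_3=(1,2,3,2)$, $t_4=(3,1,3,3)$, $t_5=(0,1,3,1)$, $t_6=(0,0,0,1)$, $t_7=(3,1,0,2)$, $t_8=(0,2,1,2)$, $t_9=(1,2,1,4)$, $t_{10}=(3,3,1,2)$. Let $\mathcal{T}_0=\{t_0,\dots,t_{10}\}$ and $\Omega_0=\Omega_{\mathcal{T}_0}$; the tile $t_i$ is identified with its index $i$,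 so that $\Omega_0\subset\{0,\dots,10\}^{\mathbb{Z}^2}$. The partition $\mathcal{P}_0$. The rectangle $[0,\varphi)\times[0,\varphi+3)$ is a fundamental domain of $\mathbb{R}^2/\Gamma_0$. The atom $P_i$ (associated with tile $t_i$) is the image in $\mathbb{R}^2/\Gamma_0$ of the union of the interiors of the following polygons, given by their vertices in order. $P_0$: triangles $(0,0),(\varphi-1,0),(\varphi-1,1)$; $(\varphi-1,0),(1,0),(1,1)$; $(1,0),(\varphi,0),(\varphi,1)$. $P_1$: triangles $(0,0),(0,1),(\varphi-1,1)$; $(\varphi-1,0),(\varphi-1,1),(1,1)$; $(1,0),(1,1),(\varphi,1)$. $P_2$: $(0,2),(\varphi-1,\varphi+2),(0,\varphi+1)$. $P_3$: $(1,1),(\varphi,2),(\varphi,\varphi+2),(1,2)$. $P_4$: $(0,2),(1,\varphi+2),(1,\varphi+3)$. $P_5$: $(0,\varphi+1),(\varphi-1,\varphi+2),(1,\varphi+3),(2-\varphi,\varphi+2),(2-\varphi,\varphi+3),(0,\varphi+2)$. $P_6$: triangles $(0,\varphi+2),(2-\varphi,\varphi+3),(0,\varphi+3)$; $(2-\varphi,\varphi+2),(1,\varphi+3),(2-\varphi,\varphi+3)$; $(1,\varphi+2),(\varphi,\varphi+3),(1,\varphi+3)$. $P_7$: $(0,1),(1,\varphi+2),(0,2)$ and $(1,\varphi+1),(1,\varphi+2),(\varphi,\varphi+3),(\varphi,\varphi+2)$. $P_8$: $(\varphi-1,1),(\varphi,\varphi+2),(\varphi-1,2)$. $P_9$: triangles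 $(0,1),(\varphi-1,1),(\varphi-1,2)$; $(\varphi-1,1),(1,1),(1,2)$; $(1,1),(\varphi,1),(\varphi,2)$. $P_{10}$: $(0,1),(1,\varphi+1),(1,\varphi+2)$. Symbolic dynamical systems. A topological partition of a compact metric space $M$ is a finite collection $\mathcal{P}=\{P_a\}_{a\in\mathcal{A}}$ of disjoint open sets with $M=\bigcup_a\overline{P_a}$. Given a continuous $\mathbb{Z}^2$-action $R$ on $M$, a pattern $w\in\mathcal{A}^S$ ($S\subset\mathbb{Z}^2$ finite) is allowed if $\bigcap_{k\in S}R^{-k}(P_{w_k})\neq\varnothing$. The symbolic dynamical system $\mathcal{X}_{\mathcal{P},R}\subset\mathcal{A}^{\mathbb{Z}^2}$ corresponding to $\mathcal{P},R$ is the unique subshift whose language is the set of allowed patterns. For $w\in\mathcal{X}_{\mathcal{P},R}$ let $D_n(w)=\bigcap_{\|k\|\le n}R^{-k}(P_{w_k})$ with $\|k\|=|k_1|+|k_2|$. $\mathcal{P}$ gives a symbolic representation of $(M,\mathbb{Z}^2,R)$ if for every $w\in\mathcal{X}_{\mathcal{P},R}$ the set $\bigcap_{n\ge0}\overline{D_n(w)}$ consists of exactly one point. In that case, the factor map $f:\mathcal{X}_{\mathcal{P},R}\to M$ sends $w$ to this point; $f_0$ denotes this map for $\mathcal{P}_0,R_0$. Factors. A factor map between dynamical systems is a continuous, onto, equivariant map. An equicontinuous factor is a factor on which the group acts equicontinuously. The maximal equicontinuous factor of $(X,G,T)$ is an equicontinuous factor $\pi_{\max}:X\to X_{\max}$ such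 that every equicontinuous factor map $\theta:X\to Y$ factors as $\theta=\psi\circ\pi_{\max}$ for a unique factor map $\psi:X_{\max}\to Y$. The set of fiber cardinalities of a factor map $\theta:X\to Y$ is $\{\mathrm{card}(\theta^{-1}(y)):y\in Y\}$. Isomorphism of measure-preserving systems is in the usual sense (a measure-preserving equivariant measurable bijection between invariant sets of full measure). *)

(* Defs.v *)
From HB Require Import structures.
From mathcomp Require Import all_boot all_order all_algebra ring_quotient.
From mathcomp Require Import all_classical all_reals all_analysis.

Set Implicit Arguments.
Unset Strict Implicit.
Unset Printing Implicit Defensive.

Import Order.TTheory GRing.Theory Num.Theory.
Import numFieldNormedType.Exports.

Local Open Scope classical_set_scope.
Local Open Scope ring_scope.
Local Open Scope quotient_scope.

Notation Z2 := (int * int)%type.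

Section Dynamics.
Variable R : realType.
Implicit Types X Y : topologicalType.

(* A Z^2-system is given by a subset A of an ambient space X and maps T n of X
   of which only the restriction to A matters; this way subshifts need not be
   turned into types of their own. *)
Definition invariant_set X (T : Z2 -> X -> X) (A : set X) : Prop :=
  forall n x, A x -> A (T n x).

Definition dynamical_system X (A : set X) (T : Z2 -> X -> X) : Prop :=
  [/\ compact A,
      invariant_set T A,
      forall x, A x -> T 0 x = x,
      forall m n x, A x -> T (m + n) x = T m (T n x) &
      forall n, {within A, continuous (T n)}].

Definition minimal_system X (A : set X) (T : Z2 -> X -> X) : Prop :=
  forall B : set X,
    B `<=` A -> B !=set0 -> closed B -> invariant_set T B -> B = A.

Definition factor_map X Y (A : set X) (T : Z2 -> X -> X)
    (B : set Y) (S : Z2 -> Y -> Y) (f : X -> Y) : Prop :=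
  [/\ {within A, continuous f},
      f @` A = B &
      forall n x, A x -> f (T n x) = S n (f x)].

Definition metric_inducing_topology Y (d : Y -> Y -> R) : Prop :=
  [/\ forall x y, d x y = 0 <-> x = y,
      forall x y, d x y = d y x,
      forall x y z, d x z <= d x y + d y z &
      forall x (U : set Y),
        nbhs x U <-> exists2 e, 0 < e & [set y | d x y < e] `<=` U].

(* All the metrics inducing a given compact topology are uniformly equivalent,
   so the condition does not depend on the choice of d. *)
Definition equicontinuous_action Y (S : Z2 -> Y -> Y) : Prop :=
  exists2 d : Y -> Y -> R, metric_inducing_topology d &
    forall e, 0 < e -> exists2 r, 0 < r &
      forall x y, d x y < r -> forall n, d (S n x) (S n y) < e.

Definition equicontinuous_factor X Y (A : set X) (T : Z2 -> X -> X)
    (S : Z2 -> Y -> Y) (f : X -> Y) : Prop :=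
  [/\ dynamical_system [set: Y] S,
      equicontinuous_action S &
      factor_map A T [set: Y] S f].

Definition maximal_equicontinuous_factor X Y (A : set X) (T : Z2 -> X -> X)
    (S : Z2 -> Y -> Y) : Prop :=
  exists2 pi_max : X -> Y, equicontinuous_factor A T S pi_max &
    forall (Z : topologicalType) (U : Z2 -> Z -> Z) (theta : X -> Z),
      equicontinuous_factor A T U theta ->
      exists! psi : Y -> Z,
        factor_map [set: Y] S [set: Z] U psi /\
        forall x, A x -> theta x = psi (pi_max x).

(* The fibers of f : A -> B are finite, and N is the set of their
   cardinalities. *)
Definition fiber_cardinalities X Y (A : set X) (B : set Y) (f : X -> Y)
    (N : set nat) : Prop :=
  (forall y, B y -> exists2 n, N n & ((A `&` f @^-1` [set y]) #= `I_n)%card) /\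
  (forall n, N n -> exists2 y, B y & ((A `&` f @^-1` [set y]) #= `I_n)%card).

End Dynamics.

Notation borel X := (g_sigma_algebraType (@open X)).

Section MeasurableDynamics.
Variable R : realType.
Implicit Types X Y : ptopologicalType.

(* Borel probability measures on A are seen as Borel probability measures on
   the ambient space that are carried by A. *)
Definition invariant_probability X (A : set X) (T : Z2 -> X -> X)
    (mu : probability (borel X) R) : Prop :=
  mu A = 1%E /\
  forall n (B : set (borel X)), measurable B -> mu (T n @^-1` B) = mu B.

Definition unique_invariant_probability X (A : set X) (T : Z2 -> X -> X)
    (mu : probability (borel X) R) : Prop :=
  invariant_probability A T mu /\
  forall mu' : probability (borel X) R, invariant_probability A T mu' ->
    forall B : set (borel X), measurable B -> mu' B = mu B.

Definition uniquely_ergodic X (A : set X) (T : Z2 -> X -> X) : Prop :=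
  exists mu : probability (borel X) R, unique_invariant_probability A T mu.

Definition strictly_ergodic X (A : set X) (T : Z2 -> X -> X) : Prop :=
  uniquely_ergodic A T /\ minimal_system A T.

Definition full_measure_invariant X (A : set X) (T : Z2 -> X -> X)
    (mu : probability (borel X) R) (A' : set (borel X)) : Prop :=
  [/\ A' `<=` A, measurable A', mu A' = 1%E & invariant_set T A'].

Definition isomorphic_mps X Y
    (A : set X) (T : Z2 -> X -> X) (mu : probability (borel X) R)
    (B : set Y) (S : Z2 -> Y -> Y) (nu : probability (borel Y) R) : Prop :=
  exists (A' : set (borel X)) (B' : set (borel Y)) (h : borel X -> borel Y),
    [/\ full_measure_invariant A T mu A',
        full_measure_invariant B S nu B',
        set_bij A' B' h,
        forall n x, A' x -> h (T n x) = S n (h x) &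
        [/\ measurable_fun A' h,
            forall C, C `<=` A' -> measurable C -> measurable (h @` C) &
            forall C, measurable C -> mu (A' `&` h @^-1` C) = nu C]].

End MeasurableDynamics.

Section SymbolicDynamics.
Variable k : nat.

Definition config := {ptws Z2 -> discrete_topology 'I_k.+1}.
HB.instance Definition _ := Topological.on config.
HB.instance Definition _ := isPointed.Build config (fun=> ord0).

Definition shift_action (n : Z2) (x : config) : config := fun m => x (m + n).

Definition subshift (X : set config) : Prop :=
  closed X /\ invariant_set shift_action X.

Definition aperiodic (X : set config) : Prop :=
  X !=set0 /\ forall x n, X x -> shift_action n x = x -> n = 0.

(* A pattern with support S is given by any configuration extending it. *)
Definition in_language (X : set config) (S : set Z2) (w : config) : Prop :=
  exists2 x, X x & forall n, S n -> x n = w n.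

Definition wang_tile := (nat * nat * nat * nat)%type.
Definition right_color (t : wang_tile) := t.1.1.1.
Definition top_color (t : wang_tile) := t.1.1.2.
Definition left_color (t : wang_tile) := t.1.2.
Definition bottom_color (t : wang_tile) := t.2.

Definition wang_shift (t : 'I_k.+1 -> wang_tile) : set config :=
  [set x | forall n : Z2,
     right_color (t (x n)) = left_color (t (x (n + (1, 0)))) /\
     top_color (t (x n)) = bottom_color (t (x (n + (0, 1))))].

Section Coding.
Variables (M : topologicalType) (P : 'I_k.+1 -> set M) (T : Z2 -> M -> M).

Definition topological_partition : Prop :=
  [/\ forall a, open (P a),
      trivIset setT P &
      \bigcup_a closure (P a) = setT].

(* T^{-n}(P_a) is the preimage of P_a under T n. *)
Definition allowed (S : set Z2) (w : config) : Prop :=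
  (\bigcap_(n in S) T n @^-1` P (w n)) !=set0.

(* At most one subshift has a given language. *)
Definition is_symbolic_system (X : set config) : Prop :=
  subshift X /\
  forall S w, finite_set S -> in_language X S w <-> allowed S w.

Definition cylinder (n : nat) (w : config) : set M :=
  \bigcap_(m in [set m : Z2 | (`|m.1| + `|m.2| <= n)%N]) T m @^-1` P (w m).

Definition coded_points (w : config) : set M :=
  \bigcap_n closure (cylinder n w).

Definition symbolic_representation (X : set config) : Prop :=
  forall w, X w -> exists x, coded_points w = [set x].

End Coding.

End SymbolicDynamics.

Section JeandelRao.

Definition jeandel_rao_tiles : seq wang_tile :=
  [:: (2, 4, 2, 1); (2, 2, 2, 0); (1, 1, 3, 1); (1, 2, 3, 2); (3, 1, 3, 3);
      (0, 1, 3, 1); (0, 0, 0, 1); (3, 1, 0, 2); (0, 2, 1, 2); (1, 2, 1, 4);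
      (3, 3, 1, 2)]%N.

Definition Omega0 : set (config 10) :=
  wang_shift (fun i : 'I_11 => nth (0, 0, 0, 0)%N jeandel_rao_tiles i).

Variable R : realType.
Local Notation R2 := (R * R)%type.

Definition phi : R := (1 + Num.sqrt 5) / 2.

Definition Gamma0 : {pred R2} :=
  [pred x : R2 | `[< exists m n : int,
                      x = (phi, 0) *~ m + (1, phi + 3) *~ n >]].

Lemma Gamma0_zmod_closed : zmod_closed Gamma0.
Proof.
split=> [|x y /asboolP[m [n ->]] /asboolP[p [q ->]]]; apply/asboolP.
  by exists 0, 0; rewrite !mulr0z addr0.
by exists (m - p), (n - q); rewrite !mulrzBr opprD addrACA.
Qed.
HB.instance Definition _ := GRing.isZmodClosed.Build R2 Gamma0 Gamma0_zmod_closed.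

(* The library has the group structure and the topology of the quotient on two
   distinct aliases of it; torus carries both. *)
Definition torus := @quotient_topology R2 {ideal_quot Gamma0}.
HB.instance Definition _ := Topological.on torus.
HB.instance Definition _ := GRing.isZmodule.Build torus
  (@ring_quotient.Quotient.addqA R2 Gamma0)
  (@ring_quotient.Quotient.addqC R2 Gamma0)
  (@ring_quotient.Quotient.add0q R2 Gamma0)
  (@ring_quotient.Quotient.addNq R2 Gamma0).
HB.instance Definition _ := isPointed.Build torus 0.

Definition torus_proj (x : R2) : torus := \pi_torus x.

Definition R0 (n : Z2) (x : torus) : torus := x + torus_proj (n.1%:~R, n.2%:~R).

Definition haar_probability (lambda : probability (borel torus) R) : Prop :=
  forall (t : torus) (B : set (borel torus)), measurable B ->
    lambda [set t + x | x in B] = lambda B.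

Definition segment (a b : R2) : set R2 :=
  [set a + s *: (b - a) | s in `[0, 1]].

(* v lists the vertices in order; the last one is joined to the first one.  When
   this closed curve is simple, the interior of the polygon is the bounded
   connected component of its complement. *)
Definition polygon_boundary (v : seq R2) : set R2 :=
  [set p | exists2 e, e \in zip v (rot 1 v) & segment e.1 e.2 p].

Definition polygon_interior (v : seq R2) : set R2 :=
  [set p | ~ polygon_boundary v p /\
           bounded_set (connected_component (~` polygon_boundary v) p)].

Definition polygons0 : seq (seq (seq R2)) :=
  [:: [:: [:: (0, 0); (phi - 1, 0); (phi - 1, 1)];
          [:: (phi - 1, 0); (1, 0); (1, 1)];
          [:: (1, 0); (phi, 0); (phi, 1)]];
      [:: [:: (0, 0); (0, 1); (phi - 1, 1)];
          [:: (phi - 1, 0); (phi - 1, 1); (1, 1)];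
          [:: (1, 0); (1, 1); (phi, 1)]];
      [:: [:: (0, 2); (phi - 1, phi + 2); (0, phi + 1)]];
      [:: [:: (1, 1); (phi, 2); (phi, phi + 2); (1, 2)]];
      [:: [:: (0, 2); (1, phi + 2); (1, phi + 3)]];
      [:: [:: (0, phi + 1); (phi - 1, phi + 2); (1, phi + 3);
              (2 - phi, phi + 2); (2 - phi, phi + 3); (0, phi + 2)]];
      [:: [:: (0, phi + 2); (2 - phi, phi + 3); (0, phi + 3)];
          [:: (2 - phi, phi + 2); (1, phi + 3); (2 - phi, phi + 3)];
          [:: (1, phi + 2); (phi, phi + 3); (1, phi + 3)]];
      [:: [:: (0, 1); (1, phi + 2); (0, 2)];
          [:: (1, phi + 1); (1, phi + 2); (phi, phi + 3); (phi, phi + 2)]];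
      [:: [:: (phi - 1, 1); (phi, phi + 2); (phi - 1, 2)]];
      [:: [:: (0, 1); (phi - 1, 1); (phi - 1, 2)];
          [:: (phi - 1, 1); (1, 1); (1, 2)];
          [:: (1, 1); (phi, 1); (phi, 2)]];
      [:: [:: (0, 1); (1, phi + 1); (1, phi + 2)]]].

Definition P0 (i : 'I_11) : set torus :=
  [set torus_proj p | p in [set p | exists2 v,
     v \in nth [::] polygons0 i & polygon_interior v p]].

End JeandelRao.

(* Main.v *)
Require Import Defs.
From HB Require Import structures.
From Stdlib Require Import ZArith.
From mathcomp Require Import all_boot all_order all_algebra ring_quotient.
From mathcomp Require Import all_classical all_reals all_analysis.
From mathcomp Require Import measurable_realfun ring lra zify ssrZ.

Set Implicit Arguments.
Unset Strict Implicit.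
Unset Printing Implicit Defensive.

Import Order.TTheory GRing.Theory Num.Theory.
Import numFieldNormedType.Exports.

Local Open Scope classical_set_scope.
Local Open Scope ring_scope.

(** Let X0 be the set of configurations all of whose finite patterns are allowed.

    The edges of the polygons lie on lines of four kinds, namely those on which
    one of the functions x, y, y - phi x, y - (phi + 1) x is constant, and the
    constants are in Z[phi].  The four directions cut the plane into eight open
    sectors.  Around any point p, the part of a small disk that lies in one
    sector k is covered by a single atom, the germ at (p, k) ([germ_ex],
    [germ_uniq]).  Recording the germs at (p + m, k) for m in Z^2 defines the
    configuration [code p k]; it is a limit of itineraries of points that
    approach p inside the sector k.  Whatever depends on the polygons themselves
    (they tile the fundamental domain; the atoms of t and of its translates by
    (1, 0) and (0, 1) have matching colors) reduces to finitely many systems of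
    linear inequalities over Z[phi], which are decided by computation
    ([covered], [separated]).

    Orbits in the torus are dense because phi is irrational.  If the closed atoms
    of a configuration contain the orbits of both t and u, then by density the
    closure of the triangle P_2 is stable under the translation by u - t, and a
    triangle that small admits none but 0 ([triangle2_rigid],
    [closure_determines]).  So every configuration of X0 codes a single point
    ([X0_representation]).  An allowed pattern is realized on a whole open set,
    which the orbit of any t visits: hence all configurations over t show this
    pattern at a common place ([pattern_recurrence]).  This gives minimality, and
    it shows that the configurations over one point are proximal, so that they
    have the same image in every equicontinuous factor ([torus_maximal]).

    X0 is not the whole Wang shift: in the code of 0 from below the horizontal
    axis, the row of height 0 is constant, and sliding the lower half-plane along
    it gives another tiling.  Since a half-plane of a configuration already
    determines the point that it codes, the new tiling would code both 0 and its
    image under R0 (1, 0) ([X0_proper]).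

    The configurations over the image of p are the eight codes of p
    ([fiber_code]), and two of them agree exactly when their sectors are on the
    same side of each line through p that carries edges, that is, for each of
    the four functions whose value at p is in Z[phi] ([code_eqP]).  If two of
    the values are in Z[phi] then all four are ([golden_two_lines]), so there are
    0, 1 or 4 such lines, and the fiber has 1, 2 or 8 elements.

    An invariant probability on the torus is invariant under a dense group of
    translations, hence under all of them on open sets; averaging over the torus
    with Fubini's theorem identifies it with the Haar measure ([haar_unique]).
    The points whose orbit meets the boundary of the partition are covered by
    countably many lines and their Haar measure is 0.  Outside this set the
    coding is inverse to the factor map, which transports unique ergodicity and
    yields the isomorphism ([shift_measure_unique], [X0_isomorphic]). *)

(** * The ring Z[phi] *)

Section Golden.
Variable R : realType.
Local Notation phi := (phi R).

Lemma phi_sq : phi * phi = phi + 1.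
Proof.
have h : (Num.sqrt 5 : R) ^+ 2 = 5 by rewrite sqr_sqrtr.
by rewrite /Defs.phi; field: h.
Qed.

Lemma phi_bounds : 144 / 89 < phi < 233 / 144.
Proof.
have h : (Num.sqrt 5 : R) ^+ 2 = 5 by rewrite sqr_sqrtr.
have h0 : 0 <= (Num.sqrt 5 : R) by exact: sqrtr_ge0.
rewrite expr2 in h.
by apply/andP; split; rewrite /Defs.phi; nra.
Qed.

(** The norm a^2 + ab - b^2 of a + b phi vanishes only at 0: if it is even then
    so are a and b, which allows an infinite descent. *)
Lemma golden_norm_eq0 (a b : int) : a * a + a * b - b * b = 0 -> a = 0 /\ b = 0.
Proof.
have [n] := ubnP `|b|%N; elim: n a b => // n IH a b; rewrite ltnS => bn eq0.
have [b0|b0] := eqVneq b 0; first by move: eq0; rewrite b0; nia.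
have [c aE] : exists c, a = 2 * c.
  exists (divz a 2).
  have := divz_eq a 2; have := ltz_pmod a (isT : 0 < 2 :> int).
  have := modz_ge0 a (isT : 2 != 0 :> int).
  have := divz_eq b 2; have := ltz_pmod b (isT : 0 < 2 :> int).
  have := modz_ge0 b (isT : 2 != 0 :> int).
  move: (divz a 2) (modz a 2) (divz b 2) (modz b 2) => c r d s.
  move=> s0 s2 bE r0 r2 aE.
  have [r0E|r1] : r = 0 \/ r = 1 by lia.
    lia.
  have [sE|sE] : s = 0 \/ s = 1 by lia.
    by move: eq0; rewrite aE bE r1 sE; lia.
  by move: eq0; rewrite aE bE r1 sE; lia.
have [d bE] : exists d, b = 2 * d.
  exists (divz b 2).
  have := divz_eq b 2; have := ltz_pmod b (isT : 0 < 2 :> int).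
  have := modz_ge0 b (isT : 2 != 0 :> int).
  move: (divz b 2) (modz b 2) => d s s0 s2 bE.
  have [sE|sE] : s = 0 \/ s = 1 by lia.
    by lia.
  by move: eq0; rewrite aE bE sE; lia.
have [||c0 d0] := IH c d; last by rewrite aE bE c0 d0.
  by lia.
by move: eq0; rewrite aE bE; lia.
Qed.

Definition golden (x : R) := exists a b : int, x = a%:~R + b%:~R * phi.

Lemma golden_eq0 (a b : int) : a%:~R + b%:~R * phi = 0 -> a = 0 /\ b = 0.
Proof.
move=> h; apply: golden_norm_eq0; apply/eqP; rewrite -(intr_eq0 R); apply/eqP.
rewrite rmorphB rmorphD !rmorphM /=.
have -> : a%:~R = - (b%:~R * phi) by apply/eqP; rewrite -addr_eq0 h.
by ring: phi_sq.
Qed.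

Lemma golden_int (a : int) : golden a%:~R.
Proof. by exists a, 0; rewrite mul0r addr0. Qed.

Lemma golden0 : golden 0. Proof. exact: (golden_int 0). Qed.
Lemma golden1 : golden 1. Proof. exact: (golden_int 1). Qed.

Lemma goldenD x y : golden x -> golden y -> golden (x + y).
Proof.
by move=> [a [b ->]] [c [d ->]]; exists (a + c), (b + d); rewrite !rmorphD; ring.
Qed.

Lemma goldenN x : golden x -> golden (- x).
Proof. by move=> [a [b ->]]; exists (- a), (- b); rewrite !rmorphN; ring. Qed.

Lemma goldenB x y : golden x -> golden y -> golden (x - y).
Proof. by move=> gx gy; apply: goldenD => //; exact: goldenN. Qed.

Lemma goldenM x y : golden x -> golden y -> golden (x * y).
Proof.
move=> [a [b ->]] [c [d ->]]; exists (a * c + b * d), (a * d + b * c + b * d).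
by rewrite !rmorphD !rmorphM /=; ring: phi_sq.
Qed.

Lemma golden_phi : golden phi.
Proof. by exists 0, 1; rewrite add0r mul1r. Qed.

Lemma golden_half (x : R) : golden x -> x + x != 1.
Proof.
move=> [a [b ->]]; apply/eqP => h.
have [|a0 b0] := @golden_eq0 (a + a - 1) (b + b); last by lia.
by rewrite !(rmorphD, rmorphB) /= -[X in _ = X](subrr 1) -{3}h; ring.
Qed.

(** Powers of phi - 1 = 1 / phi. *)
Lemma golden_small (e : R) : 0 < e ->
  exists a b : int, 0 < a%:~R + b%:~R * phi < e /\ b != 0.
Proof.
wlog : e / e < 1 => [wl e0|e1 e0].
  have [e1|e1] := ltP e 1; first exact: wl.
  have [||a [b [/andP[h1 h2] b0]]] := wl (1 / 2); [lra|lra|].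
  by exists a, b; split => //; rewrite h1 /=; lra.
have /andP[p1 p2] := phi_bounds.
have c : `|phi - 1| < 1 by rewrite ger0_norm; lra.
have /cvgrPdist_lt /(_ e e0) [n _ /(_ n)] := cvg_expr c.
rewrite /= leqnn sub0r normrN normrX ger0_norm; last by lra.
move=> /(_ isT) he.
have pos : 0 < (phi - 1) ^+ n by rewrite exprn_gt0; lra.
have [a [b ab]] : golden ((phi - 1) ^+ n).
  elim: (n) => [|k IH]; first by rewrite expr0; exact: golden1.
  by rewrite exprS; apply: goldenM => //; apply: goldenB golden1; exact: golden_phi.
exists a, b; rewrite -ab pos he; split => //; apply/eqP => b0.
move: he pos; rewrite ab b0 mul0r addr0 => ae; rewrite ltr0z => a0.
have : (a%:~R : R) < 1 by lra.
by rewrite (_ : 1 = 1%:~R) // ltr_int; lia.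
Qed.

(** The multiples of a small element delta of Z[phi] come close to any x - K with
    K an integer.  A large K of the right sign makes the multiple large, hence
    also the coefficient of phi. *)
Lemma golden_dense (x e : R) (N : int) (s : bool) : 0 < e ->
  exists a b : int, `|a%:~R + b%:~R * phi - x| < e /\
    if s then N <= b else b <= N.
Proof.
move=> e0; have [c [d [/andP[]]]] := golden_small e0.
set delta := _ + _ => de0 dee d0.
pose M : int := `|N|%:Z + 1.
have M0 : 0 < M by rewrite /M; lia.
have [K HK] : exists K : int, let j := Num.floor ((x - K%:~R) / delta) in
    if s == (0 < d) then M <= j else j <= - M.
  have hb (z : R) : `|z| < (Num.bound `|z|)%:R := archi_boundP (normr_ge0 z).
  have := hb (x - M%:~R * delta); have := hb (x + M%:~R * delta).
  set B := Num.bound `|x + _|; set C := Num.bound `|x - _|.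
  move=> /ltr_normlP[hB1 hB2] /ltr_normlP[hC1 hC2].
  case: (s == _); [exists (- C%:Z) | exists B%:Z].
    by rewrite /= floor_ge_int ler_pdivlMr // rmorphN /=; lra.
  rewrite /= -ltzD1 floor_lt_int ltr_pdivrMr // rmorphD rmorphN /=.
  by lra.
pose j := Num.floor ((x - K%:~R) / delta).
exists (K + j * c), (j * d); split.
  have /andP[] := floor_itv ((x - K%:~R) / delta).
  rewrite -/j ler_pdivlMr // ltr_pdivrMr // !rmorphD /= => h1 h2.
  rewrite (_ : _ - x = j%:~R * delta - (x - K%:~R)); last first.
    by rewrite /delta !rmorphM /=; ring.
  by apply/ltr_normlP; split; lra.
move: HK; rewrite /= -/j; move: j => j; rewrite /M.
have [d1|d1] : 0 < d \/ d < 0 by lia.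
  by rewrite d1; case: (s) => /=; nia.
by rewrite (_ : 0 < d = false); [case: (s) => /=; nia | lia].
Qed.
End Golden.

(** * The torus *)

Section Torus.
Variable R : realType.
Local Notation phi := (phi R).
Local Notation R2 := (R * R)%type.
Local Notation proj := (@torus_proj R).

Lemma int_nonunit_eq0 (k : int) (c : R) : 1 <= c -> -1 < k%:~R * c < 1 -> k = 0.
Proof.
have [k1|[k1|//]] : 1 <= k \/ 1 <= - k \/ k = 0 by lia.
  rewrite -(ler1z R) in k1 => c1 kc.
  by exfalso; have := mulr_ege1 k1 c1; lra.
rewrite -(ler1z R) rmorphN /= in k1 => c1 kc.
by exfalso; have := mulr_ege1 k1 c1; lra.
Qed.

Lemma absz_bounds (N : int) : - (`|N|%N%:R) <= (N%:~R : R) <= `|N|%N%:R.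
Proof. by rewrite !pmulrn -rmorphN !ler_int; lia. Qed.

Lemma pair_norm_lt (z : R2) (e : R) : (`|z| < e) = (`|z.1| < e) && (`|z.2| < e).
Proof. by rewrite prod_normE gt_max. Qed.

Lemma pair_mulrz (a b : R) (m : int) : ((a, b) : R2) *~ m = (a *~ m, b *~ m).
Proof.
have pairMn n : ((a, b) : R2) *+ n = (a *+ n, b *+ n).
  by elim: n => [|n IH]; rewrite ?mulr0n // !mulrS IH.
by case: m => n; rewrite /intmul ?NegzE /= pairMn.
Qed.

(** All later computations in the quotient go through these two coordinates. *)
Lemma proj_eq (x y : R2) : proj x = proj y <->
  exists m n : int, x.1 = y.1 + m%:~R * phi + n%:~R /\
                    x.2 = y.2 + n%:~R * (phi + 3).
Proof.
have pE : (proj x = proj y) <-> (x - y \in @Gamma0 R).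
  rewrite Quotient.idealrBE; split; first by move=> h; apply/eqP.
  by move=> /eqP.
rewrite pE; case: x y {pE} => x1 x2 [y1 y2]; split.
  move=> /asboolP[m [n]]; rewrite !pair_mulrz => xy; exists m, n.
  have h1 : x1 - y1 = phi *~ m + 1 *~ n := congr1 fst xy.
  have h2 : x2 - y2 = 0 *~ m + (phi + 3) *~ n := congr1 snd xy.
  rewrite -(mulrzl phi) in h1; rewrite mul0rz -(mulrzl (phi + 3)) in h2.
  by split => /=; lra.
move=> [m [n [/= h1 h2]]]; apply/asboolP; exists m, n.
rewrite !pair_mulrz mul0rz -(mulrzl phi) -(mulrzl (phi + 3)).
by congr pair; rewrite /= ?h1 ?h2; ring.
Qed.

Lemma projD (x y : R2) : proj (x + y) = proj x + proj y.
Proof. exact: (@Quotient.pi_add _ (@Gamma0 R)). Qed.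

Lemma proj0 : proj 0 = 0.
Proof. by apply: (@addrI _ (proj 0)); rewrite -projD !addr0. Qed.

Lemma projN (x : R2) : proj (- x) = - proj x.
Proof. by apply/eqP; rewrite -addr_eq0 -projD addNr proj0. Qed.

Lemma proj_surj (t : torus R) : exists x, proj x = t.
Proof. by exists (repr t); rewrite /torus_proj reprK. Qed.

Definition vec (n : Z2) : R2 := (n.1%:~R, n.2%:~R).

Lemma vecD m n : vec (m + n) = vec m + vec n.
Proof. by rewrite /vec !rmorphD. Qed.

Lemma R0_proj n (x : R2) : R0 n (proj x) = proj (x + vec n).
Proof. by rewrite projD. Qed.

Lemma R0E n (t : torus R) : R0 n t = t + proj (vec n). Proof. by []. Qed.

Lemma R0_0 (t : torus R) : R0 0 t = t.
Proof. by rewrite R0E (_ : vec 0 = 0) ?proj0 ?addr0. Qed.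

Lemma R0D m n (t : torus R) : R0 (m + n) t = R0 m (R0 n t).
Proof. by rewrite !R0E vecD projD -addrA [proj _ + _]addrC. Qed.

(** A period is a relation between 1 and phi over the integers. *)
Lemma R0_free n (t : torus R) : R0 n t = t -> n = 0.
Proof.
have [x <-] := proj_surj t; rewrite R0_proj => /proj_eq[a [b /= [h1 h2]]].
have [|e1 e2] := @golden_eq0 R (3 * b - n.2) b.
  by rewrite rmorphB rmorphM /=; lra.
have [|e3 e4] := @golden_eq0 R (b - n.1) a.
  by rewrite rmorphB /=; lra.
by case: n h1 h2 e1 e3 => /= n1 n2 _ _ e1 e3; congr pair; rewrite /=; lia.
Qed.

Lemma torus_proj_continuous : continuous proj.
Proof. exact: pi_continuous. Qed.

Lemma torus_proj_open (U : set R2) : open U -> open (proj @` U).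
Proof.
move=> oU; rewrite /open /= /quotient_open.
rewrite (_ : _ @^-1` _ = \bigcup_(v in [set v | proj v = 0]) ((+%R v) @^-1` U)).
  apply: bigcup_open => v _; apply: open_comp => // x _.
  by apply: cvgD; [exact: cvg_cst | exact: cvg_id].
apply/seteqP; split=> [x [u Uu /= ux]|x [v v0 Uv]]; last first.
  by exists (v + x) => //=; rewrite projD v0 add0r.
exists (u - x); last by rewrite /= subrK.
by rewrite /= projD projN ux subrr.
Qed.

Lemma translate_continuous (s : torus R) : continuous (fun t => t + s).
Proof.
have [v <-] := proj_surj s; apply/quotient_continuous => x.
rewrite (_ : _ \o _ = proj \o (fun x => x + v)); last first.
  by apply/funext => y /=; rewrite projD.
apply: continuous_comp; last exact: torus_proj_continuous.
by apply: cvgD; [exact: cvg_id | exact: cvg_cst].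
Qed.

Lemma R0_continuous n : continuous (@R0 R n).
Proof. exact: translate_continuous. Qed.

(** The flags choose, for each coordinate, which of the two sides of the
    fundamental domain is closed: a point on a side must be moved to the side
    from which a given sector enters the domain. *)
Lemma proj_domain (x : R2) (s1 s2 : bool) : exists y : R2, [/\ proj y = proj x,
  if s1 then 0 <= y.1 < phi else 0 < y.1 <= phi &
  if s2 then 0 <= y.2 < phi + 3 else 0 < y.2 <= phi + 3].
Proof.
have /andP[p1 p2] := phi_bounds R.
have fl (s : bool) (c z : R) : 0 < c -> exists k : int,
    if s then 0 <= z - k%:~R * c < c else 0 < z - k%:~R * c <= c.
  move=> c0; case: s.
    exists (Num.floor (z / c)).
    have /andP[] := floor_itv (z / c).
    by rewrite ler_pdivlMr // ltr_pdivrMr // rmorphD /= => h1 h2; lra.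
  exists (- Num.floor (- z / c) - 1).
  have /andP[] := floor_itv (- z / c).
  by rewrite ler_pdivlMr // ltr_pdivrMr // rmorphB rmorphN rmorphD /= => h1 h2; lra.
have [|k hk] := fl s2 (phi + 3) x.2; first lra.
have [|j hj] := fl s1 phi (x.1 - k%:~R); first lra.
exists (x.1 - k%:~R - j%:~R * phi, x.2 - k%:~R * (phi + 3)); split => //.
by apply/proj_eq; exists (- j), (- k) => /=; rewrite !rmorphN /=; split; ring.
Qed.

Lemma torus_compact : compact [set: torus R].
Proof.
rewrite (_ : setT = proj @` (`[0, phi] `*` `[0, phi + 3])).
  apply: continuous_compact; last by apply: compact_setX; exact: segment_compact.
  by apply: continuous_subspaceT => x; exact: torus_proj_continuous.
apply/seteqP; split=> // t _; have [x <-] := proj_surj t.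
have [y [<- h1 h2]] := proj_domain x true true; exists y => //.
by split; rewrite /= in_itv /=; lra.
Qed.

(** The quotient norm; it makes the translations of the torus isometries. *)
Definition qnorm (t : torus R) : R := inf [set `|z| | z in [set z | proj z = t]].

Lemma qnorm_lt t e : qnorm t < e <-> exists2 z, proj z = t & `|z| < e.
Proof.
have [x xt] := proj_surj t; split.
  move=> /inf_lt [|_ [z zt <-]]; first by exists `|x|, x.
  by move=> ?; exists z.
move=> [z zt]; apply: le_lt_trans; apply: ge_inf; last by exists z.
by exists 0 => _ [u _ <-].
Qed.

(** The lattice has no nonzero vector of norm less than 1. *)
Lemma proj_small (x : R2) : `|x| < 1 -> proj x = 0 -> x = 0.
Proof.
have /andP[p1 p2] := phi_bounds R.
rewrite pair_norm_lt => /andP[/ltr_normlP[a1 a2] /ltr_normlP[b1 b2]].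
rewrite -proj0 => /proj_eq[m [n []]].
rewrite (_ : (0 : R2).1 = 0) // (_ : (0 : R2).2 = 0) // !add0r => h1 h2.
have n0 : n = 0 by apply: (@int_nonunit_eq0 _ (phi + 3)); [lra | lra].
have m0 : m = 0.
  by apply: (@int_nonunit_eq0 _ phi); [lra | rewrite n0 mulr0z in h1; lra].
move: h1 h2; rewrite m0 n0 mulr0z !mul0r addr0.
by case: x {a1 a2 b1 b2} => /= a b -> ->.
Qed.

Definition torus_dist (s t : torus R) := qnorm (t - s).

Lemma torus_dist_metric : metric_inducing_topology torus_dist.
Proof.
have qge0 t : 0 <= qnorm t.
  by rewrite leNgt; apply/negP => /qnorm_lt[z _]; rewrite ltNge normr_ge0.
split.
- move=> s t; split; last first.
    move=> ->; apply/eqP; rewrite eq_le qge0 andbT leNgt; apply/negP => h.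
    suff : qnorm (t - t) < qnorm (t - t) by rewrite ltxx.
    by apply/qnorm_lt; exists 0; rewrite ?normr0 // subrr proj0.
  move=> d0; have [|x xt x1] := (qnorm_lt (t - s) (1 / 3)).1.
    by rewrite -/(torus_dist s t) d0; lra.
  suff x0 : x = 0 by apply/esym/eqP; rewrite -subr_eq0 -xt x0 proj0.
  apply: contrapT => /eqP; rewrite -normr_gt0 => x0.
  have [|y yt yx] := (qnorm_lt (t - s) `|x|).1; first by rewrite -/(torus_dist s t) d0.
  suff /eqP : x - y = 0 by rewrite subr_eq0 => /eqP xy; move: yx; rewrite xy ltxx.
  apply: proj_small; last by rewrite projD projN xt yt subrr.
  by rewrite (le_lt_trans (ler_normB _ _)) //; lra.
- move=> s t; rewrite /torus_dist; congr inf; apply/seteqP.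
  by split=> _ [z zt <-]; exists (- z); rewrite ?normrN //= projN zt opprB.
- move=> r s t; rewrite leNgt; apply/negP.
  have dlt u v c : torus_dist u v < c <-> exists2 z, proj z = v - u & `|z| < c.
    exact: qnorm_lt.
  have := dlt r s; have := dlt s t; have := (dlt r t (torus_dist r t)).2.
  move: (torus_dist r t) (torus_dist r s) (torus_dist s t) => a b c ha hc hb abc.
  have [|x xt x1] := (hb (b + (a - b - c) / 2)).1; first by lra.
  have [|y yt y1] := (hc (c + (a - b - c) / 2)).1; first by lra.
  suff : a < a by rewrite ltxx.
  apply: ha; exists (x + y); first by rewrite projD xt yt addrC addrA subrK.
  by rewrite (le_lt_trans (ler_normD _ _)) //; lra.
- move=> t U; have [x xt] := proj_surj t; split.
    move=> tU; have : nbhs x (proj @^-1` U) by apply: torus_proj_continuous; rewrite /= xt.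
    move=> /nbhs_ballP[e /= e0 he]; exists e => // s /qnorm_lt[z zt ze].
    have -> : s = proj (x + z) by rewrite projD zt xt addrC subrK.
    by apply: he; rewrite -ball_normE /= opprD addrA subrr sub0r normrN.
  move=> [e e0 he].
  apply: (@filterS _ _ _ (proj @` ball x e)).
    move=> _ [y xy <-]; apply: he; apply/qnorm_lt; exists (y - x).
      by rewrite projD projN xt.
    by rewrite distrC; move: xy; rewrite -ball_normE.
  apply: open_nbhs_nbhs; split; last by exists x => //; exact: ballxx.
  by apply: torus_proj_open; exact: ball_open.
Qed.

Lemma R0_equicontinuous : equicontinuous_action R (@R0 R).
Proof.
exists torus_dist; first exact: torus_dist_metric.
move=> e e0; exists e => // s t st n.
by rewrite /torus_dist !R0E opprD addrACA subrr addr0.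
Qed.

Lemma metric_hausdorff (Y : topologicalType) (d : Y -> Y -> R) :
  metric_inducing_topology d -> hausdorff_space Y.
Proof.
move=> [d0 dC dD dN] p q pq; apply/d0.
have dpp x : d x x = 0 by apply/d0.
have d_ge0 x y : 0 <= d x y by have := dD x y x; rewrite dpp (dC y x); lra.
apply/eqP; rewrite eq_le d_ge0 andbT leNgt; apply/negP => dpq.
have h x : nbhs x [set y | d x y < d p q / 2] by apply/dN; exists (d p q / 2); [lra|].
have [z [/= h1 h2]] := pq _ _ (h p) (h q).
by have := dD p z q; rewrite (dC z q); lra.
Qed.

Lemma torus_hausdorff : hausdorff_space (torus R).
Proof. exact: metric_hausdorff torus_dist_metric. Qed.

(** Modulo the lattice, a vector (a + b phi, c + d phi) with integer coefficients
    is an element n of Z^2, and n.2 = c - 3 d.  By density in each coordinate,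
    with d large of a chosen sign, already the elements of a half-plane of Z^2
    have dense orbits. *)
Lemma orbit_dense (t : torus R) (U : set (torus R)) (N : int) (s : bool) :
  open U -> U !=set0 ->
  exists2 m : Z2, U (R0 m t) & if s then N <= m.2 else m.2 <= N.
Proof.
move=> oU [t' Ut']; have [x <-] := proj_surj t.
have [u ut] := proj_surj t'; rewrite -ut in Ut'.
have : nbhs u (proj @^-1` U) by apply: torus_proj_continuous; exact: open_nbhs_nbhs.
move=> /nbhs_ballP[e0 /= e00 he0].
pose e := Num.min e0 1; have e_gt0 : 0 < e by rewrite /e lt_min e00 ltr01.
have he v : `|u - v| < e -> U (proj v).
  by rewrite /e lt_min => /andP[h _]; apply: he0; rewrite -ball_normE.
have e1 : e <= 1 by rewrite /e ge_min lexx orbT.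
have /andP[p1 p2] := phi_bounds R.
pose M : int := (Num.bound `|u.2 - x.2|)%:Z + `|N|%:Z + 1.
have [A [B [AB hB]]] := golden_dense (u.2 - x.2) (if s then - M else M) (~~ s) e_gt0.
have [C [D [CD _]]] := golden_dense (u.1 - x.1) 0 true e_gt0.
exists (C - B, A - 3 * B).
  rewrite R0_proj; have -> : proj (x + vec (C - B, A - 3 * B)) =
      proj (x.1 + (C%:~R + D%:~R * phi), x.2 + (A%:~R + B%:~R * phi)).
    apply/proj_eq; exists (- D), (- B).
    by rewrite /= !rmorphB rmorphM !rmorphN /=; split; ring.
  apply: he; rewrite pair_norm_lt /=; apply/andP; split.
    by rewrite -normrN; move: CD; congr (`|_| < _); ring.
  by rewrite -normrN; move: AB; congr (`|_| < _); ring.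
have := archi_boundP (normr_ge0 (u.2 - x.2)).
move=> /ltr_normlP[b1 b2]; move: AB => /ltr_normlP[ab1 ab2].
have phi0 : 0 <= phi by lra.
have /andP[N2 N1] := absz_bounds N.
have N0 : (0 : R) <= `|N|%N%:R by [].
have ME : M%:~R = (Num.bound `|u.2 - x.2|)%:R + `|N|%N%:R + 1 :> R.
  by rewrite /M !rmorphD.
have Mphi : (M%:~R : R) <= M%:~R * phi.
  by rewrite ler_peMr //; lra.
case: (s) hB => /=; rewrite -!(ler_int R) !rmorphB !rmorphM ?rmorphN /= => hB.
  by have := ler_wpM2r phi0 hB; lra.
by have := ler_wpM2r phi0 hB; lra.
Qed.

End Torus.

(** * Deciding the incidences of polygons over Z[phi] *)

Delimit Scope Z_scope with BZ.

(** The pair (a, b) stands for a + b phi.  Binary integers are used so that the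
    checks below can be evaluated. *)
Definition zphi := (Z * Z)%type.
Definition zadd (x y : zphi) : zphi := (Z.add x.1 y.1, Z.add x.2 y.2).
Definition zopp (x : zphi) : zphi := (Z.opp x.1, Z.opp x.2).
Definition zmul (x y : zphi) : zphi :=
  (Z.add (Z.mul x.1 y.1) (Z.mul x.2 y.2),
   Z.add (Z.add (Z.mul x.1 y.2) (Z.mul x.2 y.1)) (Z.mul x.2 y.2)).
Definition zsub x y := zadd x (zopp y).

(** Sufficient for a + b phi > 0, from 144 / 89 < phi < 233 / 144; these Fibonacci
    quotients are sharp enough for all the numbers that occur below. *)
Definition zpos (x : zphi) : bool :=
  if Z.leb 0 x.2 then Z.ltb 0 (Z.add (Z.mul 89 x.1) (Z.mul 144 x.2))
  else Z.ltb 0 (Z.add (Z.mul 144 x.1) (Z.mul 233 x.2)).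
Definition zeq0 (x : zphi) : bool := Z.eqb x.1 0 && Z.eqb x.2 0.
Definition znneg (x : zphi) : bool := zpos x || zeq0 x.

(** (a, b, c) stands for the function a x + b y + c. *)
Definition affine := (zphi * zphi * zphi)%type.
Definition aneg (L : affine) : affine := (zopp L.1.1, zopp L.1.2, zopp L.2).
Definition adet (L M : affine) : zphi :=
  zsub (zmul L.1.1 M.1.2) (zmul L.1.2 M.1.1).

(** A certificate that L > 0 wherever all the members of Q are positive: by
    Cramer's rule, det(M, N) L = det(L, N) M + det(M, L) N + constant. *)
Definition entails (Q : seq affine) (L : affine) : bool :=
  has (fun M => has (fun N =>
    let k := adet M N in
    zpos k &&
    (let a := adet L N in let b := adet M L in
     [&& znneg a, znneg b, zpos a || zpos b &
         znneg (zsub (zmul k L.2) (zadd (zmul a M.2) (zmul b N.2)))])) Q) Q.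

(** As in [separated], only contradictions between one of the inequalities and
    two others are tried; this suffices for polygons and triangles. *)
Definition infeasible (Q : seq affine) : bool :=
  has (fun L => entails Q (aneg L)) Q.

Definition separated (Q Q' : seq affine) : bool :=
  has (fun L => entails Q' (aneg L)) Q || has (fun L => entails Q (aneg L)) Q'.

Section Split.
Variable rest_covered : seq affine -> bool.
Fixpoint split_covered (D Q : seq affine) : bool :=
  if Q is L :: Q' then
    if entails D L then split_covered D Q'
    else if entails D (aneg L) then rest_covered D
    else rest_covered (aneg L :: D) && split_covered (L :: D) Q'
  else true.
End Split.

(** The region defined by D is covered, up to boundaries, by the regions Qs: the
    sides of the first of the Qs cut D into pieces, each of which is either inside
    it, or must be covered by the rest. *)
Fixpoint covered (D : seq affine) (Qs : seq (seq affine)) : bool :=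
  if Qs is Q :: Qs' then split_covered (fun D' => covered D' Qs') D Q
  else infeasible D.

(** (j, s, c) is the open half-plane where the j-th of the functions x, y,
    y - phi x, y - (phi + 1) x is greater (s = true) or less (s = false) than c. *)
Definition halfplane := (nat * bool * zphi)%type.

Definition zform (j : nat) : zphi * zphi :=
  match j with
  | 0 => ((1, 0), (0, 0))%BZ
  | 1 => ((0, 0), (1, 0))%BZ
  | 2 => ((0, -1), (1, 0))%BZ
  | _ => ((-1, -1), (1, 0))%BZ
  end.

Definition affine_of (L : halfplane) : affine :=
  let: (j, s, c) := L in
  let a := ((zform j).1, (zform j).2, zopp c) in if s then a else aneg a.

Definition zpoint := (zphi * zphi)%type.
Definition zlin (j : nat) (p : zpoint) : zphi :=
  zadd (zmul (zform j).1 p.1) (zmul (zform j).2 p.2).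

Definition edge_class (e : zpoint * zpoint) : nat :=
  let dx := zsub e.2.1 e.1.1 in let dy := zsub e.2.2 e.1.2 in
  if zeq0 dx then 0 else if zeq0 dy then 1
  else if zeq0 (zsub dy (zmul (0, 1)%BZ dx)) then 2 else 3.

Definition edge_halfplane (v : seq zpoint) (e : zpoint * zpoint) : halfplane :=
  let j := edge_class e in let c := zlin j e.1 in
  (j, has (fun p => zpos (zsub (zlin j p) c)) v, c).

Definition edges (T : Type) (v : seq T) := zip v (rot 1 v).

(** Each edge contributes the side of its line on which other vertices are found. *)
Definition convex_region v := [seq edge_halfplane v e | e <- edges v].

(** The point (a + b phi, c + d phi). *)
Notation "<( a , b ; c , d )>" := (((a, b), (c, d))%BZ : zpoint)
  (a at level 69, b at level 69, c at level 69, d at level 69).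

Definition zpolygons0 : seq (seq (seq zpoint)) :=
  [:: [:: [:: <(0,0; 0,0)>; <(-1,1; 0,0)>; <(-1,1; 1,0)>];
          [:: <(-1,1; 0,0)>; <(1,0; 0,0)>; <(1,0; 1,0)>];
          [:: <(1,0; 0,0)>; <(0,1; 0,0)>; <(0,1; 1,0)>]];
      [:: [:: <(0,0; 0,0)>; <(0,0; 1,0)>; <(-1,1; 1,0)>];
          [:: <(-1,1; 0,0)>; <(-1,1; 1,0)>; <(1,0; 1,0)>];
          [:: <(1,0; 0,0)>; <(1,0; 1,0)>; <(0,1; 1,0)>]];
      [:: [:: <(0,0; 2,0)>; <(-1,1; 2,1)>; <(0,0; 1,1)>]];
      [:: [:: <(1,0; 1,0)>; <(0,1; 2,0)>; <(0,1; 2,1)>; <(1,0; 2,0)>]];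
      [:: [:: <(0,0; 2,0)>; <(1,0; 2,1)>; <(1,0; 3,1)>]];
      [:: [:: <(0,0; 1,1)>; <(-1,1; 2,1)>; <(1,0; 3,1)>;
              <(2,-1; 2,1)>; <(2,-1; 3,1)>; <(0,0; 2,1)>]];
      [:: [:: <(0,0; 2,1)>; <(2,-1; 3,1)>; <(0,0; 3,1)>];
          [:: <(2,-1; 2,1)>; <(1,0; 3,1)>; <(2,-1; 3,1)>];
          [:: <(1,0; 2,1)>; <(0,1; 3,1)>; <(1,0; 3,1)>]];
      [:: [:: <(0,0; 1,0)>; <(1,0; 2,1)>; <(0,0; 2,0)>];
          [:: <(1,0; 1,1)>; <(1,0; 2,1)>; <(0,1; 3,1)>; <(0,1; 2,1)>]];
      [:: [:: <(-1,1; 1,0)>; <(0,1; 2,1)>; <(-1,1; 2,0)>]];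
      [:: [:: <(0,0; 1,0)>; <(-1,1; 1,0)>; <(-1,1; 2,0)>];
          [:: <(-1,1; 1,0)>; <(1,0; 1,0)>; <(1,0; 2,0)>];
          [:: <(1,0; 1,0)>; <(0,1; 1,0)>; <(0,1; 2,0)>]];
      [:: [:: <(0,0; 1,0)>; <(1,0; 1,1)>; <(1,0; 2,1)>]]].

(** The only polygon that is not convex is the hexagon of P_5.  Its reentrant
    vertex is (2 - phi, phi + 2), and it is the union of two convex
    regions, each bounded by one of the edges through this vertex. *)
Definition hexagon_hull : seq halfplane :=
  [:: (2, true, (1, 1)%BZ); (3, true, (2, 0)%BZ); (3, false, (2, 1)%BZ);
      (0, true, (0, 0)%BZ)].
Definition hexagon_regions : seq (seq halfplane) :=
  [:: (0, false, (2, -1)%BZ) :: hexagon_hull; (2, false, (3, 0)%BZ) :: hexagon_hull].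

Definition polygon_regions (v : seq zpoint) : seq (seq halfplane) :=
  if size v == 6 then hexagon_regions else [:: convex_region v].

Definition atom_regions : seq (seq (seq halfplane)) :=
  [seq flatten [seq polygon_regions v | v <- vs] | vs <- zpolygons0].

Definition regions (a : nat) := nth [::] atom_regions a.

Definition domain : seq halfplane :=
  [:: (0, true, (0, 0)%BZ); (0, false, (0, 1)%BZ);
      (1, true, (0, 0)%BZ); (1, false, (3, 1)%BZ)].

Definition shift (t : zpoint) (L : halfplane) : halfplane :=
  (L.1.1, L.1.2, zsub L.2 (zlin L.1.1 t)).

Definition affines := map affine_of.

Definition check_domain :=
  all (all (fun Q => all (entails (affines Q)) (affines domain))) atom_regions.

(** Whenever a translate of the atom b by - t meets the atom a, then r a b. *)
Definition check_pairs (r : rel nat) (t : zpoint) :=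
  all (fun a => all (fun b => r a b ||
    all (fun Q => all (fun Q' => separated (affines Q) (affines (map (shift t) Q')))
      (regions b)) (regions a)) (iota 0 11)) (iota 0 11).

Definition check_cover := covered (affines domain) (map affines (flatten atom_regions)).

Definition tile (a : nat) := nth (0,0,0,0)%N jeandel_rao_tiles a.
Definition matchH : rel nat := fun a b => right_color (tile a) == left_color (tile b).
Definition matchV : rel nat := fun a b => top_color (tile a) == bottom_color (tile b).

(* The translation vectors are those that bring R0 (1, 0) and R0 (0, 1) of the
   fundamental domain back to it: (1, 0) and (1 - phi, 0) for the former; (0, 1),
   (0, 1) - (1, phi + 3) and (0, 1) + (phi, 0) - (1, phi + 3) for the latter. *)
Lemma check_domainE : check_domain. Proof. by vm_compute. Qed.
Lemma check_coverE : check_cover. Proof. by vm_compute. Qed.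
Lemma check_disjointE : check_pairs eq_op <(0,0;0,0)>. Proof. by vm_compute. Qed.
Lemma check_right1E : check_pairs matchH <(1,0;0,0)>. Proof. by vm_compute. Qed.
Lemma check_right2E : check_pairs matchH <(1,-1;0,0)>. Proof. by vm_compute. Qed.
Lemma check_up1E : check_pairs matchV <(0,0;1,0)>. Proof. by vm_compute. Qed.
Lemma check_up2E : check_pairs matchV <(-1,0;-2,-1)>. Proof. by vm_compute. Qed.
Lemma check_up3E : check_pairs matchV <(-1,1;-2,-1)>. Proof. by vm_compute. Qed.

Section Soundness.
Variable R : realType.
Local Notation phi := (phi R).
Local Notation R2 := (R * R)%type.

Definition zval (z : zphi) : R :=
  (int_of_Z z.1)%:~R + (int_of_Z z.2)%:~R * phi.
Definition pval (t : zpoint) : R2 := (zval t.1, zval t.2).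
Definition aval (L : affine) (p : R2) : R :=
  zval L.1.1 * p.1 + zval L.1.2 * p.2 + zval L.2.
Definition lin (j : nat) (p : R2) : R :=
  match j with
  | 0 => p.1
  | 1 => p.2
  | 2 => p.2 - phi * p.1
  | _ => p.2 - (phi + 1) * p.1
  end.
Definition hval (L : halfplane) (p : R2) : R :=
  let: (j, s, c) := L in if s then lin j p - zval c else zval c - lin j p.

Lemma zval_add x y : zval (zadd x y) = zval x + zval y.
Proof. by rewrite /zval /zadd /= !(rmorphD int_of_Z) !rmorphD; ring. Qed.

Lemma zval_opp x : zval (zopp x) = - zval x.
Proof. by rewrite /zval /zopp /= !(rmorphN int_of_Z) !rmorphN; ring. Qed.

Lemma zval_sub x y : zval (zsub x y) = zval x - zval y.
Proof. by rewrite /zsub zval_add zval_opp. Qed.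

Lemma zval_mul x y : zval (zmul x y) = zval x * zval y.
Proof.
rewrite /zval /zmul /= !(rmorphD int_of_Z) !(rmorphM int_of_Z) !rmorphD !rmorphM /=.
by ring: (phi_sq R).
Qed.

Lemma golden_zval z : golden (zval z).
Proof. by eexists; eexists; reflexivity. Qed.

Lemma zpos_gt0 z : zpos z -> 0 < zval z.
Proof.
have /andP[p1 p2] := phi_bounds R.
case: z => a b; rewrite /zpos /zval -[(a, b).1]/a -[(a, b).2]/b.
set A : int := int_of_Z a; set B : int := int_of_Z b.
case: ifP => b0 ab.
  have B0 : 0 <= B by rewrite /B; lia.
  have : 0 < 89 * A + 144 * B by rewrite /A /B; lia.
  rewrite -(ltr0z R) rmorphD !rmorphM /=; rewrite -(ler0z R) in B0.
  by have := ler_wpM2l B0 (ltW p1); lra.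
have B0 : 0 <= - B by rewrite /B; lia.
have : 0 < 144 * A + 233 * B by rewrite /A /B; lia.
rewrite -(ltr0z R) rmorphD !rmorphM /=.
rewrite -(ler0z R) rmorphN /= in B0.
by have := ler_wpM2l B0 (ltW p2); lra.
Qed.

Lemma zeq0_eq0 z : zeq0 z -> zval z = 0.
Proof.
case: z => a b; rewrite /zeq0 /zval /= => /andP[/Z.eqb_spec -> /Z.eqb_spec ->].
by rewrite /= mul0r addr0.
Qed.

Lemma znneg_ge0 z : znneg z -> 0 <= zval z.
Proof. by move=> /orP[/zpos_gt0/ltW|/zeq0_eq0->]. Qed.

Lemma aval_neg L p : aval (aneg L) p = - aval L p.
Proof. by rewrite /aval /aneg /= !zval_opp; ring. Qed.

Lemma entails_gt0 Q L p :
  (forall M, M \in Q -> 0 < aval M p) -> entails Q L -> 0 < aval L p.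
Proof.
move=> Qp /hasP[M MQ /hasP[N NQ /= /andP[k0 /and4P[a0 b0 ab c0]]]].
have := Qp M MQ; have := Qp N NQ.
have := zpos_gt0 k0; have := znneg_ge0 a0; have := znneg_ge0 b0.
have := znneg_ge0 c0.
have {ab} : 0 < zval (adet L N) \/ 0 < zval (adet M L).
  by case/orP: ab => /zpos_gt0; [left|right].
have : zval (adet M N) * aval L p =
    zval (adet L N) * aval M p + zval (adet M L) * aval N p +
    zval (zsub (zmul (adet M N) L.2)
               (zadd (zmul (adet L N) M.2) (zmul (adet M L) N.2))).
  by rewrite /aval !(zval_sub, zval_add, zval_mul); ring.
move: (zval (zsub _ _)) (zval (adet M N)) (zval (adet L N)) (zval (adet M L)) => c k a b.
move: (aval L p) (aval M p) (aval N p) => l m n e ab c0' b0' a0' k0' n0 m0.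
rewrite -(pmulr_rgt0 _ k0') e.
have am : 0 <= a * m by rewrite mulr_ge0 // ltW.
have bn : 0 <= b * n by rewrite mulr_ge0 // ltW.
case: ab => h; first by have : 0 < a * m by [rewrite mulr_gt0]; lra.
by have : 0 < b * n by [rewrite mulr_gt0]; lra.
Qed.

Definition in_region (Q : seq halfplane) (p : R2) :=
  forall L, L \in Q -> 0 < hval L p.

Lemma zval_pair a b : zval (a, b) = (int_of_Z a)%:~R + (int_of_Z b)%:~R * phi.
Proof. by []. Qed.

(* The literals that occur in the coordinates of the vertices. *)
Lemma int_of_Z_lit : (int_of_Z 0 = 0) * (int_of_Z 1 = 1) * (int_of_Z 2 = 2) *
  (int_of_Z 3 = 3) * (int_of_Z (-1)%BZ = -1) * (int_of_Z (-2)%BZ = -2).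
Proof. by []. Qed.

Lemma zform_lin j (p : R2) :
  zval (zform j).1 * p.1 + zval (zform j).2 * p.2 = lin j p.
Proof.
by case: j => [|[|[|j]]]; rewrite /= !zval_pair !int_of_Z_lit; ring.
Qed.

Lemma hvalE L p : hval L p = aval (affine_of L) p.
Proof.
case: L => [[j s] c]; rewrite /hval -zform_lin /affine_of.
by case: s; rewrite /aval /= !zval_opp; ring.
Qed.

Lemma in_region_aval Q p :
  in_region Q p -> forall M, M \in affines Q -> 0 < aval M p.
Proof. by move=> Qp _ /mapP[L LQ ->]; rewrite -hvalE; exact: Qp. Qed.

Lemma infeasible_false Q p :
  infeasible Q -> (forall M, M \in Q -> 0 < aval M p) -> False.
Proof.
move=> /hasP[L LQ /entails_gt0 h] Qp.
by have := h _ Qp; have := Qp _ LQ; rewrite aval_neg; lra.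
Qed.

Lemma separated_false Q Q' p : separated (affines Q) (affines Q') ->
  in_region Q p -> in_region Q' p -> False.
Proof.
move=> h /in_region_aval Qp /in_region_aval Qp'.
by case/orP: h => /hasP[L LQ /entails_gt0 h];
  [have := h _ Qp'; have := Qp _ LQ | have := h _ Qp; have := Qp' _ LQ];
  rewrite aval_neg; lra.
Qed.

(** Points on the sides of the regions are excluded: at each cut, a point of D is
    then strictly on one side. *)
Lemma covered_mem D Qs p : covered D Qs ->
  (forall M, M \in D -> 0 < aval M p) ->
  (forall Q M, Q \in Qs -> M \in Q -> aval M p != 0) ->
  exists2 Q, Q \in Qs & forall M, M \in Q -> 0 < aval M p.
Proof.
elim: Qs D => [|Q Qs IH] D /=; first by move=> /infeasible_false h /h.
set split := split_covered _ => spl Dp Qsp.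
suff [Qp|[Q0 Q0Qs h]] : (forall M, M \in Q -> 0 < aval M p) \/
    exists2 Q0, Q0 \in Qs & forall M, M \in Q0 -> 0 < aval M p.
- by exists Q => //; rewrite mem_head.
- by exists Q0 => //; rewrite in_cons Q0Qs orbT.
have Qp M : M \in Q -> aval M p != 0 by apply: Qsp; rewrite mem_head.
have {}IH D' : covered D' Qs -> (forall M, M \in D' -> 0 < aval M p) ->
    exists2 Q0, Q0 \in Qs & forall M, M \in Q0 -> 0 < aval M p.
  move=> h h'; apply: (IH D') => // Q0 M Q0Qs; apply: Qsp.
  by rewrite in_cons Q0Qs orbT.
elim: Q D {Qsp} Qp spl Dp => [|L Q IHQ] D Qp /=; first by left.
have {}IHQ D' : split D' Q -> (forall M, M \in D' -> 0 < aval M p) ->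
    0 < aval L p -> (forall M, M \in L :: Q -> 0 < aval M p) \/
    exists2 Q0, Q0 \in Qs & forall M, M \in Q0 -> 0 < aval M p.
  move=> h h' L0; have [|Q0|e] := IHQ D' _ h h'; last by right.
    by move=> M MQ; apply: Qp; rewrite in_cons MQ orbT.
  by left=> M; rewrite in_cons => /orP[/eqP->|/Q0].
case: ifP => [h spl Dp|_].
  exact: IHQ spl Dp (entails_gt0 Dp h).
case: ifP => [_ /IH h /h|_ /andP[cov spl] Dp]; first by right.
have [L0|L0|L0] := ltgtP 0 (aval L p).
- apply: (IHQ _ spl _ L0) => M; rewrite in_cons => /orP[/eqP->|MD].
    exact: L0.
  exact: Dp.
- right; apply: IH cov _ => M; rewrite in_cons => /orP[/eqP->|]; last exact: Dp.
  by rewrite aval_neg oppr_gt0.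
- by have := Qp L (mem_head _ _); rewrite -L0 eqxx.
Qed.

Lemma zval_lin j t : zval (zlin j t) = lin j (pval t).
Proof. by rewrite /zlin zval_add !zval_mul -zform_lin. Qed.

Lemma linD j p q : lin j (p + q) = lin j p + lin j q.
Proof. by case: j => [|[|[|j]]] //=; rewrite /lin /=; ring. Qed.

Lemma linN j p : lin j (- p) = - lin j p.
Proof. by case: j => [|[|[|j]]] //=; rewrite /lin /=; ring. Qed.

Lemma linZ j (a : R) (p : R2) : lin j (a *: p) = a * lin j p.
Proof. by case: j => [|[|[|j]]] //=; rewrite /lin /= /GRing.scale /=; ring. Qed.

Lemma hval_shift t L p : hval (shift t L) p = hval L (p + pval t).
Proof.
case: L => [[j s] c]; rewrite /shift /hval /= zval_sub zval_lin linD.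
by case: s; ring.
Qed.

Lemma in_region_shift t Q p :
  in_region (map (shift t) Q) p <-> in_region Q (p + pval t).
Proof.
split=> h L; first by rewrite -hval_shift => LQ; apply: h; exact: map_f.
by move=> /mapP[M MQ ->]; rewrite hval_shift; exact: h.
Qed.

Lemma regions_default a : (11 <= a)%N -> regions a = [::].
Proof. by move=> ha; rewrite /regions nth_default. Qed.

Lemma region_index a Q : Q \in regions a -> (a < 11)%N.
Proof. by move=> Qa; rewrite ltnNge; apply: contraL Qa => /regions_default->. Qed.

Lemma region_domain a Q p : Q \in regions a -> in_region Q p ->
  (0 < p.1 < phi) && (0 < p.2 < phi + 3).
Proof.
move=> Qa /in_region_aval Qp.
have /allP/(_ (regions a)) := check_domainE.
rewrite mem_nth ?(region_index Qa) // => /(_ isT)/allP/(_ Q Qa)/allP h.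
have {}h L : L \in domain -> 0 < hval L p.
  by move=> Ld; rewrite hvalE; apply: entails_gt0 Qp (h _ _); exact: map_f.
have := h (0, true, (0, 0)%BZ) isT; have := h (0, false, (0, 1)%BZ) isT.
have := h (1, true, (0, 0)%BZ) isT; have := h (1, false, (3, 1)%BZ) isT.
rewrite /hval /= !zval_pair !int_of_Z_lit => h1 h2 h3 h4.
by apply/andP; split; apply/andP; split; lra.
Qed.

Lemma pairs_sound (r : rel nat) t a b Q Q' p : check_pairs r t ->
  Q \in regions a -> Q' \in regions b -> in_region Q p ->
  in_region Q' (p + pval t) -> r a b.
Proof.
move=> h Qa Qb Qp /in_region_shift Qp'.
have ha : a \in iota 0 11 by rewrite mem_iota (region_index Qa).
have hb : b \in iota 0 11 by rewrite mem_iota (region_index Qb).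
move: h => /allP/(_ a ha)/allP/(_ b hb)/orP[//|].
by move=> /allP/(_ _ Qa)/allP/(_ _ Qb)/separated_false h'; case: (h' p).
Qed.

Lemma cover_sound p : 0 < p.1 < phi -> 0 < p.2 < phi + 3 ->
  (forall Q L, Q \in flatten atom_regions -> L \in Q -> hval L p != 0) ->
  exists a Q, Q \in regions a /\ in_region Q p.
Proof.
move=> p1 p2 h.
have [||Q' /mapP[Q Qf ->] Qp] := covered_mem (p := p) check_coverE.
- move=> _ /mapP[L Ld ->]; rewrite -hvalE.
  by move: Ld; rewrite !inE => /or4P[] /eqP ->; rewrite /hval /= !zval_pair !int_of_Z_lit; lra.
- by move=> _ _ /mapP[Q Qf ->] /mapP[L LQ ->]; rewrite -hvalE; exact: h Qf LQ.
have /flattenP[A AQ QA] := Qf.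
exists (index A atom_regions), Q; rewrite /regions nth_index //; split=> // L LQ.
by rewrite hvalE; apply: Qp; exact: map_f.
Qed.

End Soundness.

(** * The interiors of the polygons *)

Definition hzval (L : halfplane) (t : zpoint) : zphi :=
  let: (j, s, c) := L in if s then zsub (zlin j t) c else zsub c (zlin j t).

Definition hopp (L : halfplane) : halfplane := (L.1.1, ~~ L.1.2, L.2).

Definition edge_bounds (L M N : halfplane) (e : zpoint * zpoint) : bool :=
  [&& zeq0 (hzval L e.1), zeq0 (hzval L e.2), zeq0 (hzval M e.1),
      zpos (hzval M e.2), zpos (hzval N e.1) & zeq0 (hzval N e.2)].

(** The polygon lies on the inner side of each of its edges, and each edge is cut
    out of its line by two other sides. *)
Definition convex_ok (v : seq zpoint) : bool :=
  all (fun e => let L := edge_halfplane v e in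
    all (fun e' => znneg (hzval L e'.1) && znneg (hzval L e'.2)) (edges v) &&
    has (fun M => has (fun N => edge_bounds L M N e) (convex_region v))
      (convex_region v)) (edges v).

Definition hexagon : seq zpoint :=
  [:: <(0,0; 1,1)>; <(-1,1; 2,1)>; <(1,0; 3,1)>;
      <(2,-1; 2,1)>; <(2,-1; 3,1)>; <(0,0; 2,1)>].

Lemma convex_okE :
  all (all (fun v => if size v == 6 then v == hexagon else convex_ok v)) zpolygons0.
Proof. by vm_compute. Qed.

Section Polygons.
Variable R : realType.
Local Notation phi := (phi R).
Local Notation R2 := (R * R)%type.

(** A polygon is identified with Q by connectedness: Q is open and closed in the
    complement of the boundary, so a component that meets Q stays in Q and is
    bounded; a component outside of Q contains a ray and is unbounded. *)
Lemma polygon_interiorP (v : seq R2) (Q : set R2) :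
  open Q -> bounded_set Q -> (forall p, Q p -> ~ polygon_boundary v p) ->
  closed (Q `|` polygon_boundary v) ->
  (forall p, ~ Q p -> ~ polygon_boundary v p ->
    exists2 w, w != 0 & forall t, 0 <= t -> ~ polygon_boundary v (p + t *: w)) ->
  polygon_interior v = Q.
Proof.
move=> oQ bQ Qbd cQ esc; apply/seteqP; split=> p.
  move=> [pbd [M [_ hM]]]; apply: contrapT => Qp.
  have [w w0 hw] := esc p Qp pbd.
  have ray : (fun t => p + t *: w) @` `[0, +oo[ `<=`
      connected_component (~` polygon_boundary v) p.
    apply: connected_component_max.
    - by exists 0; rewrite ?scale0r ?addr0 //= in_itv /= lexx.
    - by move=> _ [t t0 <-]; apply: hw; move: t0; rewrite /= in_itv /= andbT.
    apply: connected_continuous_connected.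
      by apply/connected_intervalP; exact: interval_is_interval.
    apply: continuous_subspaceT => t.
    by apply: cvgD; [exact: cvg_cst | apply: cvgZr_tmp; exact: cvg_id].
  have wn : 0 < `|w| by rewrite normr_gt0.
  pose N := Num.max M 0 + 1; have N0 : 0 < N.
    by rewrite /N ltr_wpDl // le_max lexx orbT.
  have MN : M < N by rewrite /N ltr_pwDr // le_max lexx.
  pose t := (N + `|p| + 1) / `|w|.
  have t0 : 0 <= t by rewrite /t divr_ge0 // addr_ge0 // addr_ge0 // ltW.
  have : `|p + t *: w| <= N.
    by apply: (hM N MN); apply: ray; exists t => //=; rewrite in_itv /= t0.
  have := lerB_normD (t *: w) p.
  rewrite normrZ (ger0_norm t0) [t *: w + p]addrC /t divfK ?gt_eqF //.
  by lra.
move=> Qp; split; first exact: Qbd.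
have sub : connected_component (~` polygon_boundary v) p `<=` Q.
  have sC := @connected_component_sub _ (~` polygon_boundary v) p.
  set C := connected_component _ p in sC *.
  have CQ : C `&` Q = C.
    apply: component_connected.
    - exists p; split => //; apply: connected_component_refl; exact: Qbd.
    - by exists Q.
    - exists (Q `|` polygon_boundary v) => //; apply/seteqP; split=> q [Cq].
        by move=> Qq; split=> //; left.
      by move=> [Qq|/(sC q Cq)//].
  by rewrite -CQ => q [].
case: bQ => M [Mr hM]; exists M; split=> // x Mx q /sub; exact: hM.
Qed.

Lemma lin_continuous j : continuous (@lin R j).
Proof.
have c2 : continuous (fun p : R2 => p.2) by move=> p; exact: cvg_snd.
have c1 (a : R) : continuous (fun p : R2 => a * p.1).
  by move=> p; apply: cvgM; [exact: cvg_cst | exact: cvg_fst].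
case: j => [|[|[|j]]] p; rewrite /lin.
- exact: cvg_fst.
- exact: c2.
- by apply: cvgB; [exact: c2 | exact: c1].
- by apply: cvgB; [exact: c2 | exact: c1].
Qed.

Lemma hval_continuous L : continuous (@hval R L).
Proof.
case: L => [[j s] c] p; rewrite /hval; case: s.
  by apply: cvgB; [exact: lin_continuous | exact: cvg_cst].
by apply: cvgB; [exact: cvg_cst | exact: lin_continuous].
Qed.

Lemma hval_open L : open [set p : R2 | 0 < hval L p].
Proof.
apply: (@open_comp _ _ (hval L) [set x | 0 < x]); last exact: open_gt.
by move=> p _; exact: hval_continuous.
Qed.

Lemma hval_closed L : closed [set p : R2 | 0 <= hval L p].
Proof.
apply: (@closed_comp _ _ (hval L) [set x | 0 <= x]); last exact: closed_ge.
by move=> p _; exact: hval_continuous.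
Qed.

Lemma in_region_cons L Q (p : R2) :
  in_region (L :: Q) p <-> 0 < hval L p /\ in_region Q p.
Proof.
split=> [h|[h1 h2] M].
  by split=> [|M MQ]; apply: h; rewrite in_cons ?eqxx // MQ orbT.
by rewrite in_cons => /orP[/eqP->|]; [exact: h1 | exact: h2].
Qed.

Lemma in_region_open Q : open [set p : R2 | in_region Q p].
Proof.
elim: Q => [|L Q IH].
  by rewrite (_ : mkset _ = setT); [exact: openT | apply/seteqP; split].
rewrite (_ : mkset _ = [set p | 0 < hval L p] `&` [set p | in_region Q p]).
  by apply: openI => //; exact: hval_open.
by apply/seteqP; split=> p /in_region_cons.
Qed.

Definition weak_region (Q : seq halfplane) (p : R2) :=
  forall L, L \in Q -> 0 <= hval L p.

Lemma weak_region_closed Q : closed [set p : R2 | weak_region Q p].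
Proof.
rewrite (_ : mkset _ = \bigcap_(L in [set L | L \in Q]) [set p | 0 <= hval L p]).
  by apply: closed_bigI => L _; exact: hval_closed.
by [].
Qed.

Lemma zval_hzval L t : zval R (hzval L t) = hval L (pval R t).
Proof. by case: L => [[j []] c]; rewrite /hzval /hval zval_sub zval_lin. Qed.

Lemma hval_hopp L (p : R2) : hval (hopp L) p = - hval L p.
Proof. by case: L => [[j []] c]; rewrite /hval /hopp /= opprB. Qed.

Lemma hval_segment L (a b : R2) s :
  hval L (a + s *: (b - a)) = (1 - s) * hval L a + s * hval L b.
Proof. by case: L => [[j []] c]; rewrite /hval !(linD, linZ, linN); ring. Qed.

Lemma lin_kernel j (u w : R2) : lin j u = 0 -> lin j w = 0 -> w != 0 ->
  exists s, u = s *: w.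
Proof.
case: u w => u1 u2 [w1 w2]; rewrite /lin => hu hw w0.
have scale s : s *: ((w1, w2) : R2) = (s * w1, s * w2) by [].
case: j hu hw => [|j] hu hw.
  rewrite /= in hu hw; exists (u2 / w2); rewrite scale hu hw mulr0 divfK //.
  by apply: contraNneq w0 => w20; rewrite hw w20.
have [k [hu' hw']] : exists k, u2 = k * u1 /\ w2 = k * w1.
  case: j hu hw => [|[|j]] /= hu hw; [exists 0|exists phi|exists (phi + 1)]; lra.
exists (u1 / w1); rewrite scale hu' hw'.
have w10 : w1 != 0 by apply: contraNneq w0 => w10; rewrite hw' w10 mulr0.
by congr pair; field.
Qed.

(** Two functionals, one vanishing at either end of an edge, recognize the
    points of the edge among those of its line. *)
Lemma edge_boundsP L M N e (p : R2) : edge_bounds L M N e ->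
  hval L p = 0 -> 0 <= hval M p -> 0 <= hval N p ->
  segment (pval R e.1) (pval R e.2) p.
Proof.
case: e => a b /and5P[/= /(zeq0_eq0 R) + /(zeq0_eq0 R) + /(zeq0_eq0 R) +
  /(zpos_gt0 R) + /andP[/(zpos_gt0 R) + /(zeq0_eq0 R)]].
rewrite !zval_hzval; move: (pval R a) (pval R b) => A B La Lb Ma Mb Na Nb Lp Mp Np.
have [s ps] : exists s, p - A = s *: (B - A).
  case: L La Lb Lp => [[j sg] c] La Lb Lp; apply: (@lin_kernel j).
  - by rewrite linD linN; case: sg La Lb Lp => /=; lra.
  - by rewrite linD linN; case: sg La Lb Lp => /=; lra.
  - by rewrite subr_eq0; apply: contraTneq Mb => ->; rewrite Ma ltxx.
have {}ps : p = A + s *: (B - A) by rewrite -ps addrC subrK.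
exists s => //; move: Mp Np; rewrite ps !hval_segment Ma Nb !mulr0 add0r addr0.
by rewrite pmulr_lge0 // pmulr_lge0 // /= in_itv /= => -> ; rewrite subr_ge0 => ->.
Qed.

Lemma polygon_boundary_pval (v : seq zpoint) p :
  polygon_boundary (map (pval R) v) p <->
  exists2 e, e \in edges v & segment (pval R e.1) (pval R e.2) p.
Proof.
have E : zip (map (pval R) v) (rot 1 (map (pval R) v)) =
    [seq (pval R e.1, pval R e.2) | e <- edges v].
  rewrite -map_rot /edges; elim: (v) (rot 1 v) => [|a s IH] [|b t] //=.
  by rewrite IH.
rewrite /polygon_boundary /= E; split.
  by move=> [_ /mapP[e ev ->] he]; exists e.
by move=> [e ev he]; exists (pval R e.1, pval R e.2) => //; exact: map_f.
Qed.

Lemma region_bounded Q a : Q \in regions a -> bounded_set [set p : R2 | in_region Q p].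
Proof.
move=> Qa; exists (phi + 3); split; first exact: num_real.
move=> x hx p /(region_domain Qa) => /andP[/andP[a1 a2] /andP[b1 b2]].
have /andP[p1 p2] := phi_bounds R.
by apply/ltW; rewrite pair_norm_lt !gtr0_norm //; apply/andP; split; lra.
Qed.

Lemma segment_weak L (a b p : R2) :
  0 <= hval L a -> 0 <= hval L b -> segment a b p -> 0 <= hval L p.
Proof.
move=> La Lb [s]; rewrite /= in_itv /= => /andP[s0 s1] <-; rewrite hval_segment.
by rewrite addr_ge0 // mulr_ge0 // subr_ge0.
Qed.

Lemma segment_zero L (a b p : R2) :
  hval L a = 0 -> hval L b = 0 -> segment a b p -> hval L p = 0.
Proof. by move=> La Lb [s _ <-]; rewrite hval_segment La Lb !mulr0 addr0. Qed.

(** Provides the rays needed by [polygon_interiorP], for the points on the wrong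
    side of a supporting line. *)
Lemma hval_escape L (p : R2) : hval L p < 0 ->
  exists2 w : R2, w != 0 & forall t, 0 <= t -> hval L (p + t *: w) < 0.
Proof.
case: L => [[j s] c] Lp.
have [u uj u0] : exists2 u : R2, lin j u = 1 & u != 0.
  case: j {Lp} => [|j].
    by exists (1, 0) => //; apply/eqP => -[] /eqP; rewrite oner_eq0.
  exists (0, 1); last by apply/eqP => -[] /eqP; rewrite oner_eq0.
  by case: j => [|[|j]] /=; rewrite ?mulr0 ?subr0.
exists (if s then - u else u); first by case: s {Lp}; rewrite ?oppr_eq0.
move=> t t0; move: Lp; rewrite /hval; case: s; rewrite linD linZ ?linN uj; lra.
Qed.

Lemma convex_interior a (v : seq zpoint) : convex_ok v -> convex_region v \in regions a ->
  polygon_interior (map (pval R) v) = [set p | in_region (convex_region v) p].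
Proof.
move=> /allP ok Qa.
have bdE p : polygon_boundary (map (pval R) v) p <->
    weak_region (convex_region v) p /\ ~ in_region (convex_region v) p.
  split.
    move=> /polygon_boundary_pval[e ev ep]; split.
      move=> _ /mapP[f fv ->].
      have /andP[/allP/(_ e ev)/andP[/(znneg_ge0 R) h1 /(znneg_ge0 R) h2] _] := ok f fv.
      by apply: segment_weak ep; rewrite -zval_hzval.
    have /andP[_ /hasP[M _ /hasP[N _ /and3P[/(zeq0_eq0 R) h1 /(zeq0_eq0 R) h2 _]]]] := ok e ev.
    rewrite !zval_hzval in h1 h2.
    move=> /(_ (edge_halfplane v e)); rewrite (segment_zero h1 h2 ep) ltxx => h.
    by have := h (map_f _ ev).
  move=> [wp np]; apply/polygon_boundary_pval; apply: contrapT => nbd; apply: np.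
  move=> _ /mapP[e ev ->]; rewrite lt_neqAle wp ?map_f // andbT eq_sym.
  apply/eqP => Lp; apply: nbd; exists e => //.
  have /andP[_ /hasP[M MQ /hasP[N NQ eb]]] := ok e ev.
  by apply: edge_boundsP eb Lp (wp _ MQ) (wp _ NQ).
apply: polygon_interiorP.
- exact: in_region_open.
- exact: region_bounded Qa.
- by move=> p Qp /bdE[].
- rewrite (_ : _ `|` _ = [set p | weak_region (convex_region v) p]).
    exact: weak_region_closed.
  apply/seteqP; split=> p; first by move=> [Qp L /Qp/ltW|/bdE[]].
  by move=> wp; have [Qp|Qp] := EM (in_region (convex_region v) p); [left|right; apply/bdE].
- move=> p Qp pbd; have : ~ weak_region (convex_region v) p by move=> ?; apply/pbd/bdE.
  move=> /existsNP[L /not_implyP[LQ /negP]]; rewrite -ltNge => /hval_escape[w w0 hw].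
  by exists w => // t t0 /bdE[/(_ L LQ)]; rewrite leNgt hw.
Qed.

(** The hexagon is not the intersection of half-planes: its points satisfy
    the four inequalities of its hull and one of those of the two edges at the
    reentrant vertex D. *)
Lemma hexagon_interior :
  polygon_interior (map (pval R) hexagon) =
  [set p | exists2 Q, Q \in hexagon_regions & in_region Q p].
Proof.
(* A, ..., F are the vertices, in order; the half-planes are named after edges. *)
pose AB : halfplane := (2, true, (1, 1)%BZ).
pose BC : halfplane := (3, true, (2, 0)%BZ).
pose CD : halfplane := (2, false, (3, 0)%BZ).
pose DE : halfplane := (0, false, (2, -1)%BZ).
pose EF : halfplane := (3, false, (2, 1)%BZ).
pose FA : halfplane := (0, true, (0, 0)%BZ).
have /andP[p1 p2] := phi_bounds R.
have hvE (p : R2) : (hval AB p = p.2 - phi * p.1 - (1 + phi)) *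
    (hval BC p = p.2 - (phi + 1) * p.1 - 2) *
    (hval CD p = 3 - (p.2 - phi * p.1)) * (hval DE p = 2 - phi - p.1) *
    (hval EF p = 2 + phi - (p.2 - (phi + 1) * p.1)) * (hval FA p = p.1).
  by rewrite /hval /= !zval_pair !int_of_Z_lit; do !split; ring.
pose K (p : R2) := weak_region hexagon_hull p /\ (0 <= hval DE p \/ 0 <= hval CD p).
pose Q (p : R2) := exists2 Q, Q \in hexagon_regions & in_region Q p.
have KE p : K p <-> [/\ 0 <= hval AB p, 0 <= hval BC p, 0 <= hval EF p, 0 <= hval FA p
    & 0 <= hval DE p \/ 0 <= hval CD p].
  split=> [[h1 h2]|[h1 h2 h3 h4 h5]]; first by split => //; apply: h1; rewrite !inE eqxx ?orbT.
  by split=> // L; rewrite !inE => /or4P[] /eqP->.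
have QE p : Q p <-> [/\ 0 < hval AB p, 0 < hval BC p, 0 < hval EF p, 0 < hval FA p
    & 0 < hval DE p \/ 0 < hval CD p].
  split.
    move=> [S]; rewrite !inE => /orP[] /eqP -> h; split.
    all: try by apply: h; rewrite !inE eqxx ?orbT.
    - by left; apply: h; rewrite !inE eqxx ?orbT.
    - by right; apply: h; rewrite !inE eqxx ?orbT.
  move=> [h1 h2 h3 h4 [h5|h5]]; [exists (DE :: hexagon_hull)|exists (CD :: hexagon_hull)];
    rewrite ?inE ?eqxx ?orbT // => L; rewrite !inE => /orP[/eqP->//|/or4P[] /eqP->//].
have bdE p : polygon_boundary (map (pval R) hexagon) p <-> K p /\ ~ Q p.
  split.
    move=> /polygon_boundary_pval[e eh ep].
    have w L : znneg (hzval L e.1) && znneg (hzval L e.2) -> 0 <= hval L p.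
      move=> /andP[/(znneg_ge0 R) h1 /(znneg_ge0 R) h2].
      by apply: segment_weak ep; rewrite -zval_hzval.
    move: eh; rewrite /edges /= !inE => eh {ep}.
    rewrite KE QE; move: eh w =>
      /orP[/eqP->|/orP[/eqP->|/orP[/eqP->|/orP[/eqP->|/orP[/eqP->|/eqP->]]]]] w;
    (split; [split; first [by apply: w | by left; apply: w | by right; apply: w]
      | move=> [a b c d f];
        first [have := w (hopp AB) isT | have := w (hopp BC) isT
          | have := w (hopp EF) isT | have := w (hopp FA) isT
          | have := w (hopp CD) isT; have := w (hopp DE) isT];
        rewrite !hval_hopp {KE QE hvE p1 p2}; case: f; lra]).
  move=> [/KE[h1 h2 h3 h4 h5] /QE nQ]; apply/polygon_boundary_pval.
  have sol L M N e : e \in edges hexagon -> edge_bounds L M N e -> hval L p = 0 ->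
      0 <= hval M p -> 0 <= hval N p ->
      exists2 e, e \in edges hexagon & segment (pval R e.1) (pval R e.2) p.
    by move=> eh eb Lp Mp Np; exists e => //; exact: edge_boundsP eb Lp Mp Np.
  have pos (x : R) : 0 <= x -> x != 0 -> 0 < x by rewrite lt_def => -> ->.
  have [ab|ab] := eqVneq (hval AB p) 0.
    by apply: (@sol AB FA BC (<(0,0; 1,1)>, <(-1,1; 2,1)>)).
  have [bc|bc] := eqVneq (hval BC p) 0.
    apply: (@sol BC AB CD (<(-1,1; 2,1)>, <(1,0; 3,1)>)) => //.
    by move: h1 h2 h3 h4 h5 bc; rewrite !hvE; lra.
  have [ef|ef] := eqVneq (hval EF p) 0.
    apply: (@sol EF DE FA (<(2,-1; 3,1)>, <(0,0; 2,1)>)) => //.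
    by move: h1 h2 h3 h4 h5 ef; rewrite !hvE; lra.
  have [fa|fa] := eqVneq (hval FA p) 0.
    by apply: (@sol FA EF AB (<(0,0; 2,1)>, <(0,0; 1,1)>)).
  have nd : hval DE p <= 0 /\ hval CD p <= 0.
    split; rewrite leNgt; apply/negP => h; apply: nQ; split; try by apply: pos.
      by left.
    by right.
  have [de|de] := eqVneq (hval DE p) 0.
    by apply: (@sol DE (hopp CD) EF (<(2,-1; 2,1)>, <(2,-1; 3,1)>));
      rewrite ?hval_hopp ?oppr_ge0 //; case: nd.
  have [cd|cd] := eqVneq (hval CD p) 0.
    by apply: (@sol CD BC (hopp DE) (<(1,0; 3,1)>, <(2,-1; 2,1)>));
      rewrite ?hval_hopp ?oppr_ge0 //; case: nd.
  case: h5 => /pos h; [have := h de | have := h cd]; lra.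
have QKE : [set p | Q p] `|` polygon_boundary (map (pval R) hexagon) = [set p | K p].
  apply/seteqP; split=> p.
    move=> [/QE[h1 h2 h3 h4 h5]|/bdE[]//]; apply/KE; split; try exact: ltW.
    by case: h5 => h; [left|right]; exact: ltW.
  by move=> Kp; have [Qp|Qp] := EM (Q p); [left|right; apply/bdE].
apply: polygon_interiorP.
- rewrite (_ : mkset _ = \bigcup_(S in [set S | S \in hexagon_regions])
    [set p | in_region S p]); first by apply: bigcup_open => S _; exact: in_region_open.
  by apply/seteqP; split=> p [S hS Sp]; exists S.
- have [M1 [Mr1 b1]] := @region_bounded (DE :: hexagon_hull) 5 isT.
  have [M2 [Mr2 b2]] := @region_bounded (CD :: hexagon_hull) 5 isT.
  exists (Num.max M1 M2); split; first exact: num_real.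
  move=> x; rewrite gt_max => /andP[x1 x2] p [S]; rewrite !inE => /orP[] /eqP->.
    exact: b1.
  exact: b2.
- by move=> p Qp /bdE[].
- rewrite QKE (_ : mkset _ = [set p | weak_region hexagon_hull p] `&`
    ([set p | 0 <= hval DE p] `|` [set p | 0 <= hval CD p])) //.
  apply: closedI; first exact: weak_region_closed.
  by apply: closedU; exact: hval_closed.
- move=> p Qp pbd.
  have nK : ~ K p by move=> Kp; apply/pbd/bdE.
  have [hp|] := EM (weak_region hexagon_hull p).
    have [d1 d2] : hval DE p < 0 /\ hval CD p < 0.
      by split; rewrite ltNge; apply/negP => h; apply: nK; split=> //; [left|right].
    (* A point of the notch escapes upwards, since it opens in this direction. *)
    exists (0, 1); first by apply/eqP => -[] /eqP; rewrite oner_eq0.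
    move=> t t0 /bdE[[_ h] _]; move: d1 d2 h; rewrite !hvE.
    have -> : t *: ((0, 1) : R2) = (t * 0, t * 1) by [].
    case: p {Qp pbd nK hp} => x y /=.
    by rewrite mulr0 addr0 mulr1 => d1 d2 [?|?]; lra.
  move=> /existsNP[L /not_implyP[LQ /negP]]; rewrite -ltNge => /hval_escape[w w0 hw].
  by exists w => // t t0 /bdE[[/(_ L LQ) + _] _]; rewrite leNgt hw.
Qed.

Lemma polygons0_pval : polygons0 R = map (map (map (pval R))) zpolygons0.
Proof.
have zE : (zval R (0, 0)%BZ = 0) * (zval R (1, 0)%BZ = 1) * (zval R (2, 0)%BZ = 2) *
    (zval R (0, 1)%BZ = phi) * (zval R (-1, 1)%BZ = phi - 1) *
    (zval R (1, 1)%BZ = phi + 1) * (zval R (2, 1)%BZ = phi + 2) *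
    (zval R (3, 1)%BZ = phi + 3) * (zval R (2, -1)%BZ = 2 - phi).
  by rewrite !zval_pair !int_of_Z_lit; do !split; ring.
by rewrite /zpolygons0 /= /pval /= !zE.
Qed.

Definition lifted_atom (a : nat) (p : R2) :=
  exists2 Q, Q \in regions a & in_region Q p.

Lemma polygon_interiorE a (v : seq zpoint) : v \in nth [::] zpolygons0 a ->
  polygon_interior (map (pval R) v) =
  [set p | exists2 Q, Q \in polygon_regions v & in_region Q p].
Proof.
move=> va; have a11 : (a < size zpolygons0)%N.
  by rewrite ltnNge; apply: contraL va => ha; rewrite nth_default.
have sub Q : Q \in polygon_regions v -> Q \in regions a.
  move=> QP; rewrite /regions (nth_map [::]) //; apply/flattenP.
  by exists (polygon_regions v) => //; exact: map_f.
have /allP/(_ _ (mem_nth [::] a11))/allP/(_ v va) := convex_okE.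
move: sub; rewrite /polygon_regions; case: ifP => [_ _ /eqP->|_ /= sub ok].
  exact: hexagon_interior.
rewrite (convex_interior ok (sub _ (mem_head _ _))); apply/seteqP; split=> p.
  by move=> pv; exists (convex_region v); rewrite ?mem_head.
by move=> [Q]; rewrite inE => /eqP->.
Qed.

(** From here on the atoms are only used through open half-planes. *)
Lemma P0E (a : 'I_11) : @P0 R a = [set torus_proj p | p in [set p | lifted_atom a p]].
Proof.
rewrite /P0; congr image; apply/seteqP; split=> p; rewrite polygons0_pval.
  move=> [w]; have a11 : (a < size zpolygons0)%N by exact: ltn_ord.
  rewrite (nth_map [::]) // => /mapP[v va ->]; rewrite (polygon_interiorE va).
  move=> [Q QP Qp]; exists Q => //; rewrite /regions (nth_map [::]) //.
  by apply/flattenP; exists (polygon_regions v) => //; exact: map_f.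
have a11 : (a < size zpolygons0)%N by exact: ltn_ord.
have E : regions a = flatten [seq polygon_regions v | v <- nth [::] zpolygons0 a].
  by rewrite /regions (nth_map [::]).
move=> [Q + Qp]; rewrite E => /flattenP[S].
move=> /mapP[v va ->] QP.
exists (map (pval R) v); first by rewrite (nth_map [::]) //; exact: map_f.
by rewrite (polygon_interiorE va); exists Q.
Qed.

End Polygons.

(** * Germs of the partition in the eight sectors *)

(** The eight open sectors between the lines x = 0, y = 0, y = phi x and
    y = (phi + 1) x, which are the lines of the directions of the edges.  The
    boolean is the sign of x, and the index increases clockwise in the right
    half-plane, from x = 0. *)
Definition direction := (bool * 'I_4)%type.

(** The sign on the sector of the j-th of the four functions. *)
Definition dsign (k : direction) (j : nat) : bool :=
  k.1 == match j with 0 => true | 1 => k.2 < 3 | 2 => k.2 < 2 | _ => k.2 < 1 end%N.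

Section Germs.
Variable R : realType.
Local Notation phi := (phi R).
Local Notation R2 := (R * R)%type.
Local Notation proj := (@torus_proj R).
Local Notation P0 := (@P0 R).
Local Notation R0 := (@R0 R).
Implicit Types (p d : R2) (k : direction) (L : halfplane) (Q : seq halfplane).

(* The slopes 3, 2, 1, -1 are separated by phi + 1, phi and 0. *)
Definition dvec k : R2 :=
  let v : R2 := (1, nth 0 [:: 3; 2; 1; -1] k.2) in if k.1 then v else - v.

Definition in_sector k d :=
  forall j, if dsign k j then 0 < lin j d else lin j d < 0.

Lemma dvec_in_sector k : in_sector k (dvec k).
Proof.
have /andP[p1 p2] := phi_bounds R.
case: k => s [[|[|[|[|//]]]] hi] j; rewrite /dsign /dvec;
  case: j => [|[|[|j]]] /=; case: s => /=; lra.
Qed.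

Lemma in_sectorZ k d e : 0 < e -> in_sector k d -> in_sector k (e *: d).
Proof.
by move=> e0 h j; have := h j; rewrite linZ; case: ifP => _ ?;
  rewrite ?pmulr_rgt0 ?pmulr_rlt0.
Qed.

Definition hdir L k : bool := L.1.2 == dsign k L.1.1.

(** Decides whether p + d, for small d in the sector k, is in the half-plane L. *)
Definition sided L p k : bool := (0 < hval L p) || (hval L p == 0) && hdir L k.

Lemma sidedE L p k : sided L p k = if hdir L k then 0 <= hval L p else 0 < hval L p.
Proof.
by rewrite /sided; case: hdir; rewrite ?andbF ?orbF // andbT orbC le_eqVlt eq_sym.
Qed.

Lemma sided_hopp L p k : ~~ sided L p k -> sided (hopp L) p k.
Proof.
rewrite /sided hval_hopp oppr_gt0 oppr_eq0 negb_or negb_and -leNgt le_eqVlt.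
rewrite /hdir /hopp /=; case: eqP => //= _; rewrite ?andbF ?orbF //.
by case: (L.1.2) (dsign _ _) => [] [] //= _; rewrite ?orbT.
Qed.

Lemma sided_local L p k : sided L p k -> exists2 e, 0 < e &
  forall d, `|d| < e -> in_sector k d -> 0 < hval L (p + d).
Proof.
case/orP=> [Lp|/andP[/eqP Lp dL]].
  have : nbhs p [set p | 0 < hval L p].
    by apply: open_nbhs_nbhs; split => //; exact: hval_open.
  move=> /nbhs_ballP[e /= e0 he]; exists e => // d de _; apply: he.
  by rewrite -ball_normE /= opprD addrA subrr sub0r normrN.
exists 1 => // d _ /(_ L.1.1); move: Lp dL; rewrite /hdir.
case: L => [[j s] c] /= Lp /eqP ->; rewrite linD.
by move: Lp; case: s (dsign k j) => -[]; lra.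
Qed.

(** Replaces the sector k by one honest displacement d, for finitely many half-planes
    at once. *)
Lemma sided_near (Ls : seq halfplane) p k : exists2 e, 0 < e &
  forall d L, `|d| < e -> in_sector k d -> L \in Ls ->
    hval L (p + d) != 0 /\ (0 < hval L (p + d)) = sided L p k.
Proof.
elim: Ls => [|L Ls [e e0 he]]; first by exists 1.
have [f f0 hf] : exists2 f, 0 < f & forall d, `|d| < f -> in_sector k d ->
    hval L (p + d) != 0 /\ (0 < hval L (p + d)) = sided L p k.
  have [Lp|/sided_hopp Lp] := boolP (sided L p k).
    have [f f0 hf] := sided_local Lp; exists f => // d df dk.
    by have := hf d df dk => h; rewrite gt_eqF h.
  have [f f0 hf] := sided_local Lp; exists f => // d df dk.
  have := hf d df dk; rewrite hval_hopp oppr_gt0 => h.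
  by rewrite lt_eqF //; split=> //; apply/negbTE; rewrite -leNgt ltW.
exists (Num.min e f); first by rewrite lt_min e0.
move=> d M; rewrite lt_min => /andP[de df] dk; rewrite in_cons => /orP[/eqP->|].
  exact: hf.
exact: he.
Qed.

Lemma sector_small k e : 0 < e -> exists2 d, `|d| < e & in_sector k d.
Proof.
move=> e0; have v0 : 0 < 1 + `|dvec k| by rewrite ltr_pwDl.
exists ((e / (1 + `|dvec k|)) *: dvec k).
  rewrite normrZ ger0_norm ?divr_ge0 // ?ltW // mulrAC ltr_pdivrMr //.
  by rewrite ltr_pM2l // ltrDr.
by apply: in_sectorZ; [rewrite divr_gt0 | exact: dvec_in_sector].
Qed.

(** Some lift p + g of the point enters a region of the atom a when it moves in
    the sector k. *)
Definition germ p k (a : nat) := exists (g : R2) Q,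
  [/\ proj g = 0, Q \in regions a & forall L, L \in Q -> sided L (p + g) k].

(** Move p into the fundamental domain, on the sides through which the sector k
    points inwards, then take the region that contains the points y + d for
    small d in the sector. *)
Lemma germ_ex p k : exists a : 'I_11, germ p k a.
Proof.
have /andP[p1 p2] := phi_bounds R.
have [y [py y1 y2]] := proj_domain p (dsign k 0) (dsign k 1).
have [e e0 he] := sided_near (domain ++ flatten (flatten atom_regions)) y k.
have [d de dk] := sector_small k e0.
have dom L : L \in domain -> sided L y k -> 0 < hval L (y + d).
  by move=> Ld; have [|_ ->//] := he d L de dk; rewrite mem_cat Ld.
have sdom L : L \in domain -> sided L y k.
  rewrite !inE => /or4P[] /eqP->;
  rewrite sidedE /hdir /hval /= !zval_pair !int_of_Z_lit.
  - by move: y1; case: (dsign k 0) => /andP[] /=; lra.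
  - by move: y1; case: (dsign k 0) => /andP[] /=; lra.
  - by move: y2; case: (dsign k 1) => /andP[] /=; lra.
  - by move: y2; case: (dsign k 1) => /andP[] /=; lra.
have {}dom L : L \in domain -> 0 < hval L (y + d) by move=> Ld; apply: dom (sdom L Ld).
have := dom (0, true, (0, 0)%BZ) isT; have := dom (0, false, (0, 1)%BZ) isT.
have := dom (1, true, (0, 0)%BZ) isT; have := dom (1, false, (3, 1)%BZ) isT.
rewrite /hval !zval_pair !int_of_Z_lit => h1 h2 h3 h4.
have [|||a [Q [Qa Qy]]] := @cover_sound R (y + d).
- by rewrite /= in h3 h4 *; apply/andP; split; lra.
- by rewrite /= in h1 h2 *; apply/andP; split; lra.
- move=> Q L Qf LQ; have [|//] := he d L de dk.
  by rewrite mem_cat; apply/orP; right; apply/flattenP; exists Q.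
exists (Ordinal (region_index Qa)), (y - p), Q; split => //.
  by rewrite projD projN py subrr.
move=> L LQ; rewrite addrC subrK.
have [|_ <-] := he d L de dk; last exact: Qy.
rewrite mem_cat; apply/orP; right; apply/flattenP; exists Q => //.
by apply/flattenP; exists (regions a) => //; apply: mem_nth; exact: region_index Qa.
Qed.

Lemma germ_local p k a : germ p k a -> exists2 e, 0 < e &
  forall d, `|d| < e -> in_sector k d ->
    exists2 q, proj q = proj (p + d) & lifted_atom a q.
Proof.
move=> [g [Q [g0 Qa Qs]]]; have [e e0 he] := sided_near Q (p + g) k.
exists e => // d de dk; exists (p + g + d).
  by rewrite !projD g0 addr0.
by exists Q => // L LQ; have [_ ->] := he d L de dk LQ; exact: Qs.
Qed.

Lemma int_between (a k : int) (c : R) : 0 < c ->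
  (a - 1)%:~R * c < k%:~R * c < (a + 2)%:~R * c -> k = a \/ k = a + 1.
Proof. by move=> c0; rewrite !ltr_pM2r // !ltr_int => /andP[]; lia. Qed.

Lemma translation_eq0 (u v c : R) (i : int) : 1 <= c -> 0 < u < c -> 0 < v < c ->
  u = v + i%:~R * c -> i = 0.
Proof.
move=> c1 /andP[u0 uc] /andP[v0 vc] uv.
have c0 : 0 < c by lra.
have [|i1|//] := @int_between (-1) i c c0.
  by rewrite !rmorphD !rmorphN /=; apply/andP; split; lra.
by exfalso; move: uv; rewrite i1 rmorphN mulN1r /=; lra.
Qed.

(** Both lifts are in the fundamental domain, so they coincide, and then the
    pairwise disjointness of the regions applies. *)
Lemma lifted_atom_inj a b (x y : R2) : lifted_atom a x -> lifted_atom b y ->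
  proj x = proj y -> x = y /\ a = b.
Proof.
move=> [Q Qa Qx] [S Sb Sy].
have /andP[/andP[x1 x2] /andP[x3 x4]] := region_domain Qa Qx.
have /andP[/andP[y1 y2] /andP[y3 y4]] := region_domain Sb Sy.
move=> /proj_eq[m [n [h1 h2]]].
have /andP[p1 p2] := phi_bounds R.
have d0 : 1 <= phi + 3 by lra.
have n0 : n = 0 by apply: translation_eq0 h2; rewrite ?x3 ?x4 ?y3 ?y4.
have m0 : m = 0.
  apply: (@translation_eq0 x.1 y.1 phi); rewrite ?x1 ?x2 ?y1 ?y2 //; first by lra.
  by rewrite h1 n0 mulr0z addr0.
have xy : x = y.
  move: h1 h2; rewrite m0 n0 mulr0z !mul0r !addr0.
  by case: (x) (y) => ? ? [? ?] /= -> ->.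
split=> //; rewrite xy in Qx.
suff /eqP : a == b by [].
apply: (pairs_sound (p := y) check_disjointE Qa Sb Qx).
rewrite (_ : pval R _ = 0) ?addr0 //.
by rewrite /pval /= !zval_pair !int_of_Z_lit mulr0z mul0r addr0.
Qed.

Lemma germ_uniq p k a b : germ p k a -> germ p k b -> a = b.
Proof.
move=> /germ_local[e e0 he] /germ_local[f f0 hf].
have [|d] := @sector_small k (Num.min e f); first by rewrite lt_min e0.
rewrite lt_min => /andP[de df] dk.
have [x xp ax] := he d de dk; have [y yp yb] := hf d df dk.
by have [] := lifted_atom_inj ax yb (etrans xp (esym yp)).
Qed.

Lemma P0_open a : open (P0 a).
Proof.
rewrite P0E; apply: torus_proj_open.
rewrite (_ : mkset _ = \bigcup_(Q in [set Q | Q \in regions a])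
  [set p | in_region Q p]); first by apply: bigcup_open => Q _; exact: in_region_open.
by apply/seteqP; split=> p [Q hQ Qp]; exists Q.
Qed.

Lemma P0_inj a b t : P0 a t -> P0 b t -> a = b.
Proof.
rewrite !P0E => -[x ax xt] [y byy yt]; apply: val_inj.
by have [] := lifted_atom_inj ax byy (etrans xt (esym yt)).
Qed.

Lemma germ_P0 p k (a : 'I_11) : germ p k a -> exists2 e, 0 < e &
  forall d, `|d| < e -> in_sector k d -> P0 a (proj (p + d)).
Proof.
move=> /germ_local[e e0 he]; exists e => // d de dk.
by have [q qp aq] := he d de dk; rewrite P0E; exists q.
Qed.

Lemma near_closure (B : set (torus R)) p :
  (forall e, 0 < e -> exists2 d, `|d| < e & B (proj (p + d))) ->
  closure B (proj p).
Proof.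
move=> h U pU; have : nbhs p (proj @^-1` U) by exact: torus_proj_continuous.
move=> /nbhs_ballP[e /= e0 he]; have [d de Bd] := h e e0.
exists (proj (p + d)); split=> //; apply: he.
by rewrite -ball_normE /= opprD addrA subrr sub0r normrN.
Qed.

Lemma germ_closure p k (a : 'I_11) : germ p k a -> closure (P0 a) (proj p).
Proof.
move=> /germ_P0[e e0 he]; apply: near_closure => f f0.
have [|d] := @sector_small k (Num.min e f); first by rewrite lt_min e0.
by rewrite lt_min => /andP[de df] dk; exists d => //; exact: he.
Qed.

Lemma P0_closure a b t : P0 a t -> closure (P0 b) t -> a = b.
Proof.
move=> at_ /(_ _ (open_nbhs_nbhs (conj (@P0_open _) at_)))[u [bu au]].
exact: P0_inj au bu.
Qed.

Lemma P0_topological_partition : topological_partition P0.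
Proof.
split; first by move=> a; exact: P0_open.
  by move=> a b _ _ [t [at_ bt]]; exact: P0_inj at_ bt.
apply/seteqP; split=> // t _; have [p <-] := proj_surj t.
have [a ga] := germ_ex p (true, ord0).
by exists a => //; exact: germ_closure ga.
Qed.

(** A point of the fundamental domain moved by (1, 0) comes back to it after the
    translation by 0 or by (- phi, 0); both cases are settled by computation. *)
Lemma P0_right (a b : 'I_11) t : P0 a t -> P0 b (R0 (1, 0) t) -> matchH a b.
Proof.
rewrite !P0E => -[x [Q Qa Qx] <-] [y [S Sb Sy]]; rewrite R0_proj /vec /=.
have /andP[/andP[x1 x2] /andP[x3 x4]] := region_domain Qa Qx.
have /andP[/andP[y1 y2] /andP[y3 y4]] := region_domain Sb Sy.
have /andP[p1 p2] := phi_bounds R.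
move=> /proj_eq[m [n []]] /=; rewrite mulr0z mulr1z addr0 => h1 h2.
have n0 : n = 0.
  apply: (@translation_eq0 y.2 x.2 (phi + 3)); rewrite ?x3 ?x4 ?y3 ?y4 //; lra.
rewrite n0 mulr0z mul0r !addr0 in h1 h2.
have phi0 : 0 < phi by lra.
have [|m0|m1] := @int_between (-1) m phi phi0.
- by rewrite !rmorphD !rmorphN /=; apply/andP; split; lra.
- apply: (pairs_sound check_right2E Qa Sb Qx).
  rewrite (_ : _ + _ = y) // /pval /= !zval_pair !int_of_Z_lit.
  case: (x) (y) m0 h1 h2 => ? ? [? ?] /= -> -> ->.
  by congr pair; rewrite /=; ring.
- apply: (pairs_sound check_right1E Qa Sb Qx).
  rewrite (_ : _ + _ = y) // /pval /= !zval_pair !int_of_Z_lit.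
  case: (x) (y) m1 h1 h2 => ? ? [? ?] /= -> -> ->.
  by congr pair; rewrite /=; ring.
Qed.

Lemma P0_up (a b : 'I_11) t : P0 a t -> P0 b (R0 (0, 1) t) -> matchV a b.
Proof.
rewrite !P0E => -[x [Q Qa Qx] <-] [y [S Sb Sy]]; rewrite R0_proj /vec /=.
have /andP[/andP[x1 x2] /andP[x3 x4]] := region_domain Qa Qx.
have /andP[/andP[y1 y2] /andP[y3 y4]] := region_domain Sb Sy.
have /andP[p1 p2] := phi_bounds R.
move=> /proj_eq[m [n []]] /=; rewrite mulr0z mulr1z addr0 => h1 h2.
have d0 : 0 < phi + 3 by lra.
have phi0 : 0 < phi by lra.
have [|nE|nE] := @int_between (-1) n (phi + 3) d0.
- by rewrite !rmorphD !rmorphN /=; apply/andP; split; lra.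
- rewrite nE rmorphN /= in h1 h2.
  have [|mE|mE] := @int_between 0 m phi phi0.
  + by rewrite !rmorphD !rmorphN /=; apply/andP; split; lra.
  + apply: (pairs_sound check_up2E Qa Sb Qx).
    rewrite (_ : _ + _ = y) // /pval /= !zval_pair !int_of_Z_lit.
    case: (x) (y) mE h1 h2 => ? ? [? ?] /= -> -> ->.
    by congr pair; rewrite /=; ring.
  + apply: (pairs_sound check_up3E Qa Sb Qx).
    rewrite (_ : _ + _ = y) // /pval /= !zval_pair !int_of_Z_lit.
    case: (x) (y) mE h1 h2 => ? ? [? ?] /= -> -> ->.
    by congr pair; rewrite /=; ring.
- rewrite nE mulr0z mul0r !addr0 in h1 h2.
  have mE : m = 0.
    by apply: (@translation_eq0 y.1 x.1 phi); rewrite ?x1 ?x2 ?y1 ?y2 //; lra.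
  apply: (pairs_sound check_up1E Qa Sb Qx).
  rewrite (_ : _ + _ = y) // /pval /= !zval_pair !int_of_Z_lit.
  case: (x) (y) mE h1 h2 => ? ? [? ?] /= -> -> ->.
  by congr pair; rewrite /=; ring.
Qed.

End Germs.

(** * Topology of configurations *)

Lemma closure_min (T : topologicalType) (A C : set T) :
  closed C -> A `<=` C -> closure A `<=` C.
Proof. by move=> cC AC x; rewrite closureEbigcap; apply; split. Qed.

Section Configurations.
Variable k : nat.
Local Notation config := (config k).
Implicit Types (w x : config) (S : set Z2).

Definition agree S w : set config := [set x | forall m, S m -> x m = w m].

Definition ball1 (n : nat) : set Z2 := [set m | (`|m.1| + `|m.2| <= n)%N].

Lemma agree_nbhs S w : finite_set S -> nbhs w (agree S w).
Proof.
move=> /finite_seqP[s ->]; elim: s => [|m s IH].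
  by apply: filterS (@filterT _ (nbhs w) _).
have mw : nbhs w [set x : config | x m = w m].
  have /(_ w [set w m]) := @proj_continuous _ (fun=> discrete_topology 'I_k.+1) m.
  by apply; exact: discrete_set1.
apply: filterS (filterI mw IH) => x [xm xs] j; rewrite /= in_cons.
by move=> /orP[/eqP->//|]; exact: xs.
Qed.

Lemma nbhs_agree w (U : set config) : nbhs w U ->
  exists2 S, finite_set S & agree S w `<=` U.
Proof.
pose F := filter_from [set S | finite_set S] (fun S => agree S w).
have FF : Filter F.
  apply: filter_from_filter; first by exists set0; exact: finite_set0.
  move=> S S' fS fS'; exists (S `|` S'); first by rewrite /= finite_setU.
  by move=> x xS; split=> m mS; apply: xS; [left|right].
suff Fw : F --> w by move=> /Fw[S fS SU]; exists S.
apply/cvg_sup => m U' [V] [[W] oW <-] Wm WU.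
apply: filterS WU _; exists [set m]; first exact: finite_set1.
by move=> x /(_ m erefl) xm; move: Wm; rewrite /= /proj xm.
Qed.

Lemma closure_config (X : set config) w :
  closure X w <-> forall S, finite_set S -> exists2 x, X x & agree S w x.
Proof.
split=> [Xw S /(agree_nbhs w)/Xw[x [Xx xS]]|h U /nbhs_agree[S fS SU]].
  by exists x.
by have [x Xx xS] := h S fS; exists x; split=> //; exact: SU.
Qed.

Lemma ball1_finite n : finite_set (ball1 n).
Proof.
pose f (m : 'I_n.+1 * 'I_n.+1 * (bool * bool)) : Z2 :=
  let s (b : bool) (i : nat) : int := if b then i%:Z else - i%:Z in
  (s m.2.1 m.1.1, s m.2.2 m.1.2).
apply: (@sub_finite_set _ _ (range f)); last exact/finite_image/finite_finset.
rewrite /ball1 => -[a b] /= ab.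
have ha : (`|a| < n.+1)%N by lia.
have hb : (`|b| < n.+1)%N by lia.
exists (Ordinal ha, Ordinal hb, (0 <= a, 0 <= b)) => //.
by rewrite /f /=; congr pair; case: ifP; lia.
Qed.

Lemma finite_sub_ball1 S : finite_set S -> exists n, S `<=` ball1 n.
Proof.
move=> /finite_seqP[s ->]; elim: s => [|m s [n hn]]; first by exists 0%N.
exists (maxn n (`|m.1| + `|m.2|)) => j /=; rewrite in_cons => /orP[/eqP->|/hn].
  by rewrite /ball1 /= leq_maxr.
by rewrite /ball1 /= => h; rewrite leq_max h.
Qed.

Lemma config_compact : compact [set: config].
Proof.
have := @tychonoff Z2 (fun=> discrete_topology 'I_k.+1) (fun=> setT)
  (fun=> @finite_compact (discrete_topology 'I_k.+1) _ (@finite_finset 'I_k.+1 setT)).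
by rewrite (_ : mkset _ = setT) //; apply/seteqP; split.
Qed.

End Configurations.

Lemma decreasing_cluster (T : topologicalType) (C : nat -> set T) :
  compact [set: T] -> (forall n, C n !=set0) ->
  (forall m n, (m <= n)%N -> C n `<=` C m) ->
  exists x, forall n, closure (C n) x.
Proof.
move=> cT C0 Cm.
have FF : Filter (filter_from setT C).
  apply: filter_from_filter; first by exists 0%N.
  move=> m n _ _; exists (maxn m n) => // x Cx.
  by split; apply: Cm Cx; rewrite ?leq_maxl ?leq_maxr.
have PF : ProperFilter (filter_from setT C) by apply: filter_from_proper.
have [x [_ Cx]] := cT _ PF (@filterT _ _ FF).
by exists x => n U xU; apply: Cx xU; exists n.
Qed.

(** * The symbolic system and its factor map *)

Section JeandelRaoCoding.
Variable R : realType.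
Local Notation phi := (phi R).
Local Notation R2 := (R * R)%type.
Local Notation proj := (@torus_proj R).
Local Notation P0 := (@P0 R).
Local Notation R0 := (@R0 R).
Local Notation config := (config 10).
Local Notation shift_action := (@shift_action 10).
Implicit Types (w : config) (S : set Z2) (t : torus R) (p : R2).

Definition X0 : set config :=
  [set w | forall S, finite_set S -> allowed P0 R0 S w].

Definition code p (k : direction) : config :=
  fun m => projT1 (cid (germ_ex (p + vec R m) k)).

Lemma code_germ p k m : germ (p + vec R m) k (code p k m).
Proof. by rewrite /code; case: cid. Qed.

Lemma code_near p k S : finite_set S -> exists2 e, 0 < e &
  forall d, `|d| < e -> in_sector k d ->
  forall m, S m -> P0 (code p k m) (R0 m (proj (p + d))).
Proof.
move=> /finite_seqP[s ->]; elim: s => [|m s [e e0 he]]; first by exists 1.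
have [f f0 hf] := germ_P0 (code_germ p k m).
exists (Num.min e f); first by rewrite lt_min e0.
move=> d; rewrite lt_min => /andP[de df] dk j; rewrite /= in_cons => /orP[/eqP->|].
  by rewrite R0_proj addrAC; exact: hf.
exact: he.
Qed.

(** Any finite part of [code p k] is read off at p + d, for small d in the sector. *)
Lemma code_X0 p k : X0 (code p k).
Proof.
move=> S fS; have [e e0 he] := code_near p k fS.
have [d de dk] := sector_small k e0.
by exists (proj (p + d)) => m Sm; exact: he.
Qed.

Lemma code_closure p k m : closure (P0 (code p k m)) (R0 m (proj p)).
Proof. by rewrite R0_proj; exact: germ_closure (code_germ p k m). Qed.

Lemma X0_subshift : subshift X0.
Proof.
split.
  move=> w /closure_config h S fS.
  have [x Xx xw] := h S fS; have [t tx] := Xx S fS.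
  by exists t => m Sm; have := tx m Sm; rewrite /= xw.
move=> n w Xw S fS.
have [t tw] := Xw _ (finite_image (fun m => m + n) fS).
exists (R0 n t) => m Sm; rewrite /= -R0D.
by apply: (tw (m + n)); exists m.
Qed.

Lemma X0_symbolic : is_symbolic_system P0 R0 X0.
Proof.
split; first exact: X0_subshift.
move=> S w fS; split.
  move=> [x Xx xw]; have [t tx] := Xx S fS.
  by exists t => m Sm; have := tx m Sm; rewrite /= xw.
move=> [t tw]; have [p pt] := proj_surj t.
exists (code p (true, ord0)); first exact: code_X0.
move=> m Sm; apply/esym; apply: (@P0_closure R _ _ (R0 m t)); first exact: tw.
by rewrite -pt; exact: code_closure.
Qed.

(** A closed set of configurations is determined by its finite patterns. *)
Lemma symbolic_system_unique : unique (is_symbolic_system P0 R0) X0.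
Proof.
split; first exact: X0_symbolic.
suff sub X Y : is_symbolic_system P0 R0 X -> is_symbolic_system P0 R0 Y -> X `<=` Y.
  by move=> X hX; apply/seteqP; split; apply: sub => //; exact: X0_symbolic.
move=> [[cX _] XL] [[cY _] YL] w Xw; apply: cY; apply/closure_config => S fS.
have [|y Yy yw] := (YL S w fS).2; last by exists y.
by apply/(XL S w fS).1; exists w.
Qed.

Definition vertical_half (s : bool) (N : int) (m : Z2) : Prop :=
  if s then N <= m.2 else m.2 <= N.

Definition zsided (L : halfplane) (v : zpoint) (k : direction) : bool :=
  zpos (hzval L v) || zeq0 (hzval L v) && hdir L k.

(** Decides germs at points with coordinates in Z[phi], by computation. *)
Lemma germ_zpoint v k (a : nat) Q : Q \in regions a ->
  all (fun L => zsided L v k) Q -> germ (pval R v) k a.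
Proof.
move=> Qa /allP vQ; exists 0, Q; split; rewrite ?proj0 // addr0 => L /vQ.
rewrite /sided -zval_hzval => /orP[/(zpos_gt0 R)->//|/andP[/(zeq0_eq0 R)-> ->]].
by rewrite eqxx orbT.
Qed.

Definition tile2 : 'I_11 := @Ordinal 11 2 isT.

Definition triangle2 : seq halfplane :=
  convex_region [:: <(0,0; 2,0)>; <(-1,1; 2,1)>; <(0,0; 1,1)>].

(** The closed triangle is in a box of width phi - 1 and height phi, of which its
    vertices (0, 2) and (phi - 1, phi + 2) are opposite corners.  If both are
    still in the box after a translation, then this translation is 0; the box is
    too small for the lattice to interfere. *)
Lemma triangle2_rigid (t : torus R) :
  (forall u, closure (P0 tile2) u -> closure (P0 tile2) (u + t)) -> t = 0.
Proof.
have /andP[p1 p2] := phi_bounds R.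
pose B : set R2 := `[0, phi - 1] `*` `[2, phi + 2].
have cB : closure (P0 tile2) `<=` [set proj x | x in B].
  apply: closure_min.
    apply: compact_closed; first exact: torus_hausdorff.
    apply: continuous_compact; last by apply: compact_setX; exact: segment_compact.
    by apply: continuous_subspaceT => x; exact: torus_proj_continuous.
  rewrite P0E => _ [x [Q Q2 Qx] <-]; exists x => //.
  have /eqP QE : Q == triangle2 by rewrite -mem_seq1; exact: Q2.
  rewrite {}QE {Q2} in Qx.
  have ent L : entails (affines triangle2) (affine_of L) -> 0 < hval L x.
    by move=> e; rewrite hvalE; apply: entails_gt0 e; exact: in_region_aval.
  have := ent (0, true, (0, 0)%BZ) isT; have := ent (0, false, (-1, 1)%BZ) isT.
  have := ent (1, true, (2, 0)%BZ) isT; have := ent (1, false, (2, 1)%BZ) isT.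
  rewrite /hval /= !zval_pair !int_of_Z_lit => h1 h2 h3 h4.
  by split; rewrite /= in_itv /=; apply/andP; split; lra.
move=> h.
have v1 : closure (P0 tile2) (proj (0, 2)).
  have := @germ_closure R _ _ tile2 (@germ_zpoint <(0,0; 2,0)>
    (true, ord0) tile2 triangle2 isT isT).
  congr (closure _ (proj _)); rewrite /pval /= !zval_pair !int_of_Z_lit.
  by congr pair; rewrite /=; ring.
have v2 : closure (P0 tile2) (proj (phi - 1, phi + 2)).
  have := @germ_closure R _ _ tile2 (@germ_zpoint <(-1,1; 2,1)>
    (false, @Ordinal 4 1 isT) tile2 triangle2 isT isT).
  congr (closure _ (proj _)); rewrite /pval /= !zval_pair !int_of_Z_lit.
  by congr pair; rewrite /=; ring.
have [x [x1 x2] xE] := cB _ (h _ v1).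
have [y [y1 y2] yE] := cB _ (h _ v2).
have tE : t = proj (x - (0, 2)) by rewrite projD projN xE addrC addKr.
move: x1 x2 y1 y2; rewrite /= !in_itv /= => x1 x2 y1 y2.
have : proj y = proj ((phi - 1, phi + 2) + (x - (0, 2))) by rewrite projD yE tE.
move=> /proj_eq[m [n /= [h1 h2]]].
have n0 : n = 0.
  (* The bounds only give |n (phi + 3)| < 4. *)
  apply: (@int_nonunit_eq0 R n ((phi + 3) / 4)); first by lra.
  by apply/andP; split; lra.
have m0 : m = 0.
  (* Both numbers are moved by 1 / 100 to make the inequalities strict. *)
  apply: (@translation_eq0 R (y.1 + 1 / 100) (phi - 1 + (x.1 - 0) + 1 / 100) phi).
  - by lra.
  - by apply/andP; split; lra.
  - by apply/andP; split; lra.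
  - by rewrite h1 n0 mulr0z; ring.
rewrite m0 n0 mulr0z !mul0r !addr0 in h1 h2.
rewrite tE; have -> : x = (0, 2).
  by case: (x) x1 x2 h1 h2 => a b /= ? ? ? ?; congr pair; lra.
by rewrite subrr proj0.
Qed.

(** Wherever the orbit of t visits the open atom P_2, the configuration has to show
    the letter 2, so that the orbit of u is in the closure of P_2 at the same
    time.  Density of the orbit turns this into a property of all the points of
    P_2. *)
Lemma closure_determines w t u (s : bool) (N : int) :
  (forall m, vertical_half s N m -> closure (P0 (w m)) (R0 m t) /\
                                    closure (P0 (w m)) (R0 m u)) -> t = u.
Proof.
move=> h; apply/eqP; rewrite eq_sym -subr_eq0; apply/eqP; apply: triangle2_rigid => v av.
move=> U Uv; pose V := P0 tile2 `&` (fun x => x + (u - t)) @^-1` U^°.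
have oV : open V.
  apply: openI; first exact: P0_open.
  apply: open_comp; last exact: open_interior.
  by move=> x _; exact: translate_continuous.
have [x [x2 xU]] : V !=set0.
  have : nbhs v ((fun x => x + (u - t)) @^-1` U^°).
    by apply: translate_continuous; exact: nbhs_interior.
  by move=> /av[x [ax xU]]; exists x.
have [m [m2 mU] ms] := orbit_dense t N s oV (ex_intro _ x (conj x2 xU)).
have [wt wu] := h m ms.
have w2 := P0_closure m2 wt.
have mu : R0 m t + (u - t) = R0 m u by rewrite /Defs.R0 addrC addrA subrK.
move: mU; rewrite /= mu => mU.
have [z [az Uz]] := wu _ (open_nbhs_nbhs (conj (@open_interior _ U) mU)).
by exists z; split; [rewrite w2 | exact: interior_subset Uz].
Qed.

Lemma cylinder_dec w m n : (m <= n)%N -> cylinder P0 R0 n w `<=` cylinder P0 R0 m w.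
Proof. by move=> mn t h j /= jm; apply: h; exact: leq_trans jm mn. Qed.

Lemma coded_closure w t m : coded_points P0 R0 w t -> closure (P0 (w m)) (R0 m t).
Proof.
move=> h U Um; have := h (`|m.1| + `|m.2|)%N I.
move=> /(_ (R0 m @^-1` U))[|x [xc xU]]; first exact: R0_continuous.
by exists (R0 m x); split=> //; apply: xc; rewrite /= leqnn.
Qed.

Lemma coded_nonempty w : X0 w -> exists t, coded_points P0 R0 w t.
Proof.
move=> Xw; have [||t ht] := @decreasing_cluster (torus R) (fun n => cylinder P0 R0 n w)
  (@torus_compact R).
- by move=> n; exact: Xw (ball1_finite n).
- by move=> m n; exact: cylinder_dec.
- by exists t => n _; exact: ht.
Qed.

Lemma coded_unique w t : X0 w ->
  (forall m, closure (P0 (w m)) (R0 m t)) -> coded_points P0 R0 w = [set t].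
Proof.
move=> Xw wt; have one u : coded_points P0 R0 w u -> u = t.
  move=> wu; apply: (@closure_determines w _ _ true 0) => m _.
  by split; [exact: coded_closure | exact: wt].
apply/seteqP; split=> u; first exact: one.
by move=> ->; have [v wv] := coded_nonempty Xw; rewrite -(one _ wv).
Qed.

Lemma X0_representation : symbolic_representation P0 R0 X0.
Proof.
move=> w Xw; have [t wt] := coded_nonempty Xw; exists t.
by apply: coded_unique => // m; exact: coded_closure.
Qed.

Definition factor0 w : torus R := xget 0 (coded_points P0 R0 w).

Lemma factor0_coded w : X0 w -> coded_points P0 R0 w = [set factor0 w].
Proof.
move=> Xw; have [t wt] := X0_representation Xw.
have : coded_points P0 R0 w (factor0 w) by apply: xgetPex; exists t; rewrite wt.
by rewrite wt => ->.
Qed.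

Lemma factor0_closure w m : X0 w -> closure (P0 (w m)) (R0 m (factor0 w)).
Proof. by move=> Xw; apply: coded_closure; rewrite factor0_coded. Qed.

Lemma factor0_unique w t : X0 w ->
  (forall m, closure (P0 (w m)) (R0 m t)) -> factor0 w = t.
Proof.
move=> Xw wt; have := coded_unique Xw wt; rewrite factor0_coded // => h.
by have : [set factor0 w] (factor0 w) by []; rewrite h.
Qed.

Lemma factor0_code p k : factor0 (code p k) = proj p.
Proof. by apply: factor0_unique; [exact: code_X0 | move=> m; exact: code_closure]. Qed.

Lemma factor0_shift n w : X0 w -> factor0 (shift_action n w) = R0 n (factor0 w).
Proof.
move=> Xw; apply: factor0_unique; first exact: X0_subshift.2.
by move=> m; rewrite -R0D; exact: factor0_closure.
Qed.

(** By compactness, the closed cylinders around w, which decrease to one point,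
    are eventually in any neighbourhood of it. *)
Lemma factor0_cylinder w (U : set (torus R)) : X0 w -> nbhs (factor0 w) U ->
  exists n, forall x, X0 x -> agree (ball1 n) w x -> U (factor0 x).
Proof.
move=> Xw; rewrite nbhsE => -[V [oV Vw] VU].
suff [n hn] : exists n, closure (cylinder P0 R0 n w) `<=` V.
  exists n => x Xx xw; apply/VU/hn.
  have -> : cylinder P0 R0 n w = cylinder P0 R0 n x.
    by apply/seteqP; split=> t h m mn; have := h m mn; rewrite /= xw.
  by have : coded_points P0 R0 x (factor0 x) by [rewrite factor0_coded]; apply.
apply: contrapT => /forallNP h.
have [||t ht] := @decreasing_cluster (torus R)
    (fun n => closure (cylinder P0 R0 n w) `&` ~` V) (@torus_compact R).
- move=> n; have /existsNP[t /not_implyP[tc tV]] := h n; by exists t.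
- move=> m n mn t [tc tV]; split=> // W Wt; have [x [xc xW]] := tc W Wt.
  by exists x; split=> //; exact: cylinder_dec xc.
have [tc tV] : coded_points P0 R0 w t /\ ~ V t.
  split.
    move=> n _ W Wt; have [x [[xc _] xW]] := ht n _ (nbhs_interior Wt).
    exact: xc xW.
  move=> Vt; have [x [[_ nV] xV]] := ht 0%N V (open_nbhs_nbhs (conj oV Vt)).
  exact: nV.
by move: tc; rewrite factor0_coded // => tE; rewrite tE in tV.
Qed.

Lemma factor0_continuous : {within X0, continuous factor0}.
Proof.
apply/subspace_continuousP => w Xw U /(factor0_cylinder Xw)[n hn].
apply: filterS (agree_nbhs w (ball1_finite n)) => x xw Xx; exact: hn.
Qed.

Lemma factor0_factor : factor_map X0 shift_action [set: torus R] R0 factor0.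
Proof.
split; first exact: factor0_continuous.
  apply/seteqP; split=> // t _; have [p <-] := proj_surj t.
  exists (code p (true, ord0)); [exact: code_X0 | exact: factor0_code].
by move=> n w; exact: factor0_shift.
Qed.

Lemma pattern_open S w : finite_set S -> open (\bigcap_(m in S) R0 m @^-1` P0 (w m)).
Proof.
move=> /finite_seqP[s ->]; elim: s => [|m s IH].
  by rewrite (_ : bigcap _ _ = setT); [exact: openT | apply/seteqP; split].
rewrite (_ : bigcap _ _ = R0 m @^-1` P0 (w m) `&`
    \bigcap_(j in [set` s]) R0 j @^-1` P0 (w j)).
  apply: openI => //.
  by apply: open_comp; [move=> ? _; exact: R0_continuous | exact: P0_open].
apply/seteqP; split=> [v h|v [h1 h2] j /=].
  by split=> [|j js]; apply: h; rewrite /= in_cons ?eqxx // js orbT.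
by rewrite in_cons => /orP[/eqP->|]; [exact: h1 | exact: h2].
Qed.

(** A pattern is realized on an open set V.  At a time n when the orbit of t is in
    V, the closed atoms of a configuration over t force its letters. *)
Lemma pattern_recurrence t x S : X0 x -> finite_set S -> exists n,
  forall w, X0 w -> factor0 w = t -> agree S x (shift_action n w).
Proof.
move=> Xx fS; have [u ux] := Xx S fS.
have oV := @pattern_open S x fS.
have [n nV _] := orbit_dense t 0 true oV (ex_intro _ u ux).
exists n => w Xw wt m Sm; apply/esym/(@P0_closure R _ _ (R0 m (R0 n t))).
  exact: nV.
by rewrite -R0D -wt; exact: factor0_closure.
Qed.

Lemma X0_minimal : minimal_system X0 shift_action.
Proof.
move=> B BX [w Bw] cB iB; apply/seteqP; split=> // x Xx.
apply/cB/closure_config => S fS.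
have [n hn] := pattern_recurrence (factor0 w) Xx fS.
by exists (shift_action n w); [exact: iB | apply: hn => //; exact: BX].
Qed.

Lemma X0_aperiodic : aperiodic X0.
Proof.
split; first by exists (code 0 (true, ord0)); exact: code_X0.
by move=> w n Xw wn; apply: (@R0_free R n (factor0 w)); rewrite -factor0_shift // wn.
Qed.

(** Adjacent letters are atoms of one point and of its translate. *)
Lemma X0_sub_Omega0 : X0 `<=` Omega0.
Proof.
move=> w Xw n; have pat (m : Z2) : exists t, P0 (w n) t /\ P0 (w (n + m)) (R0 m t).
  have [|t ht] := Xw [set n; n + m]; first by rewrite finite_setU; split; exact: finite_set1.
  exists (R0 n t); split; first by apply: ht; left.
  by rewrite -R0D [m + n]addrC; apply: (ht (n + m)); right.
split; apply/eqP.
  by have [t [t1 t2]] := pat (1, 0); exact: P0_right t1 t2.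
by have [t [t1 t2]] := pat (0, 1); exact: P0_up t1 t2.
Qed.

Lemma X0_compact : compact X0.
Proof. exact: subclosed_compact X0_subshift.1 (@config_compact 10) _. Qed.

End JeandelRaoCoding.

(** * The maximal equicontinuous factor *)

Section Factor.
Variable R : realType.
Local Notation phi := (phi R).
Local Notation R2 := (R * R)%type.
Local Notation proj := (@torus_proj R).
Local Notation R0 := (@R0 R).
Local Notation X0 := (@X0 R).
Local Notation config := (config 10).
Local Notation shift_action := (@shift_action 10).

Lemma torus_system : dynamical_system [set: torus R] R0.
Proof.
split=> //; first exact: torus_compact.
- by move=> t _; exact: R0_0.
- by move=> m n t _; exact: R0D.
- by move=> n; apply: continuous_subspaceT; exact: R0_continuous.
Qed.

Lemma shift_actionD m n (w : config) :
  shift_action (m + n) w = shift_action m (shift_action n w).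
Proof. by apply/funext => j; rewrite /Defs.shift_action addrA. Qed.

(** If w and x are over one point, then at some time n both show a given large
    pattern of w.  Their images are then close at the time n, hence close at all
    times by equicontinuity, in particular at the time 0. *)
Lemma equicontinuous_factor_fiber (Z : topologicalType) (U : Z2 -> Z -> Z)
    (theta : config -> Z) : equicontinuous_factor R X0 shift_action U theta ->
  forall w x, X0 w -> X0 x -> factor0 R w = factor0 R x -> theta w = theta x.
Proof.
have half (a b c e : R) : a <= b + c -> b < e / 2 -> c < e / 2 -> a < e by lra.
have nneg (a b : R) : 0 <= a + b -> a = b -> 0 <= a by lra.
move=> [_ [d dm deq] [thc _ the]] w x Xw Xx wx.
have [d0 dC dD dN] := dm.
have d_ge0 u v : 0 <= d u v.
  by apply: (nneg _ (d v u)); [rewrite -((d0 u u).2 erefl) | exact: dC].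
apply/d0/eqP; rewrite eq_le d_ge0 andbT leNgt; apply/negP => dpos.
have [r r0 hr] := deq _ dpos.
have : nbhs (theta w) [set y | d (theta w) y < r / 2].
  by apply/dN; exists (r / 2); rewrite ?divr_gt0.
move=> /((subspace_continuousP X0 theta).1 thc w Xw) /nbhs_agree[S fS hS].
have [n hn] := pattern_recurrence (factor0 R w) Xw fS.
have near u : X0 u -> factor0 R u = factor0 R w ->
    d (theta w) (theta (shift_action n u)) < r / 2.
  by move=> Xu uw; apply: (hS _ (hn u Xu uw)); exact: (X0_subshift R).2.
have cl : d (theta (shift_action n w)) (theta (shift_action n x)) < r.
  apply: half (dD _ (theta w) _) _ _; last exact: near x Xx (esym wx).
  by rewrite dC; exact: near.
have back u : X0 u -> U (- n) (theta (shift_action n u)) = theta u.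
  move=> Xu; rewrite -the; last exact: (X0_subshift R).2.
  rewrite -shift_actionD addNr; congr theta.
  by apply/funext => j; rewrite /Defs.shift_action addr0.
by have := hr _ _ cl (- n); rewrite !back // ltxx.
Qed.

(** The factor theta descends to a map psi on the torus, which is continuous because
    the images of closed sets of the compact set X0 are closed. *)
Lemma torus_maximal :
  maximal_equicontinuous_factor R X0 shift_action R0.
Proof.
exists (@factor0 R).
  split; [exact: torus_system | exact: R0_equicontinuous | exact: factor0_factor].
move=> Z U theta hth.
have fib := equicontinuous_factor_fiber hth.
have [_ [d dm _] [thc ths the]] := hth.
have lift t : exists w, X0 w /\ factor0 R w = t.
  have [_ fs _] := factor0_factor R.
  by have : [set: torus R] t by []; rewrite -fs => -[w Xw wt]; exists w.
pose psi t := theta (projT1 (cid (lift t))).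
have psiE w : X0 w -> theta w = psi (factor0 R w).
  by move=> Xw; rewrite /psi; case: cid => x /= [Xx xw]; exact: fib.
exists psi; split; last first.
  move=> psi' [_ h]; apply/funext => t; have [w [Xw <-]] := lift t.
  by rewrite -psiE // h.
split=> //; split.
- apply: continuous_subspaceT; apply/continuous_closedP => C cC.
  have -> : psi @^-1` C = factor0 R @` (X0 `&` theta @^-1` C).
    apply/seteqP; split=> [t Ct|_ [w [Xw Cw] <-]]; last by rewrite /= -psiE.
    by have [w [Xw wt]] := lift t; exists w => //; split=> //=; rewrite psiE // wt.
  apply: compact_closed; first exact: torus_hausdorff.
  apply: continuous_compact.
    exact: (continuous_subspaceW (@subIsetl _ _ _) (@factor0_continuous R)).
  have /continuous_closedP/(_ C cC)/closed_subspaceP[V cV VE] := thc.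
  rewrite setIC -VE; apply: (subclosed_compact _ (@X0_compact R)).
    by apply: closedI => //; exact: (X0_subshift R).1.
  exact: subIsetr.
- apply/seteqP; split=> // z _; have : [set: Z] z by [].
  by rewrite -ths => -[w Xw <-]; exists (factor0 R w) => //; rewrite -psiE.
- move=> n t _; have [w [Xw <-]] := lift t.
  rewrite -factor0_shift // -!psiE //; first exact: the.
  exact: (X0_subshift R).2.
Qed.

(** * A tiling with a fault line *)

(** Modulo the lattice the axis y = 0 is the upper side y = phi + 3 of the fundamental
    domain, and three triangles of P_6 hang from it over its whole length. *)
Lemma germ_fault (x : R) (k : direction) : k = (true, @Ordinal 4 3 isT) ->
  germ ((x, 0) : R2) k 6.
Proof.
move=> kE; have /andP[p1 p2] := phi_bounds R.
have [y [py y1 y2]] := proj_domain ((x, 0) : R2) true false.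
have y2E : y.2 = phi + 3.
  move: py => /proj_eq[m [n [_ /= h2]]].
  have [||n1|n1] := @int_between R 0 n (phi + 3); first by lra.
  - rewrite sub0r rmorphN !rmorphD /=; move: y2; rewrite h2 => /andP[? ?].
    by apply/andP; split; lra.
  - by move: y2; rewrite h2 n1 mulr0z mul0r addr0 ltxx.
  - by rewrite h2 n1 mulr1z mul1r add0r.
have sol (i : nat) : (i < 3)%N ->
    (forall L, L \in nth [::] (regions 6) i -> sided L y k) -> germ ((x, 0) : R2) k 6.
  move=> i3 Qy; exists (y - (x, 0)), (nth [::] (regions 6) i); split => //.
  - by rewrite projD projN py subrr.
  - by apply: mem_nth.
  - by move=> L /Qy; rewrite addrC subrK.
have sq := phi_sq R; move: y1 => /= /andP[y10 y1p].
have phi0 : 0 < phi by lra.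
have ltM u v : u < v -> phi * u < phi * v by rewrite ltr_pM2l.
have leM u v : u <= v -> phi * u <= phi * v by rewrite ler_pM2l.
have [xa|xa] := ltP y.1 (2 - phi).
  apply: (sol 0%N) => // L; rewrite !inE => LQ.
  have := ltM _ _ xa => h.
  by case/or3P: LQ => /eqP->; rewrite kE sidedE /hdir /hval /=
    !zval_pair !int_of_Z_lit ?y2E; lra.
have [xb|xb] := ltP y.1 1.
  apply: (sol 1%N) => // L; rewrite !inE => LQ.
  have := leM _ _ xa; have := ltM _ _ xb => h h'.
  by case/or3P: LQ => /eqP->; rewrite kE sidedE /hdir /hval /=
    !zval_pair !int_of_Z_lit ?y2E; lra.
apply: (sol 2%N) => // L; rewrite !inE => LQ.
have := leM _ _ xb; have := ltM _ _ y1p => h h'.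
by case/or3P: LQ => /eqP->; rewrite kE sidedE /hdir /hval /=
  !zval_pair !int_of_Z_lit ?y2E; lra.
Qed.

(** The row of height 0 of w is constant, so its lower half-plane can be shifted by
    (1, 0) without harm to the colors.  The result z agrees with w above the row,
    hence would code 0, and agrees below with the translate of w, hence would
    code its image. *)
Lemma X0_proper : X0 `<` Omega0.
Proof.
split; first exact: X0_sub_Omega0.
pose k : direction := (true, @Ordinal 4 3 isT); pose w := code (@GRing.zero R2) k.
have Xw : X0 w by exact: code_X0.
have wO : Omega0 w by exact: X0_sub_Omega0 Xw.
have row0 (i : int) : w (i, 0) = 6%N :> nat.
  apply/esym; apply: (@germ_uniq R (0 + vec R (i, 0)) k); last exact: code_germ.
  by rewrite add0r; exact: germ_fault.
pose z : config := fun m => if 1 <= m.2 then w m else w (m + (1, 0)).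
have zO : Omega0 z.
  move=> n; rewrite /z; split.
    rewrite /= addr0; case: ifP => _; first exact: (wO n).1.
    exact: (wO (n + (1, 0))).1.
  rewrite /=; case: ifP => n1.
    by rewrite (_ : 1 <= n.2 + 1) ?(wO n).2 //; lia.
  case: ifP => n2; last by rewrite addrAC; exact: (wO (n + (1, 0))).2.
  have n0 : n = (n.1, 0) by case: (n) n1 n2 => a b /= n1 n2; congr pair; lia.
  have wn : w n = 6%N :> nat by rewrite n0 row0.
  have wn' : w (n + (1, 0)) = 6%N :> nat.
    by rewrite n0 (_ : _ + _ = (n.1 + 1, 0)) ?row0.
  by have := (wO n).2; rewrite wn wn' => <-.
move=> sub; have Xz := sub z zO.
have e1 : factor0 R z = proj 0.
  apply: (@closure_determines R z _ _ true 1) => m m1.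
  split; first exact: factor0_closure.
  by rewrite /z m1; exact: code_closure.
have e2 : factor0 R z = R0 (1, 0) (proj 0).
  apply: (@closure_determines R z _ _ false 0) => m; rewrite /vertical_half => m0.
  split; first exact: factor0_closure.
  have -> : z m = w (m + (1, 0)) by rewrite /z ifF //; lia.
  by rewrite -R0D; exact: code_closure.
by have := @R0_free R _ _ (etrans (esym e2) e1).
Qed.

End Factor.

(** * The fibers of the factor map *)

Section Fibers.
Variable R : realType.
Local Notation phi := (phi R).
Local Notation R2 := (R * R)%type.
Local Notation proj := (@torus_proj R).
Local Notation P0 := (@P0 R).
Local Notation R0 := (@R0 R).
Local Notation X0 := (@X0 R).
Implicit Types (p d : R2) (k : direction).

Lemma golden_lin j p : golden p.1 -> golden p.2 -> golden (lin j p).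
Proof.
move=> g1 g2; have gp := golden_phi R; case: j => [|[|[|j]]] //=; apply: goldenB => //.
  exact: goldenM.
by apply: goldenM => //; apply: goldenD gp (golden1 R).
Qed.

Lemma golden_lattice p : proj p = 0 -> golden p.1 /\ golden p.2.
Proof.
rewrite -(proj0 R) => /proj_eq[m [n [-> ->]]]; rewrite !add0r.
split; first by exists n, m; rewrite addrC.
exists (n * 3), n; rewrite rmorphM /=; ring.
Qed.

(** The sum of Z^2 and of the lattice is Z[phi]^2. *)
Lemma lattice_golden (a b : R) : golden a -> golden b ->
  exists (m : Z2) (g : R2), proj g = 0 /\ vec R m + g = (a, b).
Proof.
move=> [a1 [a2 ->]] [b1 [b2 ->]].
exists (a1 - b2, b1 - b2 * 3), (b2%:~R + a2%:~R * phi, b2%:~R * (phi + 3)); split.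
  rewrite -(proj0 R); apply/proj_eq; exists a2, b2 => /=; split; ring.
by congr pair; rewrite /= !rmorphB ?rmorphM /=; ring.
Qed.

Lemma golden_unvec p m j : golden (lin j (p + vec R m)) -> golden (lin j p).
Proof.
rewrite linD => h; rewrite -(addrK (lin j (vec R m)) (lin j p)).
by apply: goldenB => //; apply: golden_lin; exact: golden_int.
Qed.

(** The sector only matters for the edges through p + g, and when such an edge is
    on a line of the kind j, then lin j p is in Z[phi]. *)
Lemma germ_side p k k' a :
  (forall j, golden (lin j p) -> dsign k j = dsign k' j) ->
  germ p k a -> germ p k' a.
Proof.
move=> h [g [Q [g0 Qa Qs]]]; exists g, Q; split=> // L LQ.
have := Qs L LQ; rewrite /sided; case/orP=> [->//|/andP[/eqP L0 hd]].
rewrite L0 eqxx /= orbC /=; move: hd; rewrite /hdir => /eqP->.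
have [g1 g2] := golden_lattice g0.
rewrite h ?eqxx //; case: L L0 {LQ} => [[j s] c] /= L0.
have E : lin j (p + g) = zval R c by case: s L0; lra.
by rewrite -(addrK (lin j g) (lin j p)) -linD E; apply: goldenB;
  [exact: golden_zval | exact: golden_lin].
Qed.

Lemma code_side p k k' :
  (forall j, golden (lin j p) -> dsign k j = dsign k' j) -> code p k = code p k'.
Proof.
move=> h; apply/funext => m; apply: val_inj.
apply: (@germ_uniq R (p + vec R m) k'); last exact: code_germ.
by apply: germ_side (code_germ p k m) => j /golden_unvec; exact: h.
Qed.

Lemma sector_ex d : (forall j, lin j d != 0) -> exists k, in_sector k d.
Proof.
move=> h; have := h 0; have := h 1; have := h 2; have := h 3; rewrite /lin.
case: d {h} => x y /=; rewrite !neq_lt => h3 h2 h1 h0.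
have /andP[p1 p2] := phi_bounds R; have phi0 : 0 < phi by lra.
have [x0|x0] : 0 < x \/ x < 0 by case/orP: h0; [right|left].
  have := mulr_gt0 phi0 x0 => px.
  have [y3|y3] : 0 < y - (phi + 1) * x \/ y - (phi + 1) * x < 0.
    by case/orP: h3; [right|left].
    by exists (true, @Ordinal 4 0 isT); case=> [|[|[|j]]]; rewrite /dsign /=; lra.
  have [y2|y2] : 0 < y - phi * x \/ y - phi * x < 0 by case/orP: h2; [right|left].
    by exists (true, @Ordinal 4 1 isT); case=> [|[|[|j]]]; rewrite /dsign /=; lra.
  have [y1|y1] : 0 < y \/ y < 0 by case/orP: h1; [right|left].
    by exists (true, @Ordinal 4 2 isT); case=> [|[|[|j]]]; rewrite /dsign /=; lra.
  by exists (true, @Ordinal 4 3 isT); case=> [|[|[|j]]]; rewrite /dsign /=; lra.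
have px : phi * x < 0 by rewrite pmulr_rlt0.
have [y3|y3] : y - (phi + 1) * x < 0 \/ 0 < y - (phi + 1) * x.
  by case/orP: h3; [left|right].
  by exists (false, @Ordinal 4 0 isT); case=> [|[|[|j]]]; rewrite /dsign /=; lra.
have [y2|y2] : y - phi * x < 0 \/ 0 < y - phi * x by case/orP: h2; [left|right].
  by exists (false, @Ordinal 4 1 isT); case=> [|[|[|j]]]; rewrite /dsign /=; lra.
have [y1|y1] : y < 0 \/ 0 < y by case/orP: h1; [left|right].
  by exists (false, @Ordinal 4 2 isT); case=> [|[|[|j]]]; rewrite /dsign /=; lra.
by exists (false, @Ordinal 4 3 isT); case=> [|[|[|j]]]; rewrite /dsign /=; lra.
Qed.

(** A small move off the four lines. *)
Lemma sector_perturb d e : 0 < e ->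
  exists2 d', `|d'| < e & exists k, in_sector k (d + d').
Proof.
move=> e0; pose k0 : direction := (true, ord0).
have [f f0 hf] := sided_near [seq (j, true, (0, 0)%BZ) | j <- iota 0 4] d k0.
have [|d'] := @sector_small R k0 (Num.min e f); first by rewrite lt_min e0.
rewrite lt_min => /andP[de df] dk; exists d' => //; apply: sector_ex.
have nz j : (j < 4)%N -> lin j (d + d') != 0.
  move=> j4; have [|+ _] := hf d' (j, true, (0, 0)%BZ) df dk.
    by apply/mapP; exists j => //; rewrite mem_iota.
  by rewrite /hval zval_pair !int_of_Z_lit mulr0z mul0r addr0 subr0.
by case=> [|[|[|j]]]; [exact: (nz 0%N)|exact: (nz 1%N)|exact: (nz 2%N)|exact: (nz 3%N)].
Qed.

Lemma codes_near p S : finite_set S -> exists2 e, 0 < e &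
  forall k d, `|d| < e -> in_sector k d ->
  forall m, S m -> P0 (code p k m) (R0 m (proj (p + d))).
Proof.
move=> fS; suff h (s : seq direction) : exists2 e, 0 < e & forall k, k \in s ->
    forall d, `|d| < e -> in_sector k d ->
    forall m, S m -> P0 (code p k m) (R0 m (proj (p + d))).
  by have [e e0 he] := h (enum {: direction}); exists e => // k; apply: he; rewrite mem_enum.
elim: s => [|k s [e e0 he]]; first by exists 1.
have [f f0 hf] := code_near p k fS.
exists (Num.min e f); first by rewrite lt_min e0.
move=> k'; rewrite in_cons => /orP[/eqP->|ks] d; rewrite lt_min => /andP[de df].
  exact: hf.
exact: he.
Qed.

(** Otherwise w differs from each of the eight codes of p at some place.  A point
    p + d near p that realizes w at these eight places can be chosen off the
    lines through p, in some sector k, where [code p k] is realized as well. *)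
Lemma fiber_code p w : X0 w -> factor0 R w = proj p -> exists k, w = code p k.
Proof.
move=> Xw wp; apply: contrapT => /forallNP nk.
have diff k : exists m, w m <> code p k m.
  by apply: contrapT => /forallNP h; apply: (nk k); apply/funext => m; exact: contrapT.
pose bad k := projT1 (cid (diff k)).
have [n hn] : exists n, forall k, ball1 n (bad k).
  have [n hn] := finite_sub_ball1 (finite_image bad (@finite_finset _ [set: direction])).
  by exists n => k; apply: hn; exists k.
have [e e0 he] := codes_near p (ball1_finite n).
have cl : closure (cylinder P0 R0 n w) (proj p).
  by have : coded_points P0 R0 w (proj p) by [rewrite factor0_coded // wp]; apply.
have [|t [tc [q qe qt]]] := cl (proj @` ball p e).
  apply: open_nbhs_nbhs; split; last by exists p => //; exact: ballxx.
  by apply: torus_proj_open; exact: ball_open.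
have : nbhs q (proj @^-1` cylinder P0 R0 n w).
  apply: torus_proj_continuous; rewrite /= qt; apply: open_nbhs_nbhs; split=> //.
  exact: pattern_open (ball1_finite n).
move=> /nbhs_ballP[f /= f0 hf].
have {}qe : `|q - p| < e by rewrite distrC; move: qe; rewrite -ball_normE.
have [|d' d's [k dk]] := @sector_perturb (q - p) (Num.min f (e - `|q - p|)).
  by rewrite lt_min f0 subr_gt0.
move: d's; rewrite lt_min => /andP[d'f d'e].
have d'q : cylinder P0 R0 n w (proj (p + (q - p + d'))).
  apply: hf; rewrite -ball_normE /= addrA [p + _]addrC subrK opprD addrA subrr sub0r.
  by rewrite normrN.
have dE : `|q - p + d'| < e.
  by rewrite (le_lt_trans (ler_normD _ _)) // addrC -ltrBrDr.
have m := he k _ dE dk (bad k) (hn k).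
have := P0_inj (d'q _ (hn k)) m.
by rewrite /bad; case: cid.
Qed.

Lemma golden_between (x l u : R) : l < u -> exists2 a, golden a & l < x + a < u.
Proof.
move=> lu; have [|a [b [ab _]]] := @golden_dense R ((l + u) / 2 - x) ((u - l) / 2) 0 true.
  by lra.
exists (a%:~R + b%:~R * phi); first by exists a, b.
by move: ab => /ltr_normlP[h1 h2]; apply/andP; split; lra.
Qed.

Lemma germ_at p m g z a i k : proj g = 0 -> p + (vec R m + g) = z ->
  (i < size (regions a))%N -> (forall L, L \in nth [::] (regions a) i -> sided L z k) ->
  germ (p + vec R m) k a.
Proof.
move=> g0 pz ia h; exists g, (nth [::] (regions a) i).
by split=> //; [exact: mem_nth | rewrite -addrA pz].
Qed.

Lemma sided_pos L p k : 0 < hval L p -> sided L p k.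
Proof. by rewrite /sided => ->. Qed.

(* The half-plane of the edge itself is decided by the sign hk of the sector. *)
Ltac solve_sided hk := first
  [ by apply: sided_pos; rewrite /hval /= !zval_pair !int_of_Z_lit; lra
  | by rewrite sidedE /hdir hk /hval /= !zval_pair !int_of_Z_lit; lra ].

Lemma pair_add (p : R2) (a b c d : R) : p.1 + a = c -> p.2 + b = d -> p + (a, b) = (c, d).
Proof. by case: p => x y /= <- <-. Qed.

(** Up to Z^2 and the lattice, p can be moved by any vector of Z[phi]^2.  As lin j p
    is in Z[phi], p can be moved into the line of one particular edge of the kind
    j, and, by density, into the edge itself; the germs on its two sides
    are different atoms. *)
Lemma germ_split p j : golden (lin j p) -> exists m a b, a != b /\
  forall k, germ (p + vec R m) k (if dsign k j then a else b).
Proof.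
have /andP[p1 p2] := phi_bounds R; have phi0 : 0 < phi by lra.
have sq := phi_sq R; have gp := golden_phi R; have g1 := golden1 R.
have ltM u v : u < v -> phi * u < phi * v by rewrite ltr_pM2l.
move=> gj; case: j gj => [|[|[|j]]] gj; rewrite /= in gj.
- have [b gb] := @golden_between p.2 1 2 ltac:(lra).
  have [m [g [g0 mg]]] := lattice_golden (goldenB g1 gj) gb.
  move=> /andP[b1 b2].
  have pz : p + (vec R m + g) = (1, p.2 + b).
    by rewrite mg; apply: pair_add => //; rewrite addrC subrK.
  exists m, 3, 9; split=> // k; case: ifP => hk.
    apply: (germ_at (i := 0) g0 pz) => // L; rewrite !inE => /or4P[] /eqP->; solve_sided hk.
  apply: (germ_at (i := 1) g0 pz) => // L; rewrite !inE => /or3P[] /eqP->; solve_sided hk.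
- have [b gb] := @golden_between p.1 1 phi ltac:(lra).
  have [m [g [g0 mg]]] := lattice_golden gb (goldenB g1 gj).
  move=> /andP[b1 b2]; have b1' := ltM _ _ b1; have b2' := ltM _ _ b2.
  have pz : p + (vec R m + g) = (p.1 + b, 1).
    by rewrite mg; apply: pair_add => //; rewrite addrC subrK.
  exists m, 9, 1; split=> // k; case: ifP => hk;
  apply: (germ_at (i := 2) g0 pz) => // L; rewrite !inE => /or3P[] /eqP->; solve_sided hk.
- have [b gb] := @golden_between p.1 1 phi ltac:(lra).
  have gc : golden (phi * b - phi - (p.2 - phi * p.1)).
    by apply: goldenB => //; apply: goldenB => //; exact: goldenM.
  have [m [g [g0 mg]]] := lattice_golden gb gc.
  move=> /andP[b1 b2]; have b1' := ltM _ _ b1; have b2' := ltM _ _ b2.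
  have pz : p + (vec R m + g) = (p.1 + b, phi * (p.1 + b) - phi).
    by rewrite mg; apply: pair_add => //; ring.
  exists m, 1, 0; split=> // k; case: ifP => hk;
  apply: (germ_at (i := 2) g0 pz) => // L; rewrite !inE => /or3P[] /eqP->; solve_sided hk.
- have [b gb] := @golden_between p.1 (phi - 1) 1 ltac:(lra).
  have gc : golden ((phi + 1) * b - phi - (p.2 - (phi + 1) * p.1)).
    apply: goldenB => //; apply: goldenB => //; apply: goldenM => //.
    exact: goldenD.
  have [m [g [g0 mg]]] := lattice_golden gb gc.
  move=> /andP[b1 b2]; have b1' := ltM _ _ b1; have b2' := ltM _ _ b2.
  have pz : p + (vec R m + g) = (p.1 + b, (phi + 1) * (p.1 + b) - phi).
    by rewrite mg; apply: pair_add => //; ring.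
  exists m, 1, 0; split=> // k; rewrite -[dsign k j.+3]/(dsign k 3).
  case: ifP => hk;
  apply: (germ_at (i := 1) g0 pz) => // L; rewrite !inE => /or3P[] /eqP->; solve_sided hk.
Qed.

(** A line of the kind j with lin j p in Z[phi] tells its two sides apart, by
    [germ_split]; the other lines carry no edges, and no germ sees them. *)
Lemma code_eqP p k k' : code p k = code p k' <->
  forall j, golden (lin j p) -> dsign k j = dsign k' j.
Proof.
split=> [E j /germ_split[m [a [b [ab h]]]]|]; last exact: code_side.
have e1 := germ_uniq (h k) (code_germ p k m).
have e2 := germ_uniq (h k') (code_germ p k' m).
rewrite E -e2 in e1; move: e1 ab.
by case: (dsign k j); case: (dsign k' j) => // ->; rewrite eqxx.
Qed.

(** The differences of the four slopes, infinity aside, are the units 1, phi and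
    phi + 1 = phi^2 of Z[phi]; so two of the values determine the coordinates of
    p within Z[phi]. *)
Lemma golden_two_lines p i j : (i < j < 4)%N -> golden (lin i p) -> golden (lin j p) ->
  forall l, golden (lin l p).
Proof.
move=> ij gi gj l.
have sq := phi_sq R; have gp := golden_phi R; have g1 := golden1 R.
have gp1 : golden (phi + 1) by exact: goldenD.
have gx : golden p.1.
  case: i j ij gi gj => [|[|[|i]]] [|[|[|[|j]]]] //= ij gi gj //; try by exfalso; clear - ij; lia.
  - have -> : p.1 = (phi - 1) * (p.2 - (p.2 - phi * p.1)) by ring: sq.
    by apply: goldenM; apply: goldenB.
  - have -> : p.1 = (1 + 1 - phi) * (p.2 - (p.2 - (phi + 1) * p.1)) by ring: sq.
    by apply: goldenM; apply: goldenB => //; exact: goldenD.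
  - have -> : p.1 = (p.2 - phi * p.1) - (p.2 - (phi + 1) * p.1) by ring.
    exact: goldenB.
apply: golden_lin => //.
case: j ij gj => [|[|[|j]]] /= ij gj //.
  by rewrite -(subrK (phi * p.1) p.2); apply: goldenD => //; exact: goldenM.
by rewrite -(subrK ((phi + 1) * p.1) p.2); apply: goldenD => //; exact: goldenM.
Qed.

Lemma card_eq_seq (T : eqType) (s : seq T) (A : set T) : uniq s ->
  (forall x, A x <-> x \in s) -> (A #= `I_(size s))%card.
Proof.
move=> us As; apply/card_set_bijP; exists (index^~ s); split.
- by move=> x /As xs; rewrite /= index_mem.
- move=> x y; rewrite !inE => /As xs /As ys xy.
  by rewrite -(nth_index x xs) xy nth_index.
- move=> i /= si; case: s us As si => [|x s] us As si //.
  exists (nth x (x :: s) i); last exact: index_uniq.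
  by apply/As; exact: mem_nth.
Qed.

Lemma card_fiber p (s : seq direction) n : size s = n ->
  uniq s -> {in s &, injective (code p)} ->
  (forall k, exists2 k', k' \in s & code p k = code p k') ->
  ((X0 `&` factor0 R @^-1` [set proj p]) #= `I_n)%card.
Proof.
move=> <- us inj cov; rewrite -(size_map (code p)).
apply: card_eq_seq; first by rewrite map_inj_in_uniq.
move=> w; split.
  move=> [Xw wp]; have [k ->] := fiber_code Xw wp.
  by have [k' ks ->] := cov k; exact: map_f.
by move=> /mapP[k _ ->]; split; [exact: code_X0 | exact: factor0_code].
Qed.

Lemma card_fiber1 p : (forall j, ~ golden (lin j p)) ->
  ((X0 `&` factor0 R @^-1` [set proj p]) #= `I_1)%card.
Proof.
move=> np; apply: (@card_fiber p [:: (true, ord0)]) => //.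
  by move=> k k'; rewrite !inE => /eqP-> /eqP->.
by move=> k; exists (true, ord0); rewrite ?mem_head //; apply: code_side => j /np.
Qed.

(** Only the side of the line i matters, and the sectors (true, 0) and (false, 0)
    are opposite, so that they represent both sides of every line. *)
Lemma card_fiber2 p i : (i < 4)%N -> golden (lin i p) ->
  (forall j, (j < 4)%N -> golden (lin j p) -> j = i) ->
  ((X0 `&` factor0 R @^-1` [set proj p]) #= `I_2)%card.
Proof.
move=> i4 gi one.
have dE b j : dsign (b, ord0) j = b by case: b j => -[|[|[|j]]].
have one' k k' : dsign k i = dsign k' i -> code p k = code p k'.
  move=> h; apply: code_side => j.
  case: j => [|[|[|j]]] gj.
  - by rewrite (one 0%N).
  - by rewrite (one 1%N).
  - by rewrite (one 2%N).
  - by have := one 3%N isT gj; move=> i3; move: h; rewrite -i3.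
apply: (@card_fiber p [:: (true, ord0); (false, ord0)]) => //.
  move=> [b k] [b' k']; rewrite !inE => h h' /code_eqP/(_ i gi).
  by move: h h' => /orP[] /eqP[-> ->] /orP[] /eqP[-> ->]; rewrite !dE.
move=> k; exists (dsign k i, ord0); last by apply: one'; rewrite dE.
by case: (dsign k i); rewrite !inE ?eqxx ?orbT.
Qed.

Lemma card_fiber8 p : (forall j, golden (lin j p)) ->
  ((X0 `&` factor0 R @^-1` [set proj p]) #= `I_8)%card.
Proof.
move=> gp; have s8 : size (enum {: direction}) = 8%N.
  by rewrite -cardE card_prod card_bool card_ord.
apply: (card_fiber s8); first exact: enum_uniq; last by move=> k; exists k; rewrite ?mem_enum.
move=> [b i] [b' i'] _ _ /code_eqP h.
have d j := h j (gp j); have := d 0; have := d 1; have := d 2; have := d 3.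
rewrite /dsign /=; case: i i' {h d} => [[|[|[|[|//]]]] hi] [[|[|[|[|//]]]] hi'];
  case: b b' => -[] //= *; congr pair; exact: val_inj.
Qed.

Lemma X0_fiber_cardinalities :
  fiber_cardinalities X0 [set: torus R] (@factor0 R) [set 1%N; 2%N; 8%N].
Proof.
have two (p : R2) i j : (i < 4)%N -> (j < 4)%N -> i != j ->
    golden (lin i p) -> golden (lin j p) -> forall l, golden (lin l p).
  move=> i4 j4; rewrite neq_ltn => /orP[] ij gi gj.
    by apply: (@golden_two_lines p i j) => //; rewrite ij.
  by apply: (@golden_two_lines p j i) => //; rewrite ij.
have hg : ~ golden (1 / 2 : R).
  by move=> /golden_half/eqP; apply; field.
have hgp : ~ golden (phi / 2 : R).
  move=> h; apply: hg; have -> : 1 / 2 = (phi - 1) * (phi / 2) by field: (phi_sq R).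
  by apply: goldenM h; apply: goldenB (golden1 R); exact: golden_phi.
split=> [t _|n].
  have [p <-] := proj_surj t.
  have [ex|nex] := EM (exists2 i, (i < 4)%N & golden (lin i p)); last first.
    exists 1%N; first by left; left.
    apply: card_fiber1 => j gj; apply: nex.
    by case: j gj => [|[|[|j]]] gj; [exists 0%N|exists 1%N|exists 2%N|exists 3%N].
  have [i i4 gi] := ex.
  have [one|] := EM (forall j, (j < 4)%N -> golden (lin j p) -> j = i).
    by exists 2%N; [left; right | exact: card_fiber2 gi one].
  move=> /existsNP[j /not_implyP[j4 /not_implyP[gj /eqP ji]]].
  by exists 8%N; [right | apply: card_fiber8; exact: two gj gi].
case=> [[->|->]|->].
(* The witnesses have respectively no value, one value and all values in Z[phi]. *)
- exists (proj (1 / 2, 1 / 2)) => //; apply: card_fiber1 => -[|[|[|j]]] //=.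
  + move=> h; apply: hg.
    have -> : 1 / 2 = - phi * (1 / 2 - phi * (1 / 2)) by field: (phi_sq R).
    by apply: goldenM h; apply: goldenN; exact: golden_phi.
  + move=> h; apply: hgp; have -> : phi / 2 = - (1 / 2 - (phi + 1) * (1 / 2)) by field.
    exact: goldenN.
- exists (proj (1 / 2, 0)) => //; apply: (@card_fiber2 _ 1) => //=; first exact: golden0.
  move=> j j4 gj; apply/eqP; apply: contrapT => /negP j1.
  apply: hg; have g1 : golden (lin 1 ((1 / 2, 0) : R2)) by exact: golden0.
  exact: (two _ j 1 j4 isT j1 gj g1 0%N).
- exists (proj (0, 0)) => //; apply: card_fiber8 => j.
  by apply: golden_lin => /=; exact: golden0.
Qed.

End Fibers.

(** * Lebesgue measure on the unit square *)

Section UnitMeasure.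
Variable R : realType.
Local Notation mR := (measurableTypeR R).
Local Notation leb := (@lebesgue_measure R).
Local Open Scope ereal_scope.

Lemma measurable_translation (a : R) (A : set mR) :
  measurable A -> measurable ((fun x : R => x + a)%R @^-1` A).
Proof.
move=> mA; rewrite -[X in measurable X]setTI.
have mf : measurable_fun [set: mR] (fun x : R => x + a)%R.
  apply: continuous_measurable_fun => x.
  by apply: cvgD; [exact: cvg_id | exact: cvg_cst].
exact: mf measurableT _ mA.
Qed.

Lemma lebesgue_translation (a : R) (A : set mR) : measurable A ->
  leb ((fun x : R => x + a)%R @^-1` A) = leb A.
Proof.
pose f (x : mR) : mR := (x + a)%R.
have mf : measurable_fun setT f by move=> _ B mB; rewrite setTI; exact: measurable_translation.
move=> mA; apply/esym.
have h := @lebesgue_measure_unique R (pushforward leb f).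
apply: (h mf _ A mA) => _ [[x y] _ <-] /=; rewrite /pushforward.
rewrite (_ : _ @^-1` _ = [set` `]x - a, y - a]%R]); last first.
  by apply/seteqP; split=> z; rewrite /f /= !in_itv /= ltrBlDr lerBrDr.
rewrite !lebesgue_measure_itv /= !lte_fin ltrD2r; case: ifP => // _.
by rewrite -!EFinB; congr EFin; ring.
Qed.

Definition unit_lebesgue : set mR -> \bar R := mrestr leb (@measurable_itv R `[0%R, 1%R[).
HB.instance Definition _ := Measure.on unit_lebesgue.

Lemma unit_lebesgue_setT : unit_lebesgue setT = 1.
Proof.
by rewrite /unit_lebesgue /mrestr setTI lebesgue_measure_itv /= lte01 oppr0 adde0.
Qed.

HB.instance Definition _ :=
  Measure_isProbability.Build _ _ _ unit_lebesgue unit_lebesgue_setT.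

(** Modulo 1 a translation exchanges two intervals. *)
Lemma unit_lebesgue_periodic (B : set mR) (a : R) : measurable B ->
  (forall x, B x <-> B (x + 1)%R) ->
  unit_lebesgue ((fun x : R => x + a)%R @^-1` B) = unit_lebesgue B.
Proof.
move=> mB per.
have perz (k : int) x : B x <-> B (x + k%:~R)%R.
  have pern (n : nat) y : B y <-> B (y + n%:R)%R.
    elim: n => [|n IH]; first by rewrite addr0.
    by rewrite -natr1 addrA -per.
  case: k => n; first exact: pern.
  rewrite NegzE rmorphN /= (pern n.+1 (x - _)%R).
  by rewrite -[X in (_ - X)%R]/(n.+1%:R) subrK.
pose r := (a - (Num.floor a)%:~R)%R.
have /andP[r0 r1] : (0 <= r < 1)%R.
  have /andP[h1 h2] := floor_itv a; rewrite /r subr_ge0 h1 /=.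
  by move: h2; rewrite rmorphD /= -ltrBlDl.
have -> : (fun x : R => x + a)%R @^-1` B = (fun x : R => x + r)%R @^-1` B.
  apply/seteqP; split=> x /=; rewrite (perz (Num.floor a) (x + r)%R) /r.
    by rewrite -addrA subrK.
  by rewrite -addrA subrK.
rewrite /unit_lebesgue /mrestr.
have mI b1 b2 (x y : R) : measurable (B `&` [set` Interval (BSide b1 x) (BSide b2 y)]).
  by apply: measurableI => //; exact: measurable_itv.
have -> : (fun x : R => x + r)%R @^-1` B `&` `[0%R, 1%R[ =
    (fun x : R => x + r)%R @^-1` (B `&` `[r, (1 + r)%R[).
  apply/seteqP; split=> x [Bx]; rewrite /= !in_itv /= => h; split=> //;
    by move: h; rewrite /= ?in_itv /= ?lerDr ?ltrD2r ?lerDr //.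
rewrite (lebesgue_translation r (mI _ _ _ _)).
have -> : B `&` `[r, (1 + r)%R[ = (B `&` `[r, 1%R[) `|` (B `&` `[1%R, (1 + r)%R[).
  rewrite -setIUr; congr (_ `&` _); apply/seteqP; split=> x; rewrite /= !in_itv /=.
    by case: (ltP x 1%R) => h /andP[-> ?]; [left|right].
  by case=> /andP[h1 h2]; apply/andP; split; lra.
have -> : B `&` `[0%R, 1%R[ = (B `&` `[r, 1%R[) `|` (B `&` `[0%R, r[).
  rewrite -setIUr; congr (_ `&` _); apply/seteqP; split=> x; rewrite /= !in_itv /=.
    by case: (ltP x r) => h /andP[? ->]; [right|left]; rewrite ?andbT.
  by case=> /andP[h1 h2]; apply/andP; split; lra.
rewrite !measureU; try exact: mI.
- congr (_ + _).
  transitivity (leb ((fun x : R => x + 1)%R @^-1` (B `&` `[1%R, (1 + r)%R[))).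
    by rewrite lebesgue_translation //; exact: mI.
  congr (leb _).
  apply/seteqP; split=> x [Bx]; rewrite /= !in_itv /= => h; split.
  + exact: (per x).2 Bx.
  + by move: h; lra.
  + exact: (per x).1 Bx.
  + by move: h; rewrite /= ?in_itv /=; lra.
- apply/seteqP; split=> // x [[_ /=]]; rewrite in_itv /= => h [_ /=].
  by rewrite in_itv /=; move: h; lra.
- apply/seteqP; split=> // x [[_ /=]]; rewrite in_itv /= => h [_ /=].
  by rewrite in_itv /=; move: h; lra.
Qed.

Definition square_measure := (unit_lebesgue \x unit_lebesgue)%E.
HB.instance Definition _ := Probability.on square_measure.

Lemma square_translation_measurable (a b : R) (C : set (mR * mR)) : measurable C ->
  measurable ((fun x : R * R => (x.1 + a, x.2 + b)%R) @^-1` C).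
Proof.
move=> mC; rewrite -[X in measurable X]setTI.
have tr (c : R) : measurable_fun [set: mR] (fun x : R => x + c)%R.
  by move=> _ B mB; rewrite setTI; exact: measurable_translation.
have mf : measurable_fun [set: mR * mR] (fun x : R * R => (x.1 + a, x.2 + b)%R : mR * mR).
  apply: measurable_fun_pair.
    exact: (measurableT_comp (tr a) (@measurable_fst _ _ mR mR)).
  exact: (measurableT_comp (tr b) (@measurable_snd _ _ mR mR)).
exact: mf measurableT _ mC.
Qed.

(** One coordinate at a time, by sections.  For the first coordinate the sections
    have to be taken in the other order, which is Fubini's theorem. *)
Lemma square_periodic (C : set (mR * mR)) (a b : R) : measurable C ->
  (forall x, C x <-> C (x.1 + 1, x.2)%R) -> (forall x, C x <-> C (x.1, x.2 + 1)%R) ->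
  square_measure ((fun x : R * R => (x.1 + a, x.2 + b)%R) @^-1` C) = square_measure C.
Proof.
move=> mC per1 per2.
have step2 : square_measure ((fun x : R * R => (x.1 + 0, x.2 + b)%R) @^-1` C) = square_measure C.
  apply: eq_integral => u _ /=.
  have mu := measurable_xsection u mC.
  rewrite -[RHS](unit_lebesgue_periodic b mu).
    by congr unit_lebesgue; apply/seteqP; split=> v; rewrite /xsection /= !inE /= addr0.
  by move=> v; rewrite /xsection /= !inE; exact: (per2 (u, v)).
pose D := (fun x : R * R => (x.1 + 0, x.2 + b)%R) @^-1` C.
have mD : measurable D by exact: square_translation_measurable.
have -> : (fun x : R * R => (x.1 + a, x.2 + b)%R) @^-1` C =
    (fun x : R * R => (x.1 + a, x.2 + 0)%R) @^-1` D.
  by apply/seteqP; split=> x; rewrite /D /= !addr0.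
rewrite -step2 -/D.
have sw (A : set (mR * mR)) : measurable A -> square_measure A =
    (unit_lebesgue \x^ unit_lebesgue)%E A.
  move=> mA; apply: product_measure_unique => // A1 A2 mA1 mA2.
  exact: product_measure2E.
rewrite (sw _ mD) sw; last exact: square_translation_measurable.
apply: eq_integral => v _ /=.
have mu := measurable_ysection v mD.
rewrite -[RHS](unit_lebesgue_periodic a mu).
  by congr unit_lebesgue; apply/seteqP; split=> u; rewrite /ysection /= !inE /= addr0.
move=> u; rewrite /ysection /D /= !inE /= !addr0; exact: (per1 (u, _)).
Qed.

End UnitMeasure.

(** * Haar measure on the torus *)

Section CountableBases.
Context d1 d2 (T1 : measurableType d1) (T2 : measurableType d2) (I J : countType).
Variables (F : I -> set T1) (G : J -> set T2).
Hypotheses (mF : forall i, measurable (F i)) (mG : forall j, measurable (G j)).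

(** Replaces a countable basis for a product of two Borel spaces, so that sets that
    are open for the product topology can be shown measurable. *)
Lemma box_measurable (W : set (T1 * T2)) :
  (forall p, W p -> exists i j, [/\ F i p.1, G j p.2 & F i `*` G j `<=` W]) ->
  measurable W.
Proof.
move=> h; pose H (k : I * J) : set (T1 * T2) :=
  if `[< F k.1 `*` G k.2 `<=` W >] then F k.1 `*` G k.2 else set0.
rewrite (_ : W = \bigcup_k H k).
  apply: countable_bigcupT_measurable => [|k]; first exact: countableP.
  by rewrite /H; case: asboolP => // _; exact: measurableX.
apply/seteqP; split=> [p Wp|p [k _]].
  have [i [j [Fp Gp FG]]] := h p Wp; exists (i, j) => //.
  by rewrite /H; case: asboolP.
by rewrite /H; case: asboolP => // FG; exact: FG.
Qed.
End CountableBases.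

Lemma borel_continuous (X Y : ptopologicalType) (f : X -> Y) : continuous f ->
  measurable_fun [set: borel X] (f : borel X -> borel Y).
Proof.
move=> /continuousP cf.
apply: (@measurability _ _ (borel X) (borel Y) setT f (@open Y)) => // _ [B oB <-].
by rewrite setTI; apply: sub_sigma_algebra; exact: cf.
Qed.

Lemma borel_open (X : ptopologicalType) (A : set (borel X)) : open (A : set X) -> measurable A.
Proof. by move=> oA; exact: sub_sigma_algebra. Qed.

Lemma borel_closed (X : ptopologicalType) (A : set (borel X)) :
  closed (A : set X) -> measurable A.
Proof.
move=> cA; rewrite -(setCK A); apply: measurableC; apply: borel_open.
exact: closed_openC.
Qed.

Section Haar.
Variable R : realType.
Local Notation phi := (phi R).
Local Notation R2 := (R * R)%type.
Local Notation proj := (@torus_proj R).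
Local Notation mR := (measurableTypeR R).
Local Notation bT := (borel (torus R)).

Definition rat_itv (i : rat * rat) : set mR := [set` `]ratr i.1, ratr i.2[].

Lemma rat_itv_measurable i : measurable (rat_itv i).
Proof. exact: measurable_itv. Qed.

Lemma rat_itv_ball (x e : R) : 0 < e ->
  exists i, rat_itv i x /\ rat_itv i `<=` [set y | `|x - y| < e].
Proof.
move=> e0.
have [r1] := @rat_in_itvoo R (x - e) x ltac:(lra).
have [r2] := @rat_in_itvoo R x (x + e) ltac:(lra).
rewrite !in_itv /= => /andP[h1 h2] /andP[h3 h4].
exists (r1, r2); rewrite /rat_itv /= in_itv /=; split; first by rewrite h4.
move=> y; rewrite /= in_itv /= => /andP[h5 h6].
by apply/ltr_normlP; split; lra.
Qed.

Lemma plane_open_measurable (W : set R2) : open W -> measurable (W : set (mR * mR)).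
Proof.
move=> oW; apply: (box_measurable rat_itv_measurable rat_itv_measurable) => p Wp.
have /nbhs_ballP[e /= e0 he] : nbhs p W by exact: open_nbhs_nbhs.
have [i [i1 i2]] := rat_itv_ball p.1 e0; have [j [j1 j2]] := rat_itv_ball p.2 e0.
exists i, j; split=> // x [/i2 h1 /j2 h2]; apply: he.
by rewrite -ball_normE /= pair_norm_lt; apply/andP.
Qed.

(** The linear map that sends Z^2 to the lattice, and the unit square to a
    fundamental domain. *)
Definition lattice_coord (x : R2) : R2 := (x.1 * phi + x.2, x.2 * (phi + 3)).
Definition torus_coord (x : mR * mR) : bT := proj (lattice_coord x).

Lemma lattice_coordD x y : lattice_coord (x + y) = lattice_coord x + lattice_coord y.
Proof. by congr pair; rewrite /=; ring. Qed.

Lemma lattice_coord_continuous : continuous lattice_coord.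
Proof.
move=> x.
have h1 : (fun y : R2 => y.1 * phi + y.2) @ x --> x.1 * phi + x.2.
  apply: cvgD; last exact: cvg_snd.
  by apply: cvgM; [exact: cvg_fst | exact: cvg_cst].
have h2 : (fun y : R2 => y.2 * (phi + 3)) @ x --> x.2 * (phi + 3).
  by apply: cvgM; [exact: cvg_snd | exact: cvg_cst].
exact: (cvg_pair h1 h2).
Qed.

Lemma torus_coord_continuous : continuous (torus_coord : R2 -> torus R).
Proof.
move=> x; apply: continuous_comp; first exact: lattice_coord_continuous.
exact: torus_proj_continuous.
Qed.

Lemma torus_coord_measurable : measurable_fun [set: mR * mR] torus_coord.
Proof.
apply: (@measurability _ _ _ bT setT torus_coord (@open (torus R))) => // _ [B oB <-].
rewrite setTI; apply: plane_open_measurable.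
by apply: open_comp => // x _; exact: torus_coord_continuous.
Qed.

HB.instance Definition _ := isMeasurableFun.Build _ _ _ _ torus_coord torus_coord_measurable.

Definition haar : probability bT R :=
  distribution (@square_measure R : probability _ R) torus_coord.

Lemma haarE (B : set bT) : haar B = square_measure (torus_coord @^-1` B).
Proof. by []. Qed.

Lemma torus_coord_surj t : exists x, torus_coord x = t.
Proof.
have /andP[p1 p2] := phi_bounds R.
have [y <-] := proj_surj t.
exists ((y.1 - y.2 / (phi + 3)) / phi, y.2 / (phi + 3)); congr proj.
by case: y => a b; congr pair; rewrite /=; field; lra.
Qed.

Lemma torus_coord_preimage_measurable (B : set bT) :
  measurable B -> measurable (torus_coord @^-1` B).
Proof.
by move=> mB; rewrite -[X in measurable X]setTI; exact: torus_coord_measurable.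
Qed.

Lemma haar_translation t (B : set bT) : measurable B ->
  haar ((fun x : torus R => x + t) @^-1` B) = haar B.
Proof.
move=> mB; have [a <-] := torus_coord_surj t; rewrite !haarE.
have per (z : R2) : proj (lattice_coord z) = 0 -> forall x : R2,
    (torus_coord @^-1` B) x <-> (torus_coord @^-1` B) (x + z).
  by move=> z0 x; rewrite /torus_coord /= lattice_coordD projD z0 addr0.
rewrite -(@square_periodic R (torus_coord @^-1` B) a.1 a.2).
- congr (square_measure); apply/seteqP; split=> x;
    by rewrite /torus_coord /= -projD -lattice_coordD; case: a x => ? ? [].
- exact: torus_coord_preimage_measurable.
- move=> x; have := @per (1, 0) _ x; case: x => x1 x2 /=.
  rewrite (_ : (x1, x2) + (1, 0) = (x1 + 1, x2)); last first.
    by congr pair; rewrite /= addr0.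
  apply; rewrite -(proj0 R); apply/proj_eq; exists 1, 0; rewrite /=; split; ring.
- move=> x; have := @per (0, 1) _ x; case: x => x1 x2 /=.
  rewrite (_ : (x1, x2) + (0, 1) = (x1, x2 + 1)); last first.
    by congr pair; rewrite /= addr0.
  apply; rewrite -(proj0 R); apply/proj_eq; exists 0, 1; rewrite /=; split; ring.
Qed.

Lemma haar_is_haar : haar_probability haar.
Proof.
move=> t B mB; rewrite -(haar_translation (- t) mB); congr (haar _).
apply/seteqP; split=> [_ [x Bx <-]|x Bx]; first by rewrite /= addrC addKr.
by exists (x - t) => //; rewrite addrC subrK.
Qed.

End Haar.

(** * Points whose orbit meets the boundary of the partition *)

Section SingularSet.
Variable R : realType.
Local Notation phi := (phi R).
Local Notation R2 := (R * R)%type.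
Local Notation proj := (@torus_proj R).
Local Notation P0 := (@P0 R).
Local Notation R0 := (@R0 R).
Local Notation mR := (measurableTypeR R).
Local Notation bT := (borel (torus R)).
Local Notation haar := (haar R).

Definition coord_line (j : nat) (c : R) : set (mR * mR) :=
  [set x | lin j (lattice_coord x) = c].

Lemma coord_line_measurable j c : measurable (coord_line j c).
Proof.
rewrite -(setCK (coord_line j c)); apply: measurableC; apply: plane_open_measurable.
have cont : continuous (fun x : R2 => lin j (lattice_coord x)).
  move=> x; apply: continuous_comp; first exact: lattice_coord_continuous.
  exact: lin_continuous.
have cl : closed ((fun x : R2 => lin j (lattice_coord x)) @^-1` [set y : R | y = c]).
  by apply: closed_comp; [move=> x _; exact: cont | exact: closed_eq].
exact: closed_openC cl.
Qed.

(** In the coordinates of the unit square, the j-th function still depends on the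
    second variable, so each vertical section of the line is one point. *)
Lemma coord_line_null j c : square_measure (coord_line j c) = 0%E.
Proof.
have /andP[p1 p2] := phi_bounds R.
have [b b0 hb] : exists2 b, b != 0 & forall u v : R,
    lin j (lattice_coord (u, v)) = lin j (lattice_coord (u, 0)) + b * v.
  case: j => [|[|[|j]]].
  - by exists 1; rewrite ?oner_eq0 // => u v; rewrite /lin /=; ring.
  - exists (phi + 3); first by apply/eqP; lra.
    by move=> u v; rewrite /lin /=; ring.
  - exists 3; first by apply/eqP; lra.
    by move=> u v; rewrite /lin /=; ring.
  - exists 2; first by apply/eqP; lra.
    by move=> u v; rewrite /lin /=; ring.
apply: integral0_eq => u _ /=.
rewrite (_ : xsection _ u = [set (c - lin j (lattice_coord (u, 0))) / b]).
  rewrite /unit_lebesgue /mrestr; apply/eqP; rewrite eq_le measure_ge0 andbT.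
  rewrite -(lebesgue_measure_set1 ((c - lin j (lattice_coord (u, 0))) / b)).
  apply: le_measure; rewrite ?inE; [|exact: measurable_set1|exact: subIsetl].
  by apply: measurableI; [exact: measurable_set1 | exact: measurable_itv].
apply/seteqP; split=> v; rewrite /xsection /= inE /coord_line /= (hb u v).
  by move=> <-; rewrite addrC addKr mulrC mulKf.
by move=> ->; rewrite mulrCA divff // mulr1 addrC subrK.
Qed.

Definition nongeneric : set (mR * mR) :=
  [set x | exists2 j, (j < 4)%N & golden (lin j (lattice_coord x))].

(** Z[phi] is countable. *)
Lemma nongeneric_null : (@square_measure R).-negligible nongeneric.
Proof.
pose F (k : nat) : set (mR * mR) := if @unpickle (nat * (int * int))%type k is Some i
  then coord_line i.1 (i.2.1%:~R + i.2.2%:~R * phi) else set0.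
apply: (@negligibleS _ _ _ _ (\bigcup_k F k)).
  move=> x [j _ [a [b hj]]]; exists (pickle (j, (a, b))) => //.
  by rewrite /F pickleK.
apply: negligible_bigcup => k; rewrite /F; case: unpickle => [i|].
  by apply/negligibleP; [exact: coord_line_measurable | exact: coord_line_null].
exact: negligible_set0.
Qed.

Definition boundary0 : set bT := ~` \bigcup_a P0 a.

Lemma boundary0_measurable : measurable boundary0.
Proof.
apply: measurableC; apply: borel_open; apply: bigcup_open => a _; exact: P0_open.
Qed.

(** If none of the lines through p carries edges, then p itself, and not only its
    neighbours in a sector, is inside the region of its germ. *)
Lemma generic_atom (p : R2) : (forall j, ~ golden (lin j p)) ->
  exists a, P0 a (proj p).
Proof.
move=> np; have [a [g [Q [g0 Qa Qs]]]] := germ_ex p (true, ord0).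
exists a; rewrite P0E; exists (p + g); last by rewrite projD g0 addr0.
exists Q => // L LQ; have /orP[//|/andP[/eqP L0 _]] := Qs L LQ.
have [g1 g2] := golden_lattice g0.
case: L L0 {LQ} => [[j s] c] /= L0; case: (np j).
have E : lin j (p + g) = zval R c by case: s L0; lra.
by rewrite -(addrK (lin j g) (lin j p)) -linD E; apply: goldenB;
  [exact: golden_zval | exact: golden_lin].
Qed.

Lemma boundary0_null : haar boundary0 = 0%E.
Proof.
rewrite haarE; apply/negligibleP.
  exact: torus_coord_preimage_measurable boundary0_measurable.
apply: negligibleS nongeneric_null => x hx; apply: contrapT => nx; apply: hx.
have [|a ha] := @generic_atom (lattice_coord x); last by exists a.
move=> j gj; apply: nx; case: j gj => [|[|[|j]]] gj;
  [exists 0%N|exists 1%N|exists 2%N|exists 3%N] => //.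
Qed.

Definition singular : set bT := \bigcup_(m : Z2) (R0 m @^-1` boundary0).

Lemma R0_preimage_measurable n (B : set bT) :
  measurable B -> measurable ((R0 n @^-1` B) : set bT).
Proof.
move=> mB; rewrite -[X in measurable X]setTI.
exact: (borel_continuous (@R0_continuous R n)) measurableT _ mB.
Qed.

Lemma singular_measurable : measurable singular.
Proof.
apply: countable_bigcupT_measurable; first exact: countableP.
by move=> m; apply: R0_preimage_measurable; exact: boundary0_measurable.
Qed.

Lemma haar_R0 n (B : set bT) : measurable B -> haar (R0 n @^-1` B) = haar B.
Proof. exact: haar_translation. Qed.

Lemma singular_null : haar singular = 0%E.
Proof.
apply/negligibleP; first exact: singular_measurable.
pose F (k : nat) : set bT := if @unpickle (int * int)%type k is Some m
  then R0 m @^-1` boundary0 else set0.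
apply: (@negligibleS _ _ _ _ (\bigcup_k F k)).
  by move=> t [m _ tm]; exists (pickle m); [exact: I | rewrite /F pickleK].
apply: negligible_bigcup => k; rewrite /F; case: unpickle => [m|].
  have mb := boundary0_measurable.
  apply/negligibleP; first exact: R0_preimage_measurable.
  by rewrite -[RHS]boundary0_null; exact: haar_R0.
exact: negligible_set0.
Qed.

Lemma singular_R0 n t : singular (R0 n t) <-> singular t.
Proof.
split=> -[m _ h]; last by exists (m - n) => //; rewrite /= -R0D subrK.
by exists (m + n) => //; rewrite /= R0D.
Qed.

Lemma regular_atom t m : ~ singular t -> exists a, P0 a (R0 m t).
Proof.
move=> nt; apply: contrapT => h; apply: nt; exists m => //.
by move=> [a _ ha]; apply: h; exists a.
Qed.

Lemma haar_regular : haar (~` singular) = 1%E.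
Proof.
by rewrite probability_setC ?singular_null ?sube0 //; exact: singular_measurable.
Qed.

(** * Unique ergodicity of the torus *)

Lemma invr_bound_le (e : R) (j : nat) : 0 < e -> (Num.bound e^-1 <= j)%N ->
  j.+1%:R^-1 <= e.
Proof.
move=> e0 h; rewrite -[leRHS]invrK lef_pV2 ?posrE ?invr_gt0 //.
apply: le_trans (ltW (archi_boundP _)) _; first by rewrite invr_ge0 ltW.
by rewrite ler_nat leqW.
Qed.

(** If n_j are elements of Z^2 whose images in the torus tend to t, then each
    point of O - t is in O - n_j for all large j, so that O - t is covered by the
    increasing sets E_N of the points in all O - n_j with j >= N, and each of
    them has measure at most that of O. *)
Lemma invariant_translation_le (mu : probability bT R) :
  (forall n (B : set bT), measurable B -> mu (R0 n @^-1` B) = mu B) ->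
  forall (t : torus R) (O : set (torus R)), open O ->
  (mu ((fun x : torus R => x + t)%R @^-1` O) <= mu O)%E.
Proof.
move=> inv t O oO.
have approx (j : nat) : exists n : Z2, torus_dist t (R0 n 0) < j.+1%:R^-1.
  have e0 : 0 < (j.+1%:R^-1 : R) by rewrite invr_gt0.
  have [_ _ _ dN] := torus_dist_metric R.
  have nt : nbhs t [set y | torus_dist t y < j.+1%:R^-1] by apply/dN; exists j.+1%:R^-1.
  have [n hn _] := @orbit_dense R 0 _ 0 true (@open_interior _ _)
    (ex_intro _ t (nbhs_singleton (nbhs_interior nt))).
  by exists n; exact: interior_subset hn.
pose s j := projT1 (cid (approx j)).
have sE j : torus_dist t (R0 (s j) 0) < j.+1%:R^-1 by rewrite /s; case: cid.
pose O_ j : set bT := R0 (s j) @^-1` O.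
have mO : measurable (O : set bT) by exact: borel_open.
have mO_ j : measurable (O_ j) by exact: R0_preimage_measurable.
pose E N : set bT := \bigcap_(j in [set j | (N <= j)%N]) O_ j.
have mE N : measurable (E N).
  by apply: bigcap_measurable => [|j _]; [exists N; rewrite /= leqnn | exact: mO_].
have sub : (fun x : torus R => x + t) @^-1` O `<=` \bigcup_N E N.
  move=> x xO; have [_ _ _ dN] := torus_dist_metric R.
  have /dN[e e0 he] : nbhs (x + t) O by exact: open_nbhs_nbhs.
  pose N := Num.bound e^-1.
  exists N => // j /= Nj; apply: he => /=.
  have -> : R0 (s j) x = x + R0 (s j) 0 by rewrite !R0E add0r.
  rewrite /torus_dist opprD addrACA subrr add0r.
  apply: lt_le_trans (sE j) _.
  exact: invr_bound_le.
have mEU : measurable (\bigcup_N E N) by apply: bigcup_measurable => N _; exact: mE.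
apply: (@le_trans _ _ (mu (\bigcup_N E N))).
  apply: le_measure => //; rewrite inE //.
  by apply: borel_open; apply: open_comp => // x _; exact: translate_continuous.
have h := @nondecreasing_cvg_mu _ _ _ mu E mE mEU.
have nd : nondecreasing_seq E.
  move=> m n mn; apply/subsetPset => x Ex j /= nj; apply: Ex; exact: leq_trans nj.
rewrite -(cvg_lim _ (h nd)) //; apply: lime_le; first by apply/cvg_ex; eexists; exact: h nd.
apply: nearW => N /=; rewrite -(inv (s N) O mO).
apply: le_measure; [rewrite inE; exact: mE | rewrite inE; exact: mO_ |].
by move=> x; apply; rewrite /= leqnn.
Qed.

Definition rat_box (i : (rat * rat) * (rat * rat)) : set R2 :=
  @rat_itv R i.1 `*` @rat_itv R i.2.

Lemma rat_box_open i : open (rat_box i).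
Proof.
apply: openI; (apply: open_comp; [move=> x _ | exact: itv_open]).
  exact: cvg_fst.
exact: cvg_snd.
Qed.

Lemma rat_box_nbhs (p : R2) (U : set R2) : nbhs p U ->
  exists i, rat_box i p /\ rat_box i `<=` U.
Proof.
move=> /nbhs_ballP[e /= e0 he].
have [i [i1 i2]] := rat_itv_ball p.1 e0; have [j [j1 j2]] := rat_itv_ball p.2 e0.
exists (i, j); split=> // x [/i2 h1 /j2 h2]; apply: he.
by rewrite -ball_normE /= pair_norm_lt; apply/andP.
Qed.

Lemma addition_measurable (O : set (torus R)) : open O ->
  measurable ([set z | O (z.1 + torus_coord z.2)] : set (bT * (mR * mR))).
Proof.
move=> oO.
apply: (@box_measurable _ _ _ _ _ _ (fun i => proj @` rat_box i : set bT)
  (fun i => rat_box i : set (mR * mR))) => [i|i|[x y] /= xy].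
- by apply: borel_open; apply: torus_proj_open; exact: rat_box_open.
- by apply: plane_open_measurable; exact: rat_box_open.
have [p px] := proj_surj x.
have nO : nbhs (p + lattice_coord y) (proj @^-1` O).
  apply: torus_proj_continuous; apply: open_nbhs_nbhs; split=> //.
  by rewrite projD px.
have add_near : (fun z : R2 * R2 => z.1 + z.2) @ (p, lattice_coord y) -->
    p + lattice_coord y.
  by apply: cvgD; [exact: cvg_fst | exact: cvg_snd].
have [[U V] /= [nU nV] UV] := add_near _ nO.
have [i [i1 i2]] := rat_box_nbhs nU.
have [j [j1 j2]] := rat_box_nbhs (lattice_coord_continuous nV).
exists i, j; split=> //; first by exists p.
move=> [_ v] /= [[u iu <-] jv].
have := UV (u, lattice_coord v); rewrite /= projD; apply.
by split; [exact: i2 | exact: j2].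
Qed.

Lemma invariant_translation (mu : probability bT R) :
  (forall n (B : set bT), measurable B -> mu (R0 n @^-1` B) = mu B) ->
  forall (t : torus R) (O : set (torus R)), open O ->
  mu ((fun x : torus R => x + t)%R @^-1` O) = mu O.
Proof.
move=> inv t O oO; apply/eqP; rewrite eq_le invariant_translation_le //=.
have oO' : open ((fun x : torus R => x + t) @^-1` O).
  by apply: open_comp => // x _; exact: translate_continuous.
apply: le_trans (@invariant_translation_le mu inv (- t) _ oO').
rewrite le_eqVlt; apply/orP; left; apply/eqP; congr (mu _).
by apply/seteqP; split=> x /=; rewrite subrK.
Qed.

(** The set W of the pairs (x, y) with x + y in O is measured in two ways.  As both
    measures are invariant under translation on open sets, its sections have Haar
    measure haar O in one direction, and measure mu O in the other. *)
Lemma haar_unique (mu : probability bT R) :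
  (forall n (B : set bT), measurable B -> mu (R0 n @^-1` B) = mu B) ->
  forall B : set bT, measurable B -> mu B = haar B.
Proof.
move=> inv.
have open_eq (O : set (torus R)) : open O -> mu O = haar O.
  move=> oO; pose W : set (bT * (mR * mR)) := [set z | O (z.1 + torus_coord z.2)].
  have mW : measurable W := addition_measurable oO.
  pose sq : probability _ R := @square_measure R.
  have E : (mu \x sq)%E W = (mu \x^ sq)%E W.
    apply: product_measure_unique => // A C mA mC; exact: product_measure2E.
  have <- : (mu \x^ sq)%E W = mu O.
    rewrite -[RHS]mule1 -(probability_setT sq) -integral_cst //.
    apply: eq_integral => y _ /=; rewrite -(invariant_translation inv (torus_coord y) oO).
    by congr (mu _); apply/seteqP; split=> x; rewrite /ysection /= !inE.
  rewrite -E.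
  transitivity (\int[mu]_(x in setT) (haar O))%E; last first.
    rewrite integral_cst; last exact: measurableT.
    by rewrite -[RHS]mule1; congr (_ * _)%E; exact: probability_setT.
  apply: eq_integral => x _; apply: etrans (haar_translation x (borel_open oO)).
  by rewrite haarE; congr (square_measure _); apply/seteqP; split=> y; rewrite /xsection /= !inE addrC.
apply: (@measure_unique _ _ bT (@open (torus R)) (fun=> setT)) => //.
- exact: openI.
- by move=> _; exact: openT.
- by apply/seteqP; split=> // x _; exists 0%N.
- by move=> _; exact: le_lt_trans (probability_le1 mu measurableT) (ltry 1).
Qed.

End SingularSet.

(** * The invariant measure of the subshift *)

(** For comparing events up to a set of measure 0. *)
Lemma probability_carried d (T : measurableType d) (R : realType)
    (mu : probability T R) (A C D : set T) :
  measurable A -> measurable C -> measurable D -> mu A = 1%E ->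
  A `&` C = A `&` D -> mu C = mu D.
Proof.
move=> mA mC mD A1 CD.
have nA : mu (~` A) = 0%E by rewrite probability_setC // A1 subee.
suff h B : measurable B -> mu B = mu (A `&` B) by rewrite h // [RHS]h // CD.
move=> mB; have mBA : measurable (B `\` A) by exact: measurableD.
have mBI : measurable (B `&` A) by exact: measurableI.
rewrite -[B in LHS](setUIDK B A) measureU //; last first.
  by apply/seteqP; split=> // x [[_ ?] []].
rewrite [X in (_ + X)%E](_ : _ = 0%E) ?adde0 ?[B `&` A]setIC //.
apply/eqP; rewrite eq_le measure_ge0 andbT -nA.
by apply: le_measure; rewrite ?inE //; exact: measurableC.
Qed.

Section ShiftTopology.
Variable k : nat.
Local Notation config := (config k).
Implicit Type w : config.

Lemma shift_continuous n : continuous (@shift_action k n).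
Proof.
move=> w U /nbhs_agree[S fS SU].
apply: filterS (agree_nbhs w (finite_image (fun m => m + n) fS)) => x xw.
by apply: SU => m Sm; apply: xw; exists m.
Qed.

Definition seq_agree (s : seq (Z2 * 'I_k.+1)) : set config :=
  [set w | forall i, i \in s -> w i.1 = i.2].

Lemma config_open_agree (O : set config) : open O ->
  O = \bigcup_(s in [set s | seq_agree s `<=` O]) seq_agree s.
Proof.
move=> oO; apply/seteqP; split=> [w Ow|w [s sO ws]]; last exact: sO.
have [S /finite_seqP[s ->] sO] := nbhs_agree (open_nbhs_nbhs (conj oO Ow)).
exists [seq (m, w m) | m <- s] => [x xs|[m a] /mapP[j _ [-> ->]] //].
by apply: sO => m ms; apply: (xs (m, w m)); apply/mapP; exists m.
Qed.

End ShiftTopology.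

Section UniqueErgodicity.
Variable R : realType.
Local Notation P0 := (@P0 R).
Local Notation R0 := (@R0 R).
Local Notation X0 := (@X0 R).
Local Notation factor0 := (@factor0 R).
Local Notation config := (config 10).
Local Notation shift_action := (@shift_action 10).
Local Notation bT := (borel (torus R)).
Local Notation bC := (borel config).
Local Notation haar := (haar R).
Local Notation singular := (@singular R).

(** The itinerary of t.  The letter ord0 is a default, used at the times when t is on
    the boundary of the partition; with it the coding commutes with the actions on
    the whole torus. *)
Definition coding (t : bT) : bC := fun m => xget ord0 [set a | P0 a (R0 m t)].

Lemma coding_atom t m a : P0 a (R0 m t) -> coding t m = a.
Proof.
move=> ha; apply: (@P0_inj R _ _ (R0 m t)) => //.
by apply: (@xgetPex _ ord0 [set a | P0 a (R0 m t)]); exists a.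
Qed.

Lemma coding_regular t m : ~ singular t -> P0 (coding t m) (R0 m t).
Proof. by move=> /(regular_atom m)[a ha]; rewrite (coding_atom ha). Qed.

Lemma coding_shift n t : coding (R0 n t) = shift_action n (coding t).
Proof. by apply/funext => m; rewrite /coding /Defs.shift_action -R0D. Qed.

Lemma coding_X0 t : ~ singular t -> X0 (coding t).
Proof. by move=> nt S _; exists t => m _; exact: coding_regular. Qed.

Lemma factor0_coding t : ~ singular t -> factor0 (coding t) = t.
Proof.
move=> nt; apply: factor0_unique => [|m]; first exact: coding_X0.
by apply: subset_closure; exact: coding_regular.
Qed.

(** An atom that contains a point is the only one with this point in its closure. *)
Lemma coding_factor0 w : X0 w -> ~ singular (factor0 w) -> coding (factor0 w) = w.
Proof.
move=> Xw nw; apply/funext => m; apply: (@P0_closure R _ _ (R0 m (factor0 w))).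
  exact: coding_regular.
exact: factor0_closure.
Qed.

Lemma coding_letter_measurable m a : measurable ([set t | coding t m = a] : set bT).
Proof.
have mP b : measurable (R0 m @^-1` P0 b : set bT).
  by apply: R0_preimage_measurable; apply: borel_open; exact: P0_open.
have [->|a0] := eqVneq a ord0; last first.
  rewrite (_ : mkset _ = R0 m @^-1` P0 a) //.
  apply/seteqP; split=> t; last exact: coding_atom.
  rewrite /= /coding; case: xgetP => [b _ hb <- //|_ /esym/eqP].
  by rewrite (negbTE a0).
rewrite (_ : mkset _ = ~` \bigcup_(b in [set b | b != ord0]) (R0 m @^-1` P0 b)).
  apply: measurableC; apply: fin_bigcup_measurable => [|b _]; last exact: mP.
  exact: finite_finset.
apply/seteqP; split=> [t t0 [b b0 /coding_atom]|t nt].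
  by rewrite t0 => b1; move/eqP: b0; apply.
rewrite /= /coding; case: xgetP => // b _ hb.
by apply: contrapT => b0; apply: nt; exists b => //; apply/eqP.
Qed.

Lemma coding_measurable : measurable_fun setT coding.
Proof.
apply: (@measurability _ _ _ bC setT coding (@open config)) => // _ [V oV <-].
rewrite setTI (config_open_agree oV) preimage_bigcup bigcup_mkcond.
apply: countable_bigcupT_measurable => [|s]; first exact: countableP.
case: ifP => // _.
elim: s => [|[m a] s IH].
  by rewrite (_ : _ @^-1` _ = setT) //; apply/seteqP; split.
rewrite (_ : _ @^-1` _ = [set t | coding t m = a] `&` coding @^-1` seq_agree s).
  by apply: measurableI => //; exact: coding_letter_measurable.
apply/seteqP; split=> [t h|t [h1 h2] [j b]].
  split; first by apply: (h (m, a)); rewrite in_cons eqxx.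
  by move=> i si; apply: h; rewrite in_cons si orbT.
by rewrite in_cons => /orP[/eqP[-> ->] //|]; exact: h2.
Qed.

HB.instance Definition _ := isMeasurableFun.Build _ _ _ _ coding coding_measurable.

Definition shift_measure : probability bC R := distribution haar coding.

Lemma shift_measureE (B : set bC) : shift_measure B = haar (coding @^-1` B).
Proof. by []. Qed.

Lemma coding_preimage_measurable (B : set bC) :
  measurable B -> measurable (coding @^-1` B).
Proof. by move=> mB; rewrite -[X in measurable X]setTI; exact: coding_measurable. Qed.

Lemma X0_measurable : measurable (X0 : set bC).
Proof. by apply: borel_closed; exact: (X0_subshift R).1. Qed.

Lemma shift_preimage_measurable n (B : set bC) :
  measurable B -> measurable (shift_action n @^-1` B : set bC).
Proof.
move=> mB; rewrite -[X in measurable X]setTI.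
exact: (borel_continuous (@shift_continuous 10 n)) measurableT _ mB.
Qed.

Lemma regular_measurable : measurable (~` singular).
Proof. by apply: measurableC; exact: singular_measurable. Qed.

Lemma factor0_measurable : measurable_fun (X0 : set bC) (factor0 : bC -> bT).
Proof.
apply: (@measurability _ _ bC bT X0 factor0 (@open (torus R))) => // _ [V oV <-].
have /continuousP/(_ V oV)/open_subspaceP[W oW WE] := @factor0_continuous R.
rewrite setIC -WE; apply: measurableI; last exact: X0_measurable.
exact: borel_open.
Qed.

Lemma shift_measure_X0 : shift_measure X0 = 1%E.
Proof.
have mX := X0_measurable.
rewrite shift_measureE -(probability_setT haar).
apply: (probability_carried regular_measurable _ _ (haar_regular R)) => //.
  exact: coding_preimage_measurable.
by rewrite setIT; apply/seteqP; split=> [t []|t nt] //; split=> //; exact: coding_X0.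
Qed.

Lemma shift_measure_invariant : invariant_probability X0 shift_action shift_measure.
Proof.
split=> [|n B mB]; first exact: shift_measure_X0.
rewrite !shift_measureE -(haar_R0 n (coding_preimage_measurable mB)).
by congr (haar _); apply/seteqP; split=> t; rewrite /= coding_shift.
Qed.

(** [factor0] is only shown to be measurable on X0. *)
Definition factor0_patch : bC -> bT := (factor0 : bC -> bT) \_ (X0 : set bC).

Lemma factor0_patchE w : X0 w -> factor0_patch w = factor0 w.
Proof. by move=> Xw; rewrite /factor0_patch /patch mem_set. Qed.

Lemma factor0_patch_measurable : measurable_fun setT factor0_patch.
Proof.
by apply/(measurable_restrictT _ X0_measurable); exact: factor0_measurable.
Qed.

HB.instance Definition _ :=
  isMeasurableFun.Build _ _ _ _ factor0_patch factor0_patch_measurable.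

(** The image of mu in the torus is the Haar measure, and w is the coding of its
    image for mu-almost every w. *)
Lemma shift_measure_unique : unique_invariant_probability X0 shift_action shift_measure.
Proof.
split=> [|mu [muX inv] C mC]; first exact: shift_measure_invariant.
have mX := X0_measurable.
have mp (B : set bT) : measurable B -> measurable (factor0_patch @^-1` B).
  by move=> mB; rewrite -[X in measurable X]setTI; exact: factor0_patch_measurable.
have toH (B : set bT) : measurable B -> mu (factor0_patch @^-1` B) = haar B.
  move=> mB; apply: (@haar_unique R (distribution mu factor0_patch)) => // n {}B {}mB.
  rewrite /distribution /pushforward -[RHS](inv n _ (mp _ mB)).
  apply: (probability_carried mX _ _ muX).
  - by apply: mp; exact: R0_preimage_measurable.
  - by apply: shift_preimage_measurable; exact: mp.
  - apply/seteqP; split=> w [Xw]; (have Xnw := (X0_subshift R).2 n w Xw);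
      by rewrite /= !factor0_patchE // factor0_shift.
have mS := mp _ regular_measurable.
have S1 : mu (X0 `&` factor0_patch @^-1` ~` singular) = 1%E.
  rewrite -[RHS](haar_regular R) -[RHS](toH _ regular_measurable).
  apply: (probability_carried mX _ mS muX); first exact: measurableI.
  by rewrite setIA setIid.
have mcC := coding_preimage_measurable mC.
rewrite shift_measureE -(toH _ mcC).
apply: (probability_carried _ mC _ S1); [exact: measurableI | exact: mp |].
by apply/seteqP; split=> w [[Xw]]; rewrite /= factor0_patchE // => nw h;
  do !split=> //; rewrite /= ?factor0_patchE // ?coding_factor0 // in h *.
Qed.

Lemma X0_isomorphic :
  isomorphic_mps X0 shift_action shift_measure [set: torus R] R0 haar.
Proof.
have mX := X0_measurable; have mS := regular_measurable.
have mh (C : set bT) : measurable C -> measurable (X0 `&` factor0 @^-1` C : set bC).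
  exact: factor0_measurable.
pose A : set bC := X0 `&` factor0 @^-1` (~` singular).
have mA : measurable A := mh _ mS.
have codA t : ~ singular t -> A (coding t).
  by move=> nt; split; [exact: coding_X0 | rewrite /= factor0_coding].
exists A, (~` singular), factor0; split.
- split=> [w []//|//||n w [Xw nw]].
    rewrite shift_measureE -(probability_setT haar).
    apply: (probability_carried mS _ _ (haar_regular R)) => //.
      exact: coding_preimage_measurable.
    by rewrite setIT; apply/seteqP; split=> [t []|t nt] //; split=> //; exact: codA.
  split; first exact: (X0_subshift R).2.
  by rewrite /= factor0_shift // singular_R0.
- split=> //; first exact: haar_regular.
  by move=> n t; rewrite /= singular_R0.
- split=> [w []//|w x /set_mem[Xw nw] /set_mem[Xx nx] wx|t nt].
    by rewrite -(coding_factor0 Xw nw) wx coding_factor0.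
  by exists (coding t); [exact: codA | exact: factor0_coding].
- by move=> n w [Xw _]; exact: factor0_shift.
split.
- exact: measurable_funS mX (@subIsetl _ _ _) factor0_measurable.
- move=> C CA mC; rewrite (_ : _ @` _ = ~` singular `&` coding @^-1` C).
    by apply: measurableI => //; exact: coding_preimage_measurable.
  apply/seteqP; split=> [_ [w Cw <-]|t [nt Ct]].
    by have [Xw nw] := CA w Cw; split=> //; rewrite /= coding_factor0.
  by exists (coding t) => //; exact: factor0_coding.
- move=> C mC; rewrite shift_measureE.
  apply: (probability_carried mS _ mC (haar_regular R)).
    apply: coding_preimage_measurable.
    rewrite (_ : _ `&` _ = A `&` (X0 `&` factor0 @^-1` C)); last first.
      by rewrite setIA /A [X0 `&` _ `&` X0]setIAC setIid.
    by apply: measurableI => //; exact: mh.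
  apply/seteqP; split=> t [nt].
    by move=> [_]; rewrite /= factor0_coding.
  by move=> Ct; split=> //; split; [exact: codA | rewrite /= factor0_coding].
Qed.

End UniqueErgodicity.

Theorem theorem1 (R : realType) :
  topological_partition (@P0 R) /\
  exists X0 : set (config 10),
    unique (is_symbolic_system (@P0 R) (@R0 R)) X0 /\
    [/\ [/\ subshift X0, X0 `<` Omega0, minimal_system X0 (@shift_action 10) &
            aperiodic X0],
        symbolic_representation (@P0 R) (@R0 R) X0,
        maximal_equicontinuous_factor R X0 (@shift_action 10) (@R0 R),
        exists f0 : config 10 -> torus R,
          [/\ forall w, X0 w -> coded_points (@P0 R) (@R0 R) w = [set f0 w],
              factor_map X0 (@shift_action 10) [set: torus R] (@R0 R) f0 &
              fiber_cardinalities X0 [set: torus R] f0 [set 1%N; 2%N; 8%N]] &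
        strictly_ergodic R X0 (@shift_action 10) /\
        exists (nu : probability (borel (config 10)) R)
               (lambda : probability (borel (torus R)) R),
          [/\ unique_invariant_probability X0 (@shift_action 10) nu,
              haar_probability lambda &
              isomorphic_mps X0 (@shift_action 10) nu
                             [set: torus R] (@R0 R) lambda]].
Proof.
split; first exact: P0_topological_partition.
exists (X0 R); split; first exact: symbolic_system_unique.
split.
- split; [exact: X0_subshift | exact: X0_proper | exact: X0_minimal |].
  exact: X0_aperiodic.
- exact: X0_representation.
- exact: torus_maximal.
- exists (@factor0 R); split; [exact: factor0_coded | exact: factor0_factor |].
  exact: X0_fiber_cardinalities.
split.
  split; last exact: X0_minimal.
  by exists (shift_measure R); exact: shift_measure_unique.
exists (shift_measure R), (haar R); split.
- exact: shift_measure_unique.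
- exact: haar_is_haar.
- exact: X0_isomorphic.
Qed.
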